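(* Let $\hat\sigma^2_N$ be the cosine series estimator of $\sigma^2$ defined in the context. Let $N=N_n$ be a sequence of positive integers with $N_n=o(n^{1/4})$, let $\beta>5/4$ and $Q,\bar Q>0$. Assume either Model (I) and $\alpha>3/4$, or Model (II) and $\alpha>3/2$. Then, as $n\to\infty$, $$\sup_{\sigma^2\in\Theta_s^b(\alpha,Q),\ \tau^2\in\Theta_s^b(\beta,\bar Q)}\operatorname{MISE}(\hat\sigma_N^2)=O\left(N^{-2\alpha}+Nn^{-1/2}\right).$$ Consequently, if $N^*=N^*_n$ is a sequence of positive integers of exact order $n^{1/(4\alpha+2)}$ (i.e. $c_1n^{1/(4\alpha+2)}\le N^*_n\le c_2n^{1/(4\alpha+2)}$ for some constants $0<c_1\le c_2<\infty$ and all $n$ large enough), then $$\sup_{\sigma^2\in\Theta_s^b(\alpha,Q),\ \tau^2\in\Theta_s^b(\beta,\bar Q)}\operatorname{MISE}(\hat\sigma_{N^*}^2)=O\left(n^{-\alpha/(2\alpha+1)}\right).$$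
   Context: **Models.** Let $n>16$, let $(W_t)_{t\in[0,1]}$ be a standard Brownian motion and $\epsilon_{1,n},\dots,\epsilon_{n,n}$ i.i.d. random variables, independent of $W$, with $E\epsilon_{i,n}=0$, $E\epsilon_{i,n}^2=1$, $E\epsilon_{i,n}^4<\infty$, whose law does not depend on $n$. Let $\sigma,\tau:[0,1]\to(0,\infty)$ be unknown deterministic functions. The observations are, for $i=1,\dots,n$: - Model (I): $Y_{i,n}=\int_0^{i/n}\sigma(s)\,dW_s+\tau(i/n)\epsilon_{i,n}$; - Model (II): $Y_{i,n}=\sigma(i/n)W_{i/n}+\tau(i/n)\epsilon_{i,n}$. **Smoothness classes.** For $\alpha,C>0$, $\Theta_s(\alpha,C)$ is the set of $f\in L^2[0,1]$ of the form $f(x)=\theta_0+2\sum_{i\ge1}\theta_i\cos(i\pi x)$ with $\sum_{i\ge1}i^{2\alpha}\theta_i^2\le C$. For $0<l<u<\infty$, $\Theta_s^b(\alpha,C)=\Theta_s^b(\alpha,C,[l,u])=\{f\in\Theta_s(\alpha,C): l\le f\le u\}$. For $\sigma^2$ the bounds are fixed constants $l=\sigma_{\min}$, $u=\sigma_{\max}$; for $\tau^2$ they are fixed constants $l=\tau_{\min}$, $u=\tau_{\max}$. (For smoothness index $>1/2$ such functions have a continuous representative, which is used; $\sigma,\tau$ are the positive square roots.) **Estimator.** $\log$ is the binary logarithm and $[x]$ the integer part of $x$. Let $f_0=1$ and $f_k(x)=\sqrt2\cos(k\pi x/2)$ for $k\ge1$. Let $\Delta Y^k\in\mathbb R^{n-1}$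 have components $(Y_{i+1,n}-Y_{i,n})f_k(i/n)$, $i=1,\dots,n-1$. Let $D$ be the $(n-1)\times(n-1)$ matrix with $D_{i,j}=\sqrt{2/n}\,\sin(ij\pi/n)$ and $\lambda_i=4\sin^2(i\pi/(2n))$. Let $J_n^\tau$ and $J_n$ be the $(n-1)\times(n-1)$ diagonal matrices with $(J_n^\tau)_{i,i}=(n-n/\log n)^{-1}\lambda_i^{-1}$ for $[n/\log n]\le i\le n-1$ and $0$ otherwise, and $(J_n)_{i,i}=\sqrt n$ for $[n^{1/2}]+1\le i\le 2[n^{1/2}]$ and $0$ otherwise. Put $\hat t_{k,0}=(\Delta Y^k)^tDJ_n^\tau D^t\Delta Y^k$, $$\hat s_{k,0}=(\Delta Y^k)^tDJ_nD^t\Delta Y^k-\frac{7\pi^2}{3}\hat t_{k,0},\qquad \hat\sigma_N^2(t)=\hat s_{0,0}+2\sum_{i=1}^N(\hat s_{i,0}-\hat s_{0,0})\cos(i\pi t).$$ $\operatorname{MISE}(\hat\sigma^2_N)=E\int_0^1(\hat\sigma_N^2(t)-\sigma^2(t))^2dt$, the expectation being under the parameters $(\sigma,\tau)$. *)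

(* Defs.v *)
From HB Require Import structures.
From mathcomp Require Import all_boot all_order all_algebra.
From mathcomp Require Import all_classical all_reals all_analysis.
Import Order.TTheory GRing.Theory Num.Theory.
Import numFieldNormedType.Exports.

Set Implicit Arguments.
Unset Strict Implicit.
Unset Printing Implicit Defensive.

Local Open Scope classical_set_scope.
Local Open Scope ring_scope.

Section independence.
Context {d : measure_display} {T : measurableType d} {R : realType}.
Variable P : probability T R.

Definition mutually_independent {I : choiceType} (D : set I)
    (X : I -> T -> R) : Prop :=
  forall (s : seq I) (B : I -> set R),
    uniq s -> (forall i, i \in s -> D i) -> (forall i, measurable (B i)) ->
    P (\big[setI/setT]_(i <- s) (X i @^-1` B i)) =
    (\prod_(i <- s) P (X i @^-1` B i))%E.

Definition sigma_process {I : Type} (D : set I) (X : I -> T -> R) :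
    set (set T) :=
  <<s \bigcup_(i in D) preimage_set_system setT (X i) measurable >>.

Definition independent_sigma (F G : set (set T)) : Prop :=
  forall A B, F A -> G B -> P (A `&` B) = (P A * P B)%E.

Definition identically_distributed (X Y : {RV P >-> R}) : Prop :=
  forall B, measurable B -> distribution P X B = distribution P Y B.

End independence.

Section model.
Context {d : measure_display} {T : measurableType d} {R : realType}.
Variable P : probability T R.

(* The values [W t] for [t] outside [0, 1] are irrelevant. [normal_prob] is
   parametrized by the standard deviation. *)
Definition standard_brownian_motion (W : R -> {RV P >-> R}) : Prop :=
  [/\ {ae P, forall w, W 0 w = 0},
      (forall (k : nat) (t : nat -> R),
         0 <= t 0%N -> t k <= 1 ->
         (forall j, (j < k)%N -> t j <= t j.+1) ->
         mutually_independent P `I_k (fun j w => W (t j.+1) w - W (t j) w)),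
      (forall s t (B : set R), 0 <= s -> s < t -> t <= 1 -> measurable B ->
         P ((fun w => W t w - W s w) @^-1` B) =
         normal_prob 0 (Num.sqrt (t - s)) B) &
      {ae P, forall w, {within `[0, 1], continuous (fun t => W t w)}}].

(* [((a, b), c)] stands for the step [c * \1_(]a, b])]; the intervals of a
   sequence of steps may overlap. *)
Definition step_fun (s : seq (R * R * R)) (x : R) : R :=
  \sum_(p <- s) p.2 * \1_(`]p.1.1, p.1.2]%classic) x.

Definition step_integral (W : R -> T -> R) (s : seq (R * R * R)) (w : T) : R :=
  \sum_(p <- s) p.2 * (W p.1.2 w - W p.1.1 w).

(* [I] is a version of the Wiener integral of the deterministic function [f]
   over [0, t], i.e. the L^2(P)-limit of the integrals of step functions which
   converge to [f] in L^2[0, t]; it is determined up to P-null sets. *)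
Definition is_wiener_integral (W : R -> {RV P >-> R}) (f : R -> R) (t : R)
    (I : {RV P >-> R}) : Prop :=
  exists s : nat -> seq (R * R * R),
  [/\ (forall k p, p \in s k -> [/\ 0 <= p.1.1, p.1.1 <= p.1.2 & p.1.2 <= t]),
      (\int[lebesgue_measure]_(x in `[0%R, t])
         ((step_fun (s k) x - f x) ^+ 2)%:E)%E @[k --> \oo] --> 0%E &
      (\int[P]_w ((step_integral W (s k) w - I w) ^+ 2)%:E)%E
         @[k --> \oo] --> 0%E].

(* The noise array [eps n i], used for [1 <= i <= n]. Nothing is assumed on the
   joint law of different rows. *)
Definition noise_array (W : R -> {RV P >-> R})
    (eps : nat -> nat -> {RV P >-> R}) : Prop :=
  [/\ (forall n, (16 < n)%N ->
         mutually_independent P [set i | (1 <= i <= n)%N] (eps n)),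
      (forall n, (16 < n)%N ->
         independent_sigma P
           (sigma_process [set i | (1 <= i <= n)%N] (eps n))
           (sigma_process `[0, 1] W)),
      (forall n m i j, (16 < n)%N -> (16 < m)%N ->
         (1 <= i <= n)%N -> (1 <= j <= m)%N ->
         identically_distributed (eps n i) (eps m j)) &
      (forall n i, (16 < n)%N -> (1 <= i <= n)%N ->
         [/\ ('E_P[eps n i] = 0)%E,
             ('E_P[fun w => (eps n i w ^+ 2)%R] = 1)%E &
             ('E_P[fun w => (eps n i w ^+ 4)%R] < +oo)%E])].

Inductive model := ModelI | ModelII.

(* [Y i], used for [1 <= i <= n], are the observations for the squared
   parameters [s2] = sigma^2 and [t2] = tau^2. *)
Definition observations (m : model) (W : R -> {RV P >-> R})
    (eps : nat -> nat -> {RV P >-> R}) (s2 t2 : R -> R) (n : nat)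
    (Y : nat -> T -> R) : Prop :=
  forall i, (1 <= i <= n)%N ->
  let x : R := i%:R / n%:R in
  match m with
  | ModelI => exists2 X : {RV P >-> R},
      is_wiener_integral W (fun r => Num.sqrt (s2 r)) x X &
      forall w, Y i w = X w + Num.sqrt (t2 x) * eps n i w
  | ModelII =>
      forall w, Y i w = Num.sqrt (s2 x) * W x w + Num.sqrt (t2 x) * eps n i w
  end.

End model.

Section smoothness_classes.
Context {R : realType}.

Definition cosine_sum (theta : nat -> R) (m : nat) (x : R) : R :=
  theta 0%N + 2 * \sum_(1 <= i < m) theta i * cos (i%:R * pi * x).

(* Membership in L^2[0, 1], and the cosine expansion understood in L^2[0, 1] *)
Definition Theta_s (alpha C : R) : set (R -> R) := [set f : R -> R |
  [/\ measurable_fun (`[0, 1] : set R) f,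
      lebesgue_measure.-integrable `[0, 1] (fun x => (f x ^+ 2)%:E) &
      exists2 theta : nat -> R,
        (\int[lebesgue_measure]_(x in `[0%R, 1%R])
           ((f x - cosine_sum theta m x) ^+ 2)%:E)%E @[m --> \oo] --> 0%E &
        (\sum_(1 <= i <oo) (i%:R `^ (2 * alpha) * theta i ^+ 2)%:E <= C%:E)%E]].

(* The elements are the continuous representatives (meant for alpha > 1/2), so
   that the bounds hold everywhere on [0, 1]. *)
Definition Theta_sb (alpha C l u : R) : set (R -> R) := [set f : R -> R |
  [/\ Theta_s alpha C f, {within `[0, 1], continuous f} &
      forall x, 0 <= x <= 1 -> l <= f x <= u]].

End smoothness_classes.

Section estimator.
Context {R : realType}.

Definition log2 (x : R) : R := ln x / ln 2.

Definition cos_basis (k : nat) (x : R) : R :=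
  if k == 0%N then 1 else Num.sqrt 2 * cos (k%:R * pi * x / 2).

(* Entries of vectors and matrices are numbered from 1 in the formulas and from
   0 in ['I_n.-1], whence the successors. *)
Definition increments (n : nat) (y : nat -> R) (k : nat) : 'cV[R]_n.-1 :=
  \col_i ((y i.+2 - y i.+1) * cos_basis k (i.+1%:R / n%:R)).

Definition sine_mx (n : nat) : 'M[R]_n.-1 :=
  \matrix_(i, j)
    (Num.sqrt (2 / n%:R) * sin (i.+1%:R * j.+1%:R * pi / n%:R)).

Definition lambda (n i : nat) : R := 4 * sin (i%:R * pi / (2 * n%:R)) ^+ 2.

Definition J_tau (n : nat) : 'M[R]_n.-1 :=
  diag_mx (\row_i
    if (Num.truncn (n%:R / log2 n%:R) <= i.+1)%N
    then (n%:R - n%:R / log2 n%:R)^-1 * (lambda n i.+1)^-1 else 0).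

Definition J (n : nat) : 'M[R]_n.-1 :=
  let m := Num.truncn (Num.sqrt n%:R : R) in
  diag_mx (\row_i
    if (m.+1 <= i.+1 <= 2 * m)%N then Num.sqrt n%:R else 0).

Definition quad_form (n : nat) (A : 'M[R]_n.-1) (v : 'cV[R]_n.-1) : R :=
  (v^T *m sine_mx n *m A *m (sine_mx n)^T *m v) 0 0.

Definition t_hat (n : nat) (y : nat -> R) (k : nat) : R :=
  quad_form (J_tau n) (increments n y k).

Definition s_hat (n : nat) (y : nat -> R) (k : nat) : R :=
  quad_form (J n) (increments n y k) - 7 * pi ^+ 2 / 3 * t_hat n y k.

Definition sigma2_hat (n N : nat) (y : nat -> R) (t : R) : R :=
  s_hat n y 0 +
  2 * \sum_(1 <= i < N.+1) (s_hat n y i - s_hat n y 0) * cos (i%:R * pi * t).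

End estimator.

Section risk.
Context {d : measure_display} {T : measurableType d} {R : realType}.
Variable P : probability T R.

Definition MISE (s2 : R -> R) (n N : nat) (Y : nat -> T -> R) : \bar R :=
  (\int[P]_w \int[lebesgue_measure]_(t in `[0%R, 1%R])
     ((sigma2_hat n N (fun i => Y i w) t - s2 t) ^+ 2)%:E)%E.

(* In the first model [Y] ranges over all versions of the Wiener integrals;
   these are almost surely equal and have the same risk. *)
Definition sup_MISE (m : model) (W : R -> {RV P >-> R})
    (eps : nat -> nat -> {RV P >-> R})
    (Theta_sigma Theta_tau : set (R -> R)) (n N : nat) : \bar R :=
  ereal_sup [set r | exists s2 t2 Y,
    [/\ Theta_sigma s2, Theta_tau t2, observations m W eps s2 t2 n Y &
        r = MISE s2 n N Y]].

(* The finiteness is needed because [fine] maps infinite values to 0. *)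
Definition ebigO (u : nat -> \bar R) (v : nat -> R) : Prop :=
  (\forall n \near \oo, u n \is a fin_num) /\
  (fun n => fine (u n)) =O_\oo v.

End risk.

(* Main.v *)
Require Import Defs.
From HB Require Import structures.
From mathcomp Require Import all_boot all_order all_algebra.
From mathcomp Require Import all_classical all_reals all_analysis.
From mathcomp Require Import measurable_realfun ring lra zify.
Import Order.TTheory GRing.Theory Num.Theory.
Import numFieldNormedType.Exports.

Set Implicit Arguments.
Unset Strict Implicit.
Unset Printing Implicit Defensive.

Local Open Scope classical_set_scope.
Local Open Scope ring_scope.

(** Multiplying the increments of the data by [cos_basis k] and passing to the sine basis gives the
    numbers [spectral_stat], which are linear in independent centred variables: Brownian increments
    and observation errors. Suppose that the increments of the signal have a covariance with
    [cell_mean] (the integrals of sigma^2 over the cells of the grid) on the diagonal, up to entries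
    O(n^-2). The square of a sine is a constant minus a cosine of double frequency, and the square
    of a difference of consecutive sines is, up to the factor [lambda], a constant plus such a
    cosine. Hence the i-th statistic has variance [signal_level / n + lambda n i * noise_level] up
    to oscillating terms, where [signal_level] is a Riemann sum for the integral of sigma^2 times
    the square of [cos_basis k].

    The weights of [J] turn this into [signal_level] plus 7 pi^2 / 3 times [noise_level], because
    the weighted sum of the [lambda] tends to that constant ([J_lambda_sum]). At the high
    frequencies of [J_tau] the noise dominates, and dividing by [lambda] estimates [noise_level]; so
    [s_hat] removes the bias. The oscillating terms are coefficients with respect to orthogonal
    cosines, small by Bessel and Cauchy-Schwarz ([J_mean_error], [Jtau_mean_error]). The variance of
    a quadratic form in variables of bounded kurtosis is at most a multiple of the squared Frobenius
    norm of a Gram matrix ([quadratic_variance], [gram_frobenius]), whose spectral norm is governed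
    by the largest [w i * (lambda n i + 1 / n)] ([weighted_quadratic_le]). Both errors have mean
    square O(n^(-1/2)), uniformly for k <= n^(1/4) ([s_hat_error]).

    Since the square of [cos_basis k] is 1 + cos(k pi x) for k >= 1, the estimated quantity is the
    sum of the cosine coefficients 0 and k of sigma^2 ([signal_level_coef]). Orthogonality of the
    cosines then splits the risk into a tail, at most 2 Q N^(-2 alpha) on the smoothness class, and
    the equivalent of at most 9 N coefficient errors of order n^(-1/2) ([MISE_le]).

    It remains to put each model into this linear form. In Model (II), alpha > 3/2 makes sigma^2
    Lipschitz ([Theta_lipschitz]), so that an increment of the signal is sigma times a Brownian
    increment plus an O(1/n) multiple of W, which perturbs the covariances by O(n^-2)
    ([brownian_s_hat_error]). In Model (I) the Wiener integrals are replaced by integrals of step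
    functions over one common grid, whose covariances are close to the required ones ([step_grid]);
    the bound does not depend on the approximation and passes to the limit by Fatou's lemma
    ([wiener_s_hat_error]). A cut-off of order n^(1/(4 alpha + 2)) balances the two terms of the
    risk. *)

(** * Inequalities for finite sums: Cauchy-Schwarz, Parseval, Bessel, Gram matrices *)

Section finite_sums.
Context {R : realType}.

Lemma cauchy_schwarz_sum (I : Type) (r : seq I) (a b : I -> R) :
  (\sum_(i <- r) a i * b i) ^+ 2 <=
  (\sum_(i <- r) a i ^+ 2) * (\sum_(i <- r) b i ^+ 2).
Proof.
set A := \sum_(i <- r) a i ^+ 2; set B := \sum_(i <- r) b i ^+ 2.
set S := \sum_(i <- r) a i * b i.
have B0 : 0 <= B by apply: sumr_ge0 => i _; exact: sqr_ge0.
have H t : 0 <= A - 2 * t * S + t ^+ 2 * B.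
  have -> : A - 2 * t * S + t ^+ 2 * B = \sum_(i <- r) (a i - t * b i) ^+ 2.
    rewrite /A /B /S !mulr_sumr -sumrB -big_split /=.
    by apply: eq_bigr => i _; ring.
  by apply: sumr_ge0 => i _; exact: sqr_ge0.
have [B00|Bn0] := eqVneq B 0.
  have [->|S0] := eqVneq S 0; first by rewrite expr0n /= B00 mulr0.
  (* For B = 0 the quadratic is affine in t, and this t would give it the value -1. *)
  have := H ((A + 1) / (2 * S)); rewrite B00.
  have -> : A - 2 * ((A + 1) / (2 * S)) * S + ((A + 1) / (2 * S)) ^+ 2 * 0 = -1.
    by field.
  lra.
have := H (S / B).
have -> : A - 2 * (S / B) * S + (S / B) ^+ 2 * B = (A * B - S ^+ 2) / B.
  by field.
by rewrite pmulr_lge0 ?invr_gt0 ?lt_def ?Bn0 // subr_ge0.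
Qed.


(** Expanding the square, orthogonality kills the cross terms. The squared norms [g i] may depend on
    [i]: they are 1 for the sines and [lambda] for their differences. *)
Lemma parseval_sum (J : Type) (r : seq nat) (s : seq J) (e : nat -> J -> R)
    (g : nat -> R) (c : nat -> R) : uniq r ->
  (forall i i', i \in r -> i' \in r ->
     \sum_(l <- s) e i l * e i' l = (i == i')%:R * g i) ->
  \sum_(l <- s) (\sum_(i <- r) c i * e i l) ^+ 2 = \sum_(i <- r) c i ^+ 2 * g i.
Proof.
move=> ur H.
transitivity (\sum_(i <- r) \sum_(i' <- r) c i * c i' *
    (\sum_(l <- s) e i l * e i' l)).
  transitivity (\sum_(l <- s) \sum_(i <- r) \sum_(i' <- r)
      c i * c i' * (e i l * e i' l)).
    apply: eq_bigr => l _; rewrite expr2 mulr_suml; apply: eq_bigr => i _.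
    by rewrite mulr_sumr; apply: eq_bigr => i' _; ring.
  rewrite exchange_big; apply: eq_bigr => i _; rewrite exchange_big.
  by apply: eq_bigr => i' _; rewrite mulr_sumr.
rewrite big_seq [RHS]big_seq; apply: eq_bigr => i ir.
rewrite (bigD1_seq i) //= H // eqxx mul1r -expr2 big_seq_cond big1 ?addr0 //.
by move=> i' /andP[i'r /negPf ii']; rewrite H // eq_sym ii' mul0r mulr0.
Qed.

(** The squared distance of [u] to its projection onto the span of the [e i] is nonnegative; [g] is
    the common squared norm. *)
Lemma bessel_sum (J : Type) (r : seq nat) (s : seq J) (e : nat -> J -> R)
    (g : R) (u : J -> R) : uniq r -> 0 < g ->
  (forall i i', i \in r -> i' \in r ->
     \sum_(l <- s) e i l * e i' l = (i == i')%:R * g) ->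
  \sum_(i <- r) (\sum_(l <- s) e i l * u l) ^+ 2 <= g * \sum_(l <- s) u l ^+ 2.
Proof.
move=> ur g0 H.
pose b i := \sum_(l <- s) e i l * u l.
have H1 := parseval_sum b ur H.
have H2 : \sum_(l <- s) (\sum_(i <- r) b i * e i l) * u l =
    \sum_(i <- r) b i ^+ 2.
  under eq_bigr do rewrite mulr_suml.
  rewrite exchange_big; apply: eq_bigr => i _.
  rewrite expr2 [X in _ = _ * X]/b mulr_sumr; apply: eq_bigr => l _; ring.
have : 0 <= \sum_(l <- s) (u l - g^-1 * (\sum_(i <- r) b i * e i l)) ^+ 2.
  by apply: sumr_ge0 => l _; exact: sqr_ge0.
have -> : \sum_(l <- s) (u l - g^-1 * (\sum_(i <- r) b i * e i l)) ^+ 2 =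
    \sum_(l <- s) u l ^+ 2 - g^-1 * \sum_(i <- r) b i ^+ 2.
  have -> : \sum_(l <- s) u l ^+ 2 - g^-1 * \sum_(i <- r) b i ^+ 2 =
     \sum_(l <- s) u l ^+ 2 - 2 * g^-1 * (\sum_(i <- r) b i ^+ 2) +
     g^-2 * (\sum_(i <- r) b i ^+ 2 * g).
    by rewrite -mulr_suml; field; rewrite gt_eqF.
  rewrite -H1 -H2 !mulr_sumr -sumrB -big_split /=.
  by apply: eq_bigr => l _; field; rewrite gt_eqF.
by rewrite subr_ge0 mulrC ler_pdivrMr // mulrC.
Qed.

(* A Gram matrix bounded by [rho] times the identity has squared Frobenius norm
   at most [rho ^+ 2] times its size. *)
Lemma gram_frobenius (I : Type) (a : seq I) (r : seq nat) (B : nat -> I -> R)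
    (v : I -> R) (rho : R) : 0 < rho -> uniq r -> (forall x, 0 <= v x) ->
  (forall c : nat -> R, \sum_(x <- a) v x * (\sum_(i <- r) c i * B i x) ^+ 2 <=
     rho * \sum_(i <- r) c i ^+ 2) ->
  \sum_(i <- r) \sum_(j <- r) (\sum_(x <- a) B i x * B j x * v x) ^+ 2 <=
    rho ^+ 2 * (size r)%:R.
Proof.
move=> rho0 ur v0 H.
rewrite mulr_natr -sum1_size -sumrMnr big_seq [leRHS]big_seq.
apply: ler_sum => i ir; rewrite mulr1n.
pose G j := \sum_(x <- a) B i x * B j x * v x.
set S := \sum_(j <- r) _.
have X : \sum_(x <- a) v x * B i x ^+ 2 <= rho.
  have := H (fun j => (j == i)%:R).
  have -> : \sum_(j <- r) (j == i)%:R ^+ 2 = 1 :> R.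
    rewrite (bigD1_seq i) //= eqxx expr1n big1 ?addr0 // => j /negPf ->.
    by rewrite expr0n.
  rewrite mulr1; apply: le_trans; rewrite le_eqVlt; apply/orP; left; apply/eqP.
  apply: eq_bigr => x _; congr (_ * _ ^+ 2).
  rewrite (bigD1_seq i) //= eqxx mul1r big1 ?addr0 // => j /negPf ->.
  by rewrite mul0r.
have Y := H G.
have SE : S = \sum_(x <- a) v x * (B i x * \sum_(j <- r) G j * B j x).
  rewrite /S; transitivity (\sum_(j <- r) \sum_(x <- a) v x * (B i x * (G j * B j x))).
    apply: eq_bigr => j _; rewrite expr2 {1}mulr_suml; apply: eq_bigr => x _.
    rewrite -/(G j); ring.
  rewrite exchange_big; apply: eq_bigr => x _; rewrite !mulr_sumr.
  by apply: eq_bigr.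
(* AM-GM with weight [rho]. The first half is at most rho^2 (hypothesis at a unit vector), the
   second at most [S] (hypothesis at the row [G]), so S <= (rho^2 + S) / 2. *)
have : S <= (rho * (\sum_(x <- a) v x * B i x ^+ 2) +
   rho^-1 * \sum_(x <- a) v x * (\sum_(j <- r) G j * B j x) ^+ 2) / 2.
  rewrite SE !mulr_sumr -big_split mulr_suml /=; apply: ler_sum => x _.
  set g := \sum_(j <- r) _; set b := B i x.
  have -> : (rho * (v x * b ^+ 2) + rho^-1 * (v x * g ^+ 2)) / 2 =
     v x * (b * g) + v x * (rho * b - g) ^+ 2 / (2 * rho).
    by field; rewrite gt_eqF.
  rewrite lerDl; apply: divr_ge0; first exact: mulr_ge0 (v0 x) (sqr_ge0 _).
  by rewrite mulr_ge0 // ltW.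
have Z : rho^-1 * \sum_(x <- a) v x * (\sum_(j <- r) G j * B j x) ^+ 2 <= S.
  by rewrite mulrC ler_pdivrMr // mulrC.
have X' : rho * \sum_(x <- a) v x * B i x ^+ 2 <= rho * rho.
  by rewrite ler_pM2l.
rewrite expr2; lra.
Qed.

End finite_sums.

(** * Closed forms of cosine sums over a grid *)

Section trigonometric_sums.
Context {R : realType}.
Implicit Types x phi psi : R.

(** Multiplied by 2 sin(phi / 2), each cosine becomes a difference of two sines and the sum
    telescopes. *)
Lemma sum_cos_arith phi psi n :
  2 * sin (phi / 2) * (\sum_(1 <= l < n.+1) cos (phi * l%:R + psi)) =
  sin (phi * (n%:R + 1 / 2) + psi) - sin (phi / 2 + psi).
Proof.
elim: n => [|n IH].
  by rewrite big_geq // mulr0 add0r (_ : phi * _ = phi / 2) ?subrr //; ring.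
rewrite big_nat_recr //= mulrDr IH.
have -> : phi * (n%:R + 1 / 2) + psi = (phi * n.+1%:R + psi) - phi / 2.
  by rewrite -natr1; field.
have -> : phi * (n.+1%:R + 1 / 2) + psi = (phi * n.+1%:R + psi) + phi / 2.
  by field.
by rewrite (sinD _ (phi / 2)) (sinB _ (phi / 2)); ring.
Qed.

Lemma sinDn2pi x (k : nat) : sin (x + k%:R * (2 * pi)) = sin x.
Proof.
have -> : k%:R * (2 * pi) = (pi *+ 2) *+ k :> R by rewrite -(mulr_natl (pi *+ 2)) -(mulr_natl pi).
exact: (periodicn (@sinD2pi R)).
Qed.

Lemma cosDn2pi x (k : nat) : cos (x + k%:R * (2 * pi)) = cos x.
Proof.
have -> : k%:R * (2 * pi) = (pi *+ 2) *+ k :> R by rewrite -(mulr_natl (pi *+ 2)) -(mulr_natl pi).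
exact: (periodicn (@cosD2pi R)).
Qed.

Lemma sinDnpi x (k : nat) : sin (x + k%:R * pi) = (-1) ^+ k * sin x.
Proof.
elim: k => [|k IH]; first by rewrite mul0r addr0 mul1r.
have -> : x + k.+1%:R * pi = (x + k%:R * pi) + pi by rewrite -natr1; ring.
by rewrite sinDpi IH exprS; ring.
Qed.

Lemma sin_npi (k : nat) : sin (k%:R * pi : R) = 0.
Proof. by rewrite -[_ * _]add0r sinDnpi sin0 mulr0. Qed.

Lemma sin_half_gt0 (r n : nat) : (0 < r < 2 * n)%N ->
  0 < sin (r%:R * pi / n%:R / 2 : R).
Proof.
move=> /andP[r0 rn]; have n0 : (0 < n)%N by lia.
have n0' : 0 < n%:R :> R by rewrite ltr0n.
apply: sin_gt0_pi; rewrite !divr_gt0 ?mulr_gt0 ?pi_gt0 ?ltr0n //=.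
rewrite -mulrA -invfM ltr_pdivrMr ?mulr_gt0 // mulrC ltr_pM2l ?pi_gt0 //.
by rewrite mulrC -natrM ltr_nat.
Qed.

(* Full periods; the shift [s] is [0] or [1 / 2] in the applications. *)
Lemma sum_cos_period (r n : nat) (s : R) : (0 < r < n)%N ->
  \sum_(1 <= l < n.+1) cos (2 * r%:R * pi * (l%:R - s) / n%:R) = 0.
Proof.
move=> rn; have n0 : n%:R != 0 :> R by rewrite pnatr_eq0; lia.
pose phi : R := (2 * r)%:R * pi / n%:R; pose psi := - phi * s.
have := sum_cos_arith phi psi n.
have -> : phi * (n%:R + 1 / 2) + psi = (phi / 2 + psi) + r%:R * (2 * pi).
  by rewrite /phi natrM; field.
rewrite sinDn2pi subrr => /eqP; rewrite mulf_eq0 => /orP[|/eqP H].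
  have := @sin_half_gt0 (2 * r) n; rewrite -/phi => /(_ ltac:(lia)) s0.
  by rewrite mulf_eq0 pnatr_eq0 /= gt_eqF.
rewrite -[RHS]H; apply: eq_bigr => l _; congr cos.
by rewrite /psi /phi natrM; field.
Qed.

Lemma sum_cos_half (r n : nat) : (0 < r < 2 * n)%N ->
  \sum_(1 <= l < n.+1) cos (r%:R * pi * (l%:R - 1 / 2) / n%:R : R) = 0.
Proof.
move=> rn; have n0 : n%:R != 0 :> R by rewrite pnatr_eq0; lia.
pose phi : R := r%:R * pi / n%:R; pose psi := - phi / 2.
have := sum_cos_arith phi psi n.
have -> : phi * (n%:R + 1 / 2) + psi = r%:R * pi.
  by rewrite /psi /phi; field.
have -> : phi / 2 + psi = 0 by rewrite /psi; ring.
rewrite sin_npi sin0 subrr => /eqP; rewrite mulf_eq0 => /orP[|/eqP H].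
  by rewrite mulf_eq0 pnatr_eq0 /= gt_eqF // sin_half_gt0.
rewrite -[RHS]H; apply: eq_bigr => l _; congr cos.
by rewrite /psi /phi; field.
Qed.

(** The value depends only on the parity of [r], so two such sums with frequencies i + i' and i - i'
    cancel. *)
Lemma sum_cos_integer (r n : nat) : (0 < r < 2 * n)%N ->
  \sum_(1 <= l < n.+1) cos (r%:R * pi * l%:R / n%:R : R) = ((-1) ^+ r - 1) / 2.
Proof.
move=> rn; have n0 : n%:R != 0 :> R by rewrite pnatr_eq0; lia.
pose phi : R := r%:R * pi / n%:R.
have := sum_cos_arith phi 0 n; rewrite !addr0.
have -> : phi * (n%:R + 1 / 2) = phi / 2 + r%:R * pi by rewrite /phi; field.
have s0 : sin (phi / 2) != 0 by rewrite gt_eqF // sin_half_gt0.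
rewrite sinDnpi => H.
have {}H : \sum_(1 <= l < n.+1) cos (phi * l%:R + 0) = ((-1) ^+ r - 1) / 2.
  have s2 : 2 * sin (phi / 2) != 0 by rewrite mulf_neq0 // pnatr_eq0.
  by apply: (mulfI s2); rewrite H; field.
rewrite -[RHS]H; apply: eq_bigr => l _; congr cos.
by rewrite /phi; field.
Qed.

Lemma cosMcos x y : cos x * cos y = (cos (x + y) + cos (x - y)) / 2 :> R.
Proof. by rewrite cosD cosB; field. Qed.

Lemma sinMsin x y : sin x * sin y = (cos (x - y) - cos (x + y)) / 2 :> R.
Proof. by rewrite cosB cosD; field. Qed.

Lemma sinBsin x y :
  sin x - sin y = 2 * cos ((x + y) / 2) * sin ((x - y) / 2) :> R.
Proof.
have H a b : sin (a + b) - sin (a - b) = 2 * cos a * sin b :> R.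
  by rewrite sinD sinB; ring.
by rewrite -H; congr (sin _ - sin _); field.
Qed.

Lemma cosBcos x y :
  cos x - cos y = - 2 * sin ((x + y) / 2) * sin ((x - y) / 2) :> R.
Proof.
have H a b : cos (a + b) - cos (a - b) = - 2 * sin a * sin b :> R.
  by rewrite cosD cosB; ring.
by rewrite -H; congr (cos _ - cos _); field.
Qed.

(* Orthogonality of symmetric trigonometric systems: [h] is a cosine sum over
   the grid which vanishes at the relevant frequencies. *)
Lemma cos_orthogonal (n : nat) (s : R) (i i' : nat) :
  (0 < i)%N -> (0 < i')%N -> (2 * i < n)%N -> (2 * i' < n)%N ->
  \sum_(1 <= l < n.+1) cos (2 * i%:R * pi * (l%:R - s) / n%:R) *
     cos (2 * i'%:R * pi * (l%:R - s) / n%:R) = (i == i')%:R * (n%:R / 2).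
Proof.
wlog lii' : i i' / (i <= i')%N.
  move=> H i0 i'0 ni ni'; have [h|h] := leqP i i'; first exact: H.
  rewrite eq_sym -H //; last exact: ltnW.
  by apply: eq_bigr => l _; rewrite mulrC.
move=> i0 i'0 ni ni'; have n0 : n%:R != 0 :> R by rewrite pnatr_eq0; lia.
transitivity ((\sum_(1 <= l < n.+1) cos (2 * (i + i')%:R * pi * (l%:R - s) / n%:R) +
    \sum_(1 <= l < n.+1) cos (2 * (i' - i)%:R * pi * (l%:R - s) / n%:R)) / 2).
  rewrite -big_split mulr_suml; apply: eq_bigr => l _ /=.
  rewrite cosMcos; congr ((_ + _) / 2).
    by congr cos; rewrite natrD; field.
  by rewrite -[RHS]cosN; congr cos; rewrite natrB //; field.
rewrite sum_cos_period ?add0r; last by lia.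
have [->|ii'] := eqVneq i i'.
  rewrite subnn mul1r; under eq_bigr do rewrite mulr0 !mul0r cos0.
  by rewrite sumr_const_nat subSS subn0.
by rewrite sum_cos_period ?mul0r //; lia.
Qed.

End trigonometric_sums.

(** * The sine basis, its differences, and the cosine weights *)

Section sine_basis.
Context {R : realType}.
Implicit Types x y : R.

Lemma sin_mvt x : 0 <= x -> exists2 z, 0 <= z <= x & sin x = cos z * x.
Proof.
rewrite le_eqVlt => /orP[/eqP <-|x0].
  by exists 0; rewrite ?lexx // sin0 mulr0.
have [z] := @MVT R sin cos 0 x x0 (fun _ _ => is_derive_sin _)
  (continuous_subspaceT (@continuous_sin R)).
rewrite in_itv /= sin0 !subr0 => /andP[z0 zx] ->.
by exists z => //; rewrite !ltW.
Qed.

Lemma normr_sin_le x : `|sin x| <= `|x|.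
Proof.
wlog x0 : x / 0 <= x => [H|].
  have [|x0] := leP 0 x; first exact: H.
  by rewrite -normrN -sinN -[leRHS]normrN H // oppr_ge0 ltW.
have [z _ ->] := sin_mvt x0.
by rewrite normrM ler_piMl // cos_max.
Qed.

Lemma sin_sqr_le x : sin x ^+ 2 <= x ^+ 2.
Proof.
by rewrite -[leLHS]real_normK ?num_real // -[leRHS]real_normK ?num_real //
  lerXn2r ?nnegrE // normr_sin_le.
Qed.

Lemma cos_ge_quadratic x : 1 - x ^+ 2 / 2 <= cos x.
Proof.
have {2}-> : x = (x / 2) *+ 2 by rewrite -[RHS]mulr_natr; field.
rewrite cos_mulr2n cos2sin2 -(mulr_natr (1 - _)).
have := sin_sqr_le (x / 2).
rewrite (_ : (x / 2) ^+ 2 = x ^+ 2 / 4); last by field.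
lra.
Qed.

(** By the mean value theorem sin x = x cos z with z <= x, and cos z is at least 1 - z^2 / 2. *)
Lemma sin_ge_cubic x : 0 <= x -> x * (1 - x ^+ 2 / 2) <= sin x.
Proof.
move=> x0; have [z /andP[z0 zx] ->] := sin_mvt x0.
rewrite mulrC ler_wpM2r //; apply: le_trans (cos_ge_quadratic z).
by rewrite lerD2l lerN2 ler_wpM2r ?invr_ge0 // lerXn2r // nnegrE (le_trans z0).
Qed.

Lemma normr_cosB_le x y : `|cos x - cos y| <= `|x - y|.
Proof.
rewrite cosBcos !normrM normrN normr_nat.
have H := normr_sin_le ((x - y) / 2).
have -> : `|x - y| = 2 * `|(x - y) / 2|.
  by rewrite normrM [`|2^-1|]ger0_norm; [field|rewrite invr_ge0].
rewrite -mulrA ler_pM2l //; apply: le_trans H.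
by rewrite ler_piMl // sin_max.
Qed.

(** Entries of [sine_mx], numbered from 1 and extended to all naturals: the zero values at j = 0 and
    j = n serve as boundary terms in summation by parts. *)
Definition sine_coef (n i j : nat) : R :=
  Num.sqrt (2 / n%:R) * sin (i%:R * j%:R * pi / n%:R).

Lemma sine_coef0 n i : sine_coef n i 0 = 0.
Proof. by rewrite /sine_coef mulr0 !mul0r sin0 mulr0. Qed.

Lemma sine_coefn n i : (0 < n)%N -> sine_coef n i n = 0.
Proof.
move=> n0; rewrite /sine_coef (_ : i%:R * n%:R * pi / n%:R = i%:R * pi).
  by rewrite sin_npi mulr0.
by field; rewrite pnatr_eq0; lia.
Qed.

Lemma sine_coefM n i i' j : sine_coef n i j * sine_coef n i' j =
  (cos ((i%:R - i'%:R) * pi * j%:R / n%:R) -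
   cos ((i%:R + i'%:R) * pi * j%:R / n%:R)) / n%:R.
Proof.
rewrite /sine_coef mulrACA -expr2 sqr_sqrtr; last by rewrite divr_ge0.
rewrite sinMsin.
have -> : i%:R * j%:R * pi / n%:R - i'%:R * j%:R * pi / n%:R =
  (i%:R - i'%:R) * pi * j%:R / n%:R :> R by ring.
have -> : i%:R * j%:R * pi / n%:R + i'%:R * j%:R * pi / n%:R =
  (i%:R + i'%:R) * pi * j%:R / n%:R :> R by ring.
by move: (n%:R^-1) => t; field.
Qed.

Lemma sine_coef_sqr n i j : sine_coef n i j ^+ 2 =
  (1 - cos (2 * i%:R * pi * (j%:R - 0) / n%:R)) / n%:R.
Proof.
rewrite expr2 sine_coefM subrr !mul0r cos0 subr0 (_ : i%:R + i%:R = 2 * i%:R) //.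
by ring.
Qed.

Lemma sine_coef_sqr_le n i j : sine_coef n i j ^+ 2 <= 2 / n%:R.
Proof.
rewrite sine_coef_sqr ler_wpM2r ?invr_ge0 //.
have := cos_geN1 (2 * i%:R * pi * (j%:R - 0) / n%:R : R); lra.
Qed.

(** A product of two sines is a difference of cosines of frequencies i - i' and i + i', which have
    the same parity. *)
Lemma sine_orthonormal n i i' : (0 < i < n)%N -> (0 < i' < n)%N ->
  \sum_(1 <= j < n) sine_coef n i j * sine_coef n i' j = (i == i')%:R.
Proof.
wlog lii' : i i' / (i' <= i)%N.
  move=> H hi hi'; have [h|/ltnW h] := leqP i' i; first exact: H.
  rewrite eq_sym -H //; by apply: eq_bigr => l _; rewrite mulrC.
move=> hi hi'; have n0 : (0 < n)%N by lia.
have n0' : n%:R != 0 :> R by rewrite pnatr_eq0; lia.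
have -> : \sum_(1 <= j < n) sine_coef n i j * sine_coef n i' j =
    \sum_(1 <= j < n.+1) sine_coef n i j * sine_coef n i' j.
  by rewrite [RHS]big_nat_recr //= sine_coefn // mul0r addr0.
under eq_bigr do rewrite sine_coefM -natrB // -natrD.
rewrite -mulr_suml sumrB (@sum_cos_integer _ (i + i')); last by lia.
have [->|ii'] := eqVneq i i'.
  rewrite subnn; under eq_bigr do rewrite !mul0r cos0.
  rewrite sumr_const_nat subSS subn0 -signr_odd oddD addbb expr0 subrr mul0r.
  by rewrite subr0 divff.
rewrite sum_cos_integer; last by lia.
by rewrite -signr_odd -[in X in _ - X]signr_odd oddB // oddD subrr mul0r.
Qed.

Lemma sine_diffE n i l : (0 < n)%N -> (0 < l)%N ->
  sine_coef n i l.-1 - sine_coef n i l =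
  - (Num.sqrt (2 / n%:R) * 2 * sin (i%:R * pi / (2 * n%:R)) *
     cos (i%:R * pi * (l%:R - 1 / 2) / n%:R)).
Proof.
move=> n0 l0; have n0' : n%:R != 0 :> R by rewrite pnatr_eq0; lia.
case: l l0 => // l _; rewrite -mulrBr sinBsin succnK.
rewrite (_ : (_ - _) / 2 = - (i%:R * pi / (2 * n%:R))); last first.
  by rewrite -natr1; field.
rewrite (_ : (_ + _) / 2 = i%:R * pi * (l.+1%:R - 1 / 2) / n%:R); last first.
  by rewrite -natr1; field.
by rewrite sinN; ring.
Qed.

(** Differences of consecutive sines are cosines at the midpoints of the grid, again orthogonal. So
    the sine basis diagonalises the covariance of the increments of white noise, with eigenvalues
    [lambda]. *)
Lemma sine_diff_orthogonal n i i' : (0 < i < n)%N -> (0 < i' < n)%N ->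
  \sum_(1 <= l < n.+1) (sine_coef n i l.-1 - sine_coef n i l) *
      (sine_coef n i' l.-1 - sine_coef n i' l) = (i == i')%:R * lambda n i.
Proof.
wlog lii' : i i' / (i' <= i)%N.
  move=> H hi hi'; have [h|/ltnW h] := leqP i' i; first exact: H.
  have -> : (i == i')%:R * lambda n i = (i' == i)%:R * lambda n i' :> R.
    by rewrite eq_sym; case: eqVneq => [->//|]; rewrite !mul0r.
  rewrite -H //; by apply: eq_bigr => l _; rewrite mulrC.
move=> hi hi'; have n0 : (0 < n)%N by lia.
have n0' : n%:R != 0 :> R by rewrite pnatr_eq0; lia.
transitivity (2 / n%:R * 4 * sin (i%:R * pi / (2 * n%:R)) *
   sin (i'%:R * pi / (2 * n%:R)) *
  ((\sum_(1 <= l < n.+1) cos ((i + i')%:R * pi * (l%:R - 1 / 2) / n%:R) +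
  \sum_(1 <= l < n.+1) cos ((i - i')%:R * pi * (l%:R - 1 / 2) / n%:R)) / 2) : R).
  rewrite -big_split mulr_suml mulr_sumr big_nat [RHS]big_nat.
  apply: eq_bigr => l /andP[l0 _] /=.
  rewrite !sine_diffE // mulrNN.
  set a := i%:R * pi * (l%:R - 1 / 2) / n%:R.
  set b := i'%:R * pi * (l%:R - 1 / 2) / n%:R.
  have -> : (i + i')%:R * pi * (l%:R - 1 / 2) / n%:R = a + b :> R.
    by rewrite natrD /a /b; ring.
  have -> : (i - i')%:R * pi * (l%:R - 1 / 2) / n%:R = a - b :> R.
    by rewrite natrB // /a /b; ring.
  rewrite -cosMcos.
  have : Num.sqrt (2 / n%:R) ^+ 2 = 2 / n%:R :> R by rewrite sqr_sqrtr ?divr_ge0.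
  by move: (Num.sqrt _) => t t2; rewrite -t2; ring.
rewrite sum_cos_half ?add0r; last by lia.
have [->|ii'] := eqVneq i i'.
  rewrite subnn; under eq_bigr do rewrite !mul0r cos0.
  by rewrite sumr_const_nat subSS subn0 /lambda mul1r; field.
by rewrite sum_cos_half; [rewrite !mul0r mulr0|lia].
Qed.

Lemma sine_diff_sqr n i l : (0 < n)%N -> (0 < l)%N ->
  (sine_coef n i l.-1 - sine_coef n i l) ^+ 2 =
  lambda n i / n%:R * (1 + cos (2 * i%:R * pi * (l%:R - 1 / 2) / n%:R)).
Proof.
move=> n0 l0; have n0' : n%:R != 0 :> R by rewrite pnatr_eq0; lia.
rewrite sine_diffE // sqrrN !exprMn sqr_sqrtr ?divr_ge0 //.
have -> : 2 * i%:R * pi * (l%:R - 1 / 2) / n%:R =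
  (i%:R * pi * (l%:R - 1 / 2) / n%:R) *+ 2 :> R by rewrite -[RHS]mulr_natr; ring.
by rewrite cos_mulr2n /lambda; field.
Qed.

(** This identity explains the half frequency in [cos_basis]: squared, the weight produces the k-th
    cosine of the expansion. *)
Lemma cos_basis_sqr k x :
  cos_basis k x ^+ 2 = 1 + (k != 0%N)%:R * cos (k%:R * pi * x).
Proof.
rewrite /cos_basis; case: eqVneq => [->|k0] /=; first by rewrite mul0r addr0 expr1n.
rewrite exprMn sqr_sqrtr //.
rewrite [in RHS](_ : k%:R * pi * x = (k%:R * pi * x / 2) *+ 2); last first.
  by rewrite -[RHS]mulr_natr; field.
by rewrite mul1r cos_mulr2n -(mulr_natr (cos _ ^+ 2)); field.
Qed.

Lemma cos_basis_sqr_le k x : cos_basis k x ^+ 2 <= 2.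
Proof.
rewrite cos_basis_sqr; case: (k != 0%N); rewrite ?mul0r ?mul1r; last lra.
by have := cos_le1 (k%:R * pi * x); lra.
Qed.

Lemma cos_basis_diff_sqr_le k x y :
  (cos_basis k x - cos_basis k y) ^+ 2 <= 8 * k%:R ^+ 2 * (x - y) ^+ 2.
Proof.
rewrite /cos_basis; case: eqVneq => [->|k0].
  by rewrite subrr expr0n /= mulr0 mul0r.
rewrite -mulrBr exprMn sqr_sqrtr //.
have := normr_cosB_le (k%:R * pi * x / 2) (k%:R * pi * y / 2).
rewrite -ler_sqr ?nnegrE // !real_normK ?num_real // => H.
(* The crude bound pi <= 4 is used throughout for explicit constants. *)
have p4 : pi ^+ 2 <= 16 :> R.
  have := pi_ge0 R; have := pihalf_lt2 R => h1 h2.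
  by rewrite (_ : 16 = 4 ^+ 2); [rewrite lerXn2r ?nnegrE //; lra | ring].
apply: (@le_trans _ _ (2 * (k%:R ^+ 2 * (x - y) ^+ 2 * (pi ^+ 2 / 4)))).
  rewrite ler_pM2l //; apply: le_trans H _.
  by rewrite le_eqVlt; apply/orP; left; apply/eqP; field.
have := mulr_ge0 (sqr_ge0 (k%:R : R)) (sqr_ge0 (x - y)) => H0.
rewrite -[8 * _ * _]mulrA; nra.
Qed.

End sine_basis.

(** * Covariance of the spectral statistics: signal part and noise part *)

Section spectral_bounds.
Context {R : realType}.
Variables (n k : nat) (S U K : R) (t cbar : nat -> R) (C : nat -> nat -> R).
Hypothesis n0 : (0 < n)%N.
Hypothesis t_bound : forall l, (0 < l <= n)%N -> 0 <= t l <= U.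
Hypothesis cbar_bound : forall j, (0 < j < n)%N -> 0 <= cbar j <= S / n%:R.
Hypothesis C_bound : forall j j', (0 < j < n)%N -> (0 < j' < n)%N ->
  `|C j j' - (j == j')%:R * cbar j| <= K / n%:R ^+ 2.
Variable r : seq nat.
Hypothesis ur : uniq r.
Hypothesis hr : forall i, i \in r -> (0 < i < n)%N.

Definition grid_basis j : R := cos_basis k (j%:R / n%:R).
Local Notation f := grid_basis.
Local Notation s := (@sine_coef R n).
Local Notation lam := (@lambda R n).

(** Coefficient of the l-th observation error in the i-th spectral statistic, after summation by
    parts. *)
Definition noise_coef i l : R := s i l.-1 * f l.-1 - s i l * f l.
Local Notation a := noise_coef.

(** The covariance of the statistics i and i' when the signal increments have covariance [C] and the
    errors have variances [t]; see [stat_cov]. *)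
Definition spectral_cov i i' : R :=
  \sum_(1 <= j < n) \sum_(1 <= j' < n) s i j * f j * (s i' j' * f j') * C j j' +
  \sum_(1 <= l < n.+1) a i l * a i' l * t l.

Let n0' : 0 < n%:R :> R. Proof. by rewrite ltr0n. Qed.
Let n1' : n%:R != 0 :> R. Proof. by rewrite gt_eqF. Qed.

Lemma grid_basis_sqr_le j : f j ^+ 2 <= 2.
Proof. exact: cos_basis_sqr_le. Qed.

Lemma grid_basis_diff_sqr l : (0 < l)%N ->
  (f l.-1 - f l) ^+ 2 <= 8 * k%:R ^+ 2 / n%:R ^+ 2.
Proof.
move=> l0; apply: (le_trans (cos_basis_diff_sqr_le _ _ _)).
case: l l0 => // l _; rewrite succnK -mulrBl -natr1.
rewrite (_ : l%:R - _ = -1); last by ring.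
by rewrite exprMn sqrrN expr1n mul1r exprVn.
Qed.

Lemma lambda_ge0 i : 0 <= lam i.
Proof. by rewrite mulr_ge0 // sqr_ge0. Qed.

Let K0 : (exists j, (0 < j < n)%N) -> 0 <= K.
Proof.
move=> [j hj]; have := le_trans (normr_ge0 _) (C_bound hj hj).
by rewrite pmulr_lge0 // invr_gt0 exprn_gt0.
Qed.

Let ler_sum_nat' a0 b0 (F G : nat -> R) :
  (forall i, (a0 <= i < b0)%N -> F i <= G i) ->
  \sum_(a0 <= i < b0) F i <= \sum_(a0 <= i < b0) G i.
Proof. by move=> H; rewrite ler_sum_nat. Qed.

(** [C] is diagonal with entries at most S / n, plus a matrix of size n with entries at most K /
    n^2, whose spectral norm is at most K / n. *)
Lemma signal_quadratic_le (y : nat -> R) :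
  \sum_(1 <= j < n) \sum_(1 <= j' < n) y j * y j' * C j j' <=
  (S + K) / n%:R * \sum_(1 <= j < n) y j ^+ 2.
Proof.
have [n1|n1] := leqP n 1; first by rewrite !big_geq // mulr0.
have K0' : 0 <= K by apply: K0; exists 1%N; rewrite n1.
have H1 : \sum_(1 <= j < n) \sum_(1 <= j' < n) y j * y j' * C j j' <=
    \sum_(1 <= j < n) (y j ^+ 2 * (S / n%:R) +
      \sum_(1 <= j' < n) K / n%:R ^+ 2 * ((y j ^+ 2 + y j' ^+ 2) / 2)).
  apply: ler_sum_nat' => j hj.
  have -> : y j ^+ 2 * (S / n%:R) = y j ^+ 2 * (S / n%:R - cbar j) +
     \sum_(1 <= j' < n) y j * y j' * ((j == j')%:R * cbar j).
    rewrite (bigD1_seq j) ?mem_index_iota ?iota_uniq //= eqxx mul1r big1 ?addr0.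
      by ring.
    by move=> i /negPf ij; rewrite eq_sym ij mul0r mulr0.
  rewrite -addrA -big_split /= -[leLHS]add0r lerD //.
    by rewrite mulr_ge0 ?sqr_ge0 // subr_ge0; case/andP: (cbar_bound hj).
  apply: ler_sum_nat' => j' hj'.
  rewrite -lerBlDl -mulrBr; apply: le_trans (ler_norm _) _.
  rewrite normrM mulrC ler_pM ?C_bound //.
  rewrite normrM -[y j ^+ 2]real_normK ?num_real // -[y j' ^+ 2]real_normK ?num_real //.
  by have := sqr_ge0 (`|y j| - `|y j'|); rewrite sqrrB; lra.
apply: (le_trans H1); rewrite big_split /= -mulr_suml.
under [X in _ + X <= _]eq_bigr do rewrite -mulr_sumr -mulr_suml big_split /= sumr_const_nat.
rewrite -mulr_sumr -mulr_suml big_split /= sumr_const_nat sumrMnl.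
set Y := \sum_(1 <= j < n) y j ^+ 2.
have Y0 : 0 <= Y by apply: sumr_ge0 => j _; exact: sqr_ge0.
have -> : K / n%:R ^+ 2 * ((Y *+ (n - 1) + Y *+ (n - 1)) / 2) =
  K / n%:R * (Y * ((n - 1)%:R / n%:R)).
  by rewrite -[Y *+ _]mulr_natr; field.
rewrite [leLHS](_ : _ = S / n%:R * Y + K / n%:R * (Y * ((n - 1)%:R / n%:R))); last by ring.
rewrite mulrDl mulrDl lerD2l ler_wpM2l ?divr_ge0 ?(ltW n0') //.
by rewrite ler_piMr // ler_pdivrMr // mul1r ler_nat leq_subr.
Qed.

Lemma sine_parseval (c : nat -> R) :
  \sum_(1 <= j < n) (\sum_(i <- r) c i * s i j) ^+ 2 = \sum_(i <- r) c i ^+ 2.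
Proof.
rewrite (@parseval_sum _ _ _ _ _ (fun=> 1)) //.
  by under eq_bigr do rewrite mulr1.
by move=> i i' /hr hi /hr hi'; rewrite mulr1 sine_orthonormal.
Qed.

Lemma sine_bessel (u : nat -> R) :
  \sum_(i <- r) (\sum_(1 <= j < n) s i j * u j) ^+ 2 <=
  \sum_(1 <= j < n) u j ^+ 2.
Proof.
rewrite -[leRHS]mul1r; apply: bessel_sum => // i i' /hr hi /hr hi'.
by rewrite mulr1 sine_orthonormal.
Qed.

Lemma sum_pred (F : nat -> R) : F 0%N = 0 ->
  \sum_(1 <= l < n.+1) F l.-1 = \sum_(1 <= j < n) F j.
Proof.
by move=> F0; rewrite big_add1 /= big_ltn //= F0 add0r.
Qed.

(** By the product rule for differences, [noise_coef] is [f] times a difference of sines plus a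
    difference of [f] times a sine. Parseval for the two systems gives the term in [lambda] and the
    term in k^2 / n^2. *)
Lemma noise_quadratic_le (d : nat -> R) :
  \sum_(1 <= l < n.+1) t l * (\sum_(i <- r) d i * a i l) ^+ 2 <=
  U * \sum_(i <- r) d i ^+ 2 * (4 * lam i + 16 * k%:R ^+ 2 / n%:R ^+ 2).
Proof.
have U0 : 0 <= U.
  have /andP[h1 h2] : 0 <= t n <= U by apply: t_bound; rewrite n0 /=.
  exact: le_trans h1 h2.
pose X l := \sum_(i <- r) d i * (s i l.-1 - s i l).
pose Y l := \sum_(i <- r) d i * s i l.-1.
have H l : (1 <= l < n.+1)%N -> t l * (\sum_(i <- r) d i * a i l) ^+ 2 <=
    U * (4 * X l ^+ 2 + 16 * k%:R ^+ 2 / n%:R ^+ 2 * Y l ^+ 2).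
  move=> hl; have /andP[t0 tU] := t_bound hl; have /andP[l0 _] := hl.
  have -> : \sum_(i <- r) d i * a i l = f l * X l + (f l.-1 - f l) * Y l.
    rewrite /X /Y !mulr_sumr -big_split /=; apply: eq_bigr => i _.
    by rewrite /a; ring.
  apply: ler_pM => //; first exact: sqr_ge0.
  apply: (@le_trans _ _ (2 * (f l ^+ 2 * X l ^+ 2) +
      2 * ((f l.-1 - f l) ^+ 2 * Y l ^+ 2))).
    by have := sqr_ge0 (f l * X l - (f l.-1 - f l) * Y l); rewrite -!exprMn sqrrB sqrrD; lra.
  apply: lerD.
    have := ler_wpM2r (sqr_ge0 (X l)) (grid_basis_sqr_le l); lra.
  have := ler_wpM2r (sqr_ge0 (Y l)) (grid_basis_diff_sqr l0).
  rewrite -![_ / n%:R ^+ 2]mulrC; lra.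
apply: le_trans (ler_sum_nat' H) _.
rewrite -mulr_sumr ler_wpM2l // big_split /= -!mulr_sumr.
rewrite (@parseval_sum _ _ _ _ (fun i l => s i l.-1 - s i l) lam) //; last first.
  by move=> i i' /hr hi /hr hi'; exact: sine_diff_orthogonal.
rewrite (@sum_pred (fun j => (\sum_(i <- r) d i * s i j) ^+ 2)); last first.
  by rewrite big1 ?expr0n // => i _; rewrite sine_coef0 mulr0.
rewrite sine_parseval !mulr_sumr -big_split /= le_eqVlt; apply/orP; left; apply/eqP.
by apply: eq_bigr => i _; ring.
Qed.

(** The cost of treating the cosine weight as locally constant, that is of replacing [noise_coef] by
    [f] times a difference of sines. The free [delta] comes from AM-GM on the cross term and is
    chosen later. *)
Lemma noise_mean_diff (w : nat -> R) (delta : R) : 0 < delta ->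
  (forall i, i \in r -> 0 <= w i) ->
  `|\sum_(i <- r) w i * (\sum_(1 <= l < n.+1) a i l * a i l * t l) -
    \sum_(i <- r) w i * (\sum_(1 <= l < n.+1)
       t l * f l ^+ 2 * (s i l.-1 - s i l) ^+ 2)| <=
  U * (2 * delta * (\sum_(i <- r) w i * lam i) +
       (delta^-1 + 1) * (8 * k%:R ^+ 2 / n%:R ^+ 2) * \sum_(i <- r) w i).
Proof.
move=> d0 w0; rewrite -sumrB !mulr_sumr -big_split mulr_sumr /=.
rewrite big_seq [leRHS]big_seq.
apply: le_trans (ler_norm_sum _ _ _) _; apply: ler_sum => i ir.
rewrite -mulrBr -sumrB normrM ger0_norm ?w0 //.
rewrite [leRHS](_ : _ = w i * (U * (2 * delta * lam i + (delta^-1 + 1) *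
  (8 * k%:R ^+ 2 / n%:R ^+ 2)))); last by ring.
rewrite ler_wpM2l ?w0 //; apply: le_trans (ler_norm_sum _ _ _) _.
set eta := 8 * _ / _.
apply: (@le_trans _ _ (\sum_(1 <= l < n.+1) (U * (2 * delta *
   ((s i l.-1 - s i l) * (s i l.-1 - s i l)) +
   (delta^-1 + 1) * eta * (s i l.-1 * s i l.-1))))).
  apply: ler_sum_nat' => l hl; have /andP[t0 tU] := t_bound hl.
  set x := f l * (s i l.-1 - s i l); set y := (f l.-1 - f l) * s i l.-1.
  rewrite (_ : _ - _ = t l * (2 * x * y + y ^+ 2)); last first.
    by rewrite /x /y /a; ring.
  rewrite normrM ger0_norm //; apply: ler_pM => //.
  have x2 : x ^+ 2 <= 2 * (s i l.-1 - s i l) ^+ 2.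
    by rewrite exprMn ler_wpM2r ?sqr_ge0 // grid_basis_sqr_le.
  have y2 : y ^+ 2 <= eta * s i l.-1 ^+ 2.
    rewrite exprMn ler_wpM2r ?sqr_ge0 // grid_basis_diff_sqr //.
    by case/andP: hl.
  have xy : `|2 * x * y| <= delta * x ^+ 2 + delta^-1 * y ^+ 2.
    have E e : e ^+ 2 = 1 -> e * (2 * x * y) <= delta * x ^+ 2 + delta^-1 * y ^+ 2.
      move=> e1; have : 0 <= (delta * x - e * y) ^+ 2 / delta.
        by rewrite divr_ge0 ?sqr_ge0 // ltW.
      rewrite (_ : _ / delta = delta * x ^+ 2 + e ^+ 2 * delta^-1 * y ^+ 2 -
        e * (2 * x * y)); last by field; rewrite gt_eqF.
      by rewrite e1 mul1r subr_ge0.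
    rewrite ler_norml lerNl -mulN1r !E ?sqrrN ?expr1n //.
    by rewrite -[2 * x * y]mul1r E // expr1n.
  apply: le_trans (ler_normD _ _) _; rewrite (ger0_norm (sqr_ge0 y)).
  have di : 0 <= delta^-1 by rewrite invr_ge0 ltW.
  have := ler_wpM2l (ltW d0) x2; have := ler_wpM2l di y2.
  rewrite -!expr2; nra.
rewrite -mulr_sumr ler_wpM2l //.
  have /andP[h1 h2] : 0 <= t n <= U by apply: t_bound; rewrite n0 /=.
  exact: le_trans h1 h2.
rewrite big_split /= -!mulr_sumr sine_diff_orthogonal ?hr // eqxx mul1r lerD2l.
rewrite (@sum_pred (fun j => s i j * s i j)) ?sine_coef0 ?mulr0 //.
by rewrite sine_orthonormal ?hr // eqxx mulr1.
Qed.

Definition noise_level : R := (\sum_(1 <= l < n.+1) t l * f l ^+ 2) / n%:R.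

(** What remains of the i-th noise variance, divided by [lambda], beside [noise_level]: a Fourier
    coefficient at double frequency over the midpoints. [signal_osc] is its analogue over the
    integer nodes. *)
Definition noise_osc (i : nat) : R :=
  (\sum_(1 <= l < n.+1)
    cos (2 * i%:R * pi * (l%:R - 1 / 2) / n%:R) * (t l * f l ^+ 2)) / n%:R.

Definition signal_osc (i : nat) : R :=
  (\sum_(1 <= j < n) cos (2 * i%:R * pi * (j%:R - 0) / n%:R) *
     (f j ^+ 2 * cbar j)) / n%:R.

Lemma noise_level_bound : 0 <= noise_level <= 2 * U.
Proof.
have H l : (1 <= l < n.+1)%N -> 0 <= t l * f l ^+ 2 <= 2 * U.
  move=> hl; have /andP[t0 tU] := t_bound hl.
  have := sqr_ge0 (f l); have := grid_basis_sqr_le l; nra.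
apply/andP; split.
  rewrite divr_ge0 ?(ltW n0') // big_nat sumr_ge0 // => l hl.
  by case/andP: (H l hl).
rewrite ler_pdivrMr //.
apply: (@le_trans _ _ (\sum_(1 <= l < n.+1) 2 * U)).
  by apply: ler_sum_nat' => l hl; case/andP: (H l hl).
by rewrite sumr_const_nat subSS subn0 mulr_natr.
Qed.

Lemma noise_main (w : nat -> R) :
  \sum_(i <- r) w i * (\sum_(1 <= l < n.+1)
       t l * f l ^+ 2 * (s i l.-1 - s i l) ^+ 2) =
  (\sum_(i <- r) w i * lam i) * noise_level +
  \sum_(i <- r) w i * lam i * noise_osc i.
Proof.
rewrite mulr_suml -big_split /=; apply: eq_bigr => i _.
transitivity (w i * (lam i * (noise_level + noise_osc i))); last by ring.
congr (_ * _); rewrite /noise_level /noise_osc -mulrDl.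
rewrite -big_split mulr_suml mulr_sumr big_nat [RHS]big_nat /=.
by apply: eq_bigr => l /andP[l0 _]; rewrite sine_diff_sqr //; ring.
Qed.

(** Bessel for cosines of squared norm n / 2. The condition on [r] keeps the doubled frequencies in
    the range where the cosines are orthogonal. *)
Lemma noise_osc_sqr_sum : (forall i, i \in r -> (2 * i < n)%N) ->
  \sum_(i <- r) noise_osc i ^+ 2 <= 2 * U ^+ 2.
Proof.
move=> hr2; under eq_bigr do rewrite /noise_osc exprMn.
rewrite -mulr_suml exprVn ler_pdivrMr ?exprn_gt0 //.
apply: le_trans (bessel_sum (g := n%:R / 2) (fun l => t l * f l ^+ 2) ur _ _) _.
- by rewrite divr_gt0.
- by move=> i i' ir i'r; rewrite cos_orthogonal //; [case/andP: (hr ir)|case/andP: (hr i'r)|exact: hr2|exact: hr2].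
have -> : 2 * U ^+ 2 * n%:R ^+ 2 = n%:R / 2 * ((2 * U) ^+ 2 *+ n).
  by rewrite -[_ *+ n]mulr_natr; field.
rewrite ler_wpM2l ?divr_ge0 ?(ltW n0') //.
have -> : (2 * U) ^+ 2 *+ n = \sum_(1 <= l < n.+1) (2 * U) ^+ 2.
  by rewrite sumr_const_nat subSS subn0.
apply: ler_sum_nat' => l hl; have /andP[t0 tU] := t_bound hl.
have f0 := sqr_ge0 (f l); have f2 := grid_basis_sqr_le l.
have U0 := le_trans t0 tU.
have h1 := ler_wpM2r f0 tU; have h2 := ler_wpM2l U0 f2.
have h3 := mulr_ge0 t0 f0; by rewrite lerXn2r ?nnegrE //; lra.
Qed.

Lemma signal_main (w : nat -> R) :
  \sum_(i <- r) w i * (\sum_(1 <= j < n) s i j ^+ 2 * (f j ^+ 2 * cbar j)) =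
  (\sum_(i <- r) w i) / n%:R * (\sum_(1 <= j < n) f j ^+ 2 * cbar j) -
  \sum_(i <- r) w i * signal_osc i.
Proof.
rewrite !mulr_suml -sumrB /=; apply: eq_bigr => i _.
rewrite -!mulrA -mulrBr; congr (_ * _).
rewrite /signal_osc mulr_sumr mulr_suml -sumrB.
by apply: eq_bigr => j _; rewrite sine_coef_sqr; ring.
Qed.

Lemma signal_osc_sqr_sum : (forall i, i \in r -> (2 * i < n)%N) ->
  \sum_(i <- r) signal_osc i ^+ 2 <= 2 * S ^+ 2 / n%:R ^+ 2.
Proof.
move=> hr2; under eq_bigr do rewrite /signal_osc exprMn.
(* Extension by 0 at j = n, so that the sum runs over a full period. *)
pose u j := if (j < n)%N then f j ^+ 2 * cbar j else 0.
have E i : \sum_(1 <= j < n) cos (2 * i%:R * pi * (j%:R - 0) / n%:R) *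
     (f j ^+ 2 * cbar j) = \sum_(1 <= j < n.+1)
      cos (2 * i%:R * pi * (j%:R - 0) / n%:R) * u j.
  rewrite [RHS]big_nat_recr //= {2}/u ltnn mulr0 addr0 big_nat [RHS]big_nat.
  by apply: eq_bigr => j /andP[_ jn]; rewrite /u jn.
rewrite -mulr_suml exprVn ler_wpM2r ?invr_ge0 ?exprn_ge0 ?(ltW n0') //.
under eq_bigr do rewrite E.
apply: le_trans (bessel_sum (g := n%:R / 2) (u) ur _ _) _.
- by rewrite divr_gt0.
- by move=> i i' ir i'r; rewrite cos_orthogonal //; [case/andP: (hr ir)|case/andP: (hr i'r)|exact: hr2|exact: hr2].
have -> : 2 * S ^+ 2 = n%:R / 2 * ((2 * S / n%:R) ^+ 2 *+ n).
  by rewrite -[_ *+ n]mulr_natr; field.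
rewrite ler_wpM2l ?divr_ge0 ?(ltW n0') //.
have -> : (2 * S / n%:R) ^+ 2 *+ n = \sum_(1 <= l < n.+1) (2 * S / n%:R) ^+ 2.
  by rewrite sumr_const_nat subSS subn0.
apply: ler_sum_nat' => l /andP[l0 _]; rewrite /u; case: ifP => [ln|_]; last first.
  by rewrite expr0n sqr_ge0.
have /andP[c0 cU] : 0 <= cbar l <= S / n%:R by apply: cbar_bound; rewrite l0.
have f0 := sqr_ge0 (f l); have f2 := grid_basis_sqr_le l.
have h1 := ler_wpM2r c0 f2; have h3 := mulr_ge0 f0 c0.
by rewrite lerXn2r ?nnegrE // -mulrA; lra.
Qed.

(** Cauchy-Schwarz in [j] against a unit vector, then Bessel in [j'] for each fixed [j]: what is
    left is a sum of fewer than n^2 squared entries, each at most 4 K^2 / n^4. *)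
Lemma signal_error_sqr_sum :
  \sum_(i <- r) (\sum_(1 <= j < n) \sum_(1 <= j' < n) s i j * f j *
     (s i j' * f j') * (C j j' - (j == j')%:R * cbar j)) ^+ 2 <=
  4 * K ^+ 2 / n%:R ^+ 2.
Proof.
pose E j j' := f j * f j' * (C j j' - (j == j')%:R * cbar j).
have E2 j j' : (1 <= j < n)%N -> (1 <= j' < n)%N ->
    E j j' ^+ 2 <= 4 * K ^+ 2 / n%:R ^+ 4.
  move=> hj hj'; rewrite /E !exprMn.
  have -> : 4 * K ^+ 2 / n%:R ^+ 4 = 2 * 2 * (K / n%:R ^+ 2) ^+ 2 by field.
  apply: ler_pM.
  - exact: mulr_ge0 (sqr_ge0 _) (sqr_ge0 _).
  - exact: sqr_ge0.
  - by apply: ler_pM; rewrite ?sqr_ge0 ?grid_basis_sqr_le.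
  rewrite -[leLHS]real_normK ?num_real // lerXn2r ?nnegrE ?C_bound //.
  exact: le_trans (normr_ge0 _) (C_bound hj hj').
apply: (@le_trans _ _ (\sum_(i <- r) \sum_(1 <= j < n)
   (\sum_(1 <= j' < n) s i j' * E j j') ^+ 2)).
  rewrite big_seq [leRHS]big_seq; apply: ler_sum => i ir.
  have -> : \sum_(1 <= j < n) \sum_(1 <= j' < n) s i j * f j *
     (s i j' * f j') * (C j j' - (j == j')%:R * cbar j) =
     \sum_(1 <= j < n) s i j * \sum_(1 <= j' < n) s i j' * E j j'.
    apply: eq_bigr => j _; rewrite mulr_sumr; apply: eq_bigr => j' _.
    by rewrite /E; ring.
  apply: le_trans (cauchy_schwarz_sum _ _ _) _.
  under eq_bigr do rewrite expr2.
  by rewrite sine_orthonormal ?hr // eqxx mul1r.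
rewrite exchange_big /=.
apply: (@le_trans _ _ (\sum_(1 <= j < n) 4 * K ^+ 2 / n%:R ^+ 3)).
  apply: ler_sum_nat' => j hj; apply: le_trans (sine_bessel _) _.
  apply: (@le_trans _ _ (\sum_(1 <= j' < n) 4 * K ^+ 2 / n%:R ^+ 4)).
    by apply: ler_sum_nat' => j' hj'; exact: E2.
  rewrite sumr_const_nat -[leLHS]mulr_natr.
  have -> : 4 * K ^+ 2 / n%:R ^+ 3 = 4 * K ^+ 2 / n%:R ^+ 4 * n%:R by field.
  rewrite ler_wpM2l ?ler_nat ?leq_subr //.
  by rewrite mulr_ge0 ?invr_ge0 ?exprn_ge0 ?(ltW n0') // mulr_ge0 // sqr_ge0.
rewrite sumr_const_nat -[leLHS]mulr_natr.
have -> : 4 * K ^+ 2 / n%:R ^+ 2 = 4 * K ^+ 2 / n%:R ^+ 3 * n%:R by field.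
rewrite ler_wpM2l ?ler_nat ?leq_subr //.
by rewrite mulr_ge0 ?invr_ge0 ?exprn_ge0 ?(ltW n0') // mulr_ge0 // sqr_ge0.
Qed.

End spectral_bounds.

(** * Frequencies and weights of the two diagonal matrices *)

Section estimator_weights.
Context {R : realType}.

Lemma sqr_sum_mul_le (I : Type) (r : seq I) (a b : I -> R) (A B : R) :
  \sum_(i <- r) a i ^+ 2 <= A -> \sum_(i <- r) b i ^+ 2 <= B ->
  (\sum_(i <- r) a i * b i) ^+ 2 <= A * B.
Proof.
move=> hA hB; apply: le_trans (cauchy_schwarz_sum _ _ _) _.
by apply: ler_pM => //; apply: sumr_ge0 => i _; exact: sqr_ge0.
Qed.

Lemma sqr_le_of_norm (x y : R) : `|x| <= y -> x ^+ 2 <= y ^+ 2.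
Proof.
move=> xy; rewrite -real_normK ?num_real // lerXn2r ?nnegrE //.
exact: le_trans xy.
Qed.

Lemma sqr_sum_squares (N : nat) :
  6 * (\sum_(1 <= i < N.+1) i%:R ^+ 2) =
  N%:R * (N%:R + 1) * (2 * N%:R + 1) :> R.
Proof.
elim: N => [|N IH]; first by rewrite big_geq // mulr0 !mul0r.
by rewrite big_nat_recr //= mulrDr IH -natr1; ring.
Qed.

Lemma sum_weights_const (a b : nat) (x : R) :
  \sum_(i <- index_iota a b) x = (b - a)%:R * x.
Proof. by rewrite sumr_const_nat mulr_natl. Qed.

Variable n : nat.
Hypothesis n16 : (16 < n)%N.

Local Notation q := (Num.sqrt (n%:R : R)).
Local Notation lam := (@lambda R n).

Let n0 : 0 < n%:R :> R. Proof. by rewrite ltr0n; lia. Qed.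

Lemma sqrt_n_gt4 : 4 < q.
Proof.
rewrite (_ : 4 = Num.sqrt (4 ^+ 2)); last by rewrite sqrtr_sqr ger0_norm.
by rewrite ltr_sqrt // -natrX ltr_nat.
Qed.

Lemma sqrt_n_sqr : q ^+ 2 = n%:R.
Proof. by rewrite sqr_sqrtr. Qed.

Definition J_first : nat := Num.truncn q.
Local Notation m := J_first.
Definition J_range := index_iota m.+1 (2 * m).+1.

Lemma J_first_itv : m%:R <= q < m%:R + 1.
Proof. by rewrite natr1 truncn_itv // sqrtr_ge0. Qed.

Lemma J_range_in i : i \in J_range -> (0 < i)%N /\ (2 * i < n)%N.
Proof.
rewrite mem_index_iota => /andP[h1 h2]; split; first lia.
have /andP[h3 _] := J_first_itv; have q4 := sqrt_n_gt4.
have : (4 * m)%:R < n%:R :> R.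
  by rewrite natrM -sqrt_n_sqr; nra.
by rewrite ltr_nat; lia.
Qed.

Lemma lambda_le i : lam i <= (i%:R * pi / n%:R) ^+ 2.
Proof.
rewrite /lambda; have := sin_sqr_le (i%:R * pi / (2 * n%:R) : R).
have -> : (i%:R * pi / n%:R) ^+ 2 = 4 * (i%:R * pi / (2 * n%:R)) ^+ 2 :> R.
  by field; rewrite gt_eqF.
lra.
Qed.

Lemma pi_sqr_le16 : pi ^+ 2 <= 16 :> R.
Proof.
have := pi_ge0 R; have := pihalf_lt2 R => h1 h2.
by rewrite (_ : 16 = 4 ^+ 2); [rewrite lerXn2r ?nnegrE //; lra | ring].
Qed.

Lemma J_lambda i : i \in J_range -> lam i <= 64 / n%:R.
Proof.
rewrite mem_index_iota => /andP[h1 h2]; apply: le_trans (lambda_le i) _.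
have -> : 64 / n%:R = 4 * q ^+ 2 * 16 / n%:R ^+ 2.
  by rewrite sqrt_n_sqr; field; rewrite gt_eqF.
rewrite !exprMn exprVn ler_wpM2r ?invr_ge0 ?exprn_ge0 ?(ltW n0) //.
apply: ler_pM; rewrite ?sqr_ge0 ?pi_sqr_le16 //.
have -> : 4 * q ^+ 2 = (2 * q) ^+ 2 by ring.
have /andP[h3 _] := J_first_itv.
have : i%:R <= (2 * m)%:R :> R by rewrite ler_nat; lia.
rewrite natrM => h4; have := ler0n R i => h5.
by rewrite lerXn2r ?nnegrE //; lra.
Qed.

(** For low frequencies [lambda] is close to (i pi / n)^2, and the sum of i^2 for i between sqrt n
    and 2 sqrt n is close to (7 / 3) n^(3/2). This is the origin of the bias correction 7 pi^2 / 3
    in [s_hat]. *)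
Lemma J_lambda_sum :
  `|\sum_(i <- J_range) q * lam i - 7 * pi ^+ 2 / 3| <= 64 * 64 / q.
Proof.
have [Q [qE q4 q2]] : exists Q, [/\ q = Q, 4 < Q & n%:R = Q ^+ 2].
  by exists q; rewrite sqrt_n_gt4 sqrt_n_sqr.
have := J_first_itv; rewrite qE => /andP[mq qm].
have p16 := pi_sqr_le16; have p0 := sqr_ge0 (pi : R).
have q0 : Q != 0 by rewrite gt_eqF //; lra.
pose A : R := \sum_(i <- J_range) i%:R ^+ 2.
(* Difference of the sums of squares up to 2m and up to m. *)
have AE : 6 * A = 14 * m%:R ^+ 3 + 9 * m%:R ^+ 2 + m%:R.
  have h1 := sqr_sum_squares m; have h2 := sqr_sum_squares (2 * m).
  rewrite (@big_cat_nat _ _ _ m.+1 1 (2 * m).+1) //= -/A in h2; last by lia.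
  have -> : 6 * A = 6 * (\sum_(1 <= i < m.+1) i%:R ^+ 2 + A) -
    6 * (\sum_(1 <= i < m.+1) i%:R ^+ 2) by ring.
  by rewrite h1 h2 natrM; ring.
have H i : i \in J_range -> pi ^+ 2 / Q ^+ 3 * i%:R ^+ 2 - (4 * (16 * 16)) / Q ^+ 3 <= Q * lam i
   <= pi ^+ 2 / Q ^+ 3 * i%:R ^+ 2.
  move=> ir.
  have E : pi ^+ 2 / Q ^+ 3 * i%:R ^+ 2 = Q * (i%:R * pi / n%:R) ^+ 2.
    by rewrite q2; field.
  apply/andP; split; last by rewrite E ler_wpM2l ?lambda_le //; lra.
  pose x : R := i%:R * pi / (2 * n%:R).
  have x0 : 0 <= x by rewrite !mulr_ge0 ?invr_ge0 ?mulr_ge0 ?pi_ge0.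
  have x4 : x ^+ 2 <= 16 / Q ^+ 2.
    have h4 : i%:R <= 2 * Q.
      move: ir; rewrite mem_index_iota => /andP[_ h].
      have : i%:R <= (2 * m)%:R :> R by rewrite ler_nat; lia.
      rewrite natrM; lra.
    have i0 := ler0n R i.
    have -> : x ^+ 2 = i%:R ^+ 2 * pi ^+ 2 / (4 * Q ^+ 4).
      by rewrite /x q2; field.
    have -> : 16 / Q ^+ 2 = 4 * Q ^+ 2 * 16 / (4 * Q ^+ 4) by field.
    rewrite ler_wpM2r ?invr_ge0 ?mulr_ge0 ?exprn_ge0 //; try lra.
    apply: ler_pM; rewrite ?sqr_ge0 //.
    have -> : 4 * Q ^+ 2 = (2 * Q) ^+ 2 by ring.
    by rewrite lerXn2r ?nnegrE //; lra.
  have x1 : 0 <= 1 - x ^+ 2 / 2.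
    have : 16 / Q ^+ 2 <= 1.
      rewrite ler_pdivrMr ?exprn_gt0 //; last by lra.
      rewrite mul1r (_ : 16 = 4 ^+ 2); last by ring.
      by rewrite lerXn2r ?nnegrE //; lra.
    lra.
  have s2 : (x * (1 - x ^+ 2 / 2)) ^+ 2 <= sin x ^+ 2.
    have h := sin_ge_cubic x0.
    have h0 : 0 <= x * (1 - x ^+ 2 / 2) by rewrite mulr_ge0.
    by rewrite lerXn2r ?nnegrE // (le_trans h0 h).
  have x4' : x ^+ 2 * x ^+ 2 <= 16 * 16 / Q ^+ 4.
    have -> : 16 * 16 / Q ^+ 4 = (16 / Q ^+ 2) * (16 / Q ^+ 2) by field.
    by apply: ler_pM; rewrite ?sqr_ge0.
  have s3 : x ^+ 2 - 16 * 16 / Q ^+ 4 <= sin x ^+ 2.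
    apply: le_trans s2; have := sqr_ge0 (x * x ^+ 2); nra.
  rewrite E /lambda -/x.
  have -> : Q * (i%:R * pi / n%:R) ^+ 2 - (4 * (16 * 16)) / Q ^+ 3 =
     Q * (4 * (x ^+ 2 - 16 * 16 / Q ^+ 4)).
    by rewrite /x q2; field.
  by rewrite ler_wpM2l ?ler_pM2l //; lra.
have SU : \sum_(i <- J_range) Q * lam i <= pi ^+ 2 / Q ^+ 3 * A.
  rewrite /A mulr_sumr big_seq [leRHS]big_seq.
  by apply: ler_sum => i /H /andP[].
have SL : pi ^+ 2 / Q ^+ 3 * A - m%:R * ((4 * (16 * 16)) / Q ^+ 3) <= \sum_(i <- J_range) Q * lam i.
  have -> : m%:R * ((4 * (16 * 16)) / Q ^+ 3) = \sum_(i <- J_range) (4 * (16 * 16)) / Q ^+ 3.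
    rewrite sum_weights_const; congr (_%:R * _); lia.
  rewrite /A mulr_sumr -sumrB big_seq [leRHS]big_seq.
  by apply: ler_sum => i /H /andP[].
have m0 := ler0n R m.
have q3 : 0 < Q ^+ 3 by rewrite exprn_gt0 //; lra.
have E1 : m%:R * ((4 * (16 * 16)) / Q ^+ 3) <= (4 * (16 * 16)) / Q.
  have -> : (4 * (16 * 16)) / Q = Q * ((4 * (16 * 16)) / Q ^+ 3) * Q by field.
  have h : 0 <= (4 * (16 * 16)) / Q ^+ 3.
    by apply: divr_ge0; [lra|exact: ltW].
  have := ler_wpM2r h mq; have : 0 <= Q * ((4 * (16 * 16)) / Q ^+ 3) by rewrite mulr_ge0 //; lra.
  nra.
have E2 : `|A / Q ^+ 3 - 7 / 3| <= 12 / Q.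
  have -> : A / Q ^+ 3 - 7 / 3 = (6 * A - 14 * Q ^+ 3) / (6 * Q ^+ 3) by field.
  have -> : 12 / Q = 72 * Q ^+ 2 / (6 * Q ^+ 3) by field.
  rewrite normrM (@ger0_norm _ (_^-1)) ?invr_ge0; last by lra.
  apply: ler_wpM2r; first by rewrite invr_ge0; lra.
  rewrite AE ler_norml; apply/andP; split.
    have h3 : Q ^+ 3 - m%:R ^+ 3 <= 3 * Q ^+ 2.
      have -> : Q ^+ 3 - m%:R ^+ 3 = (Q - m%:R) * (Q ^+ 2 + Q * m%:R + m%:R ^+ 2) by ring.
      have h1 : 0 <= Q - m%:R <= 1 by lra.
      have h2 : Q * m%:R <= Q ^+ 2 by rewrite expr2 ler_wpM2l //; lra.
      have h4 : m%:R ^+ 2 <= Q ^+ 2 by rewrite lerXn2r ?nnegrE //; lra.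
      have h5 : 0 <= Q * m%:R by rewrite mulr_ge0 //; lra.
      have h6 := sqr_ge0 (m%:R : R).
      nra.
    have := sqr_ge0 (m%:R : R); have := sqr_ge0 Q; nra.
  have h4 : m%:R ^+ 2 <= Q ^+ 2 by rewrite lerXn2r ?nnegrE //; lra.
  have h5 : m%:R ^+ 3 <= Q ^+ 3 by rewrite lerXn2r ?nnegrE //; lra.
  have h6 : m%:R <= Q ^+ 2 by nra.
  have h7 := sqr_ge0 Q.
  nra.
have E3 : `|pi ^+ 2 / Q ^+ 3 * A - 7 * pi ^+ 2 / 3| <= 16 * 12 / Q.
  have -> : pi ^+ 2 / Q ^+ 3 * A - 7 * pi ^+ 2 / 3 = pi ^+ 2 * (A / Q ^+ 3 - 7 / 3) by field.
  have -> : 16 * 12 / Q = 16 * (12 / Q) by ring.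
  by rewrite normrM ger0_norm // ler_pM.
(* The two error contributions are 1024 / Q and 192 / Q; the last summand is slack for a round
   constant. *)
have E4 : 64 * 64 / Q = (4 * (16 * 16)) / Q + 16 * 12 / Q + (45 * 64) / Q by field.
have E5 : 0 <= (45 * 64) / Q by apply: divr_ge0; lra.
move: E3; rewrite E4 !ler_norml => /andP[h1 h2]; apply/andP; split; lra.
Qed.

Local Notation L := (@log2 R n%:R).
Definition Jtau_first : nat := Num.truncn (n%:R / L).
Local Notation i0 := Jtau_first.
Definition Jtau_range := index_iota i0 n.
Definition Jtau_scale : R := (n%:R - n%:R / L)^-1.
Local Notation rho := Jtau_scale.

Lemma ln2_ge_half : 1 / 2 <= ln 2 :> R.
Proof.
have -> : ln 2 = - ln (1 + - (1 / 2)) :> R.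
  by rewrite -lnV ?posrE; [congr ln; field|lra].
by rewrite lerNr le_ln1Dx //; lra.
Qed.

(** With x = n^(1/4), the logarithm is 4 ln x / ln 2 <= 8 ln x, and ln x is below x. *)
Lemma log2_bounds : 4 <= L /\ L ^+ 2 <= 64 * q.
Proof.
have l2 := ln2_ge_half; have q4 := sqrt_n_gt4; have q2 := sqrt_n_sqr.
have l20 : 0 < ln 2 :> R by lra.
have L4 : 4 <= L.
  rewrite /log2 ler_pdivlMr // mulr_natl -lnXn // ler_ln ?posrE ?exprn_gt0 //.
  by rewrite -natrX ler_nat; lia.
split=> //.
pose x := Num.sqrt q.
have x2 : x ^+ 2 = q by rewrite sqr_sqrtr // sqrtr_ge0.
have x0 : 0 < x by rewrite sqrtr_gt0; lra.
have : L <= 8 * x.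
  rewrite /log2 ler_pdivrMr // -q2 -x2 -exprM lnXn // -mulr_natl.
  have := ln_sublinear x0; nra.
rewrite -x2 (_ : 64 * x ^+ 2 = (8 * x) ^+ 2); last by ring.
by move=> h; rewrite lerXn2r ?nnegrE //; lra.
Qed.

Let L4 : 4 <= L. Proof. exact: log2_bounds.1. Qed.

Lemma Jtau_first_itv : i0%:R <= n%:R / L < i0%:R + 1.
Proof.
rewrite natr1 truncn_itv // divr_ge0 //; have := L4; lra.
Qed.

Let nL : n%:R / L <= n%:R / 4.
Proof.
by rewrite ler_wpM2l // lef_pV2 ?posrE //; have := L4; lra.
Qed.

Lemma Jtau_first_small : (4 * i0 <= n)%N.
Proof.
have /andP[h _] := Jtau_first_itv.
rewrite -(ler_nat R) natrM; have := nL; have := n0; lra.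
Qed.

Lemma Jtau_first_gt0 : (0 < i0)%N.
Proof.
rewrite -(ltr_nat R) /= -(ltrD2r 1) add0r.
have /andP[_] := Jtau_first_itv; apply: le_lt_trans.
have [_ L64] := log2_bounds; rewrite ler_pdivlMr ?mul1r; last by have := L4; lra.
have [Q [qE q4 q2]] : exists Q, [/\ q = Q, 4 < Q & n%:R = Q ^+ 2].
  by exists q; rewrite sqrt_n_gt4 sqrt_n_sqr.
rewrite qE in L64; have := L4; move: L64; move: L => l L64 l4.
rewrite q2 -ler_sqr ?nnegrE ?exprn_ge0 //; [|lra|lra].
apply: le_trans L64 _.
have h : 16 <= Q ^+ 2 by rewrite -q2 ler_nat; lia.
rewrite expr2 -{1}q2; nra.
Qed.

Lemma Jtau_first_ge : n%:R / (2 * L) <= i0%:R.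
Proof.
have /andP[_ h] := Jtau_first_itv.
have : 1 <= i0%:R :> R by rewrite ler1n Jtau_first_gt0.
have -> : n%:R / (2 * L) = n%:R / L / 2 by field; have := L4; lra.
have := L4; lra.
Qed.

Lemma Jtau_scale_bounds : n%:R^-1 <= rho <= 2 / n%:R.
Proof.
have h0 : 0 <= n%:R / L by rewrite divr_ge0 //; have := L4; lra.
have h1 : 0 < n%:R - n%:R / L by have := nL; have := n0; lra.
apply/andP; split; first by rewrite lef_pV2 ?posrE //; lra.
have -> : 2 / n%:R = (n%:R / 2)^-1 :> R by field; rewrite gt_eqF.
by rewrite lef_pV2 ?posrE //; have := nL; have := n0; lra.
Qed.

Lemma Jtau_range_in i : i \in Jtau_range -> (0 < i < n)%N.
Proof.
rewrite mem_index_iota => /andP[h ->].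
by rewrite (leq_trans Jtau_first_gt0 h).
Qed.

(** The sine increases up to pi / 2, so the first index is the worst. There the angle is at most 1 /
    2, where sin x >= x / 2, and the index is at least n / (2 L). *)
Lemma Jtau_lambda i : i \in Jtau_range -> (4 * L ^+ 2)^-1 <= lam i.
Proof.
rewrite mem_index_iota => /andP[h1 h2].
have p2 := pi_ge2 R; have p4 := pihalf_lt2 R; have L4' := L4; have nn := n0.
pose x j : R := j%:R * pi / (2 * n%:R).
have xmono : x i0 <= x i.
  rewrite /x; apply: ler_wpM2r; first by rewrite invr_ge0; lra.
  by apply: ler_wpM2r; [lra|rewrite ler_nat].
have x00 : 0 <= x i0 by rewrite /x !mulr_ge0 ?invr_ge0 ?mulr_ge0 ?(ltW n0) //; lra.
have xi : x i <= pi / 2.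
  have -> : x i = pi / 2 * (i%:R / n%:R) by rewrite /x; field; rewrite gt_eqF.
  by rewrite ler_piMr ?ler_pdivrMr ?mul1r ?ler_nat ?(ltnW h2) //; lra.
have x0h : x i0 <= 1 / 2.
  have -> : x i0 = pi * (4 * i0)%:R / (8 * n%:R) by rewrite /x natrM; field; rewrite gt_eqF.
  rewrite ler_pdivrMr ?mulr_gt0 //.
  have := Jtau_first_small; rewrite -(ler_nat R) => h.
  have : pi * (4 * i0)%:R <= 4 * n%:R :> R by apply: ler_pM => //; lra.
  lra.
have s0 : x i0 / 2 <= sin (x i0).
  apply: le_trans (sin_ge_cubic x00).
  have : x i0 ^+ 2 <= 1 by rewrite expr_le1 //; lra.
  by move=> h; rewrite ler_wpM2l //; lra.
have s1 : sin (x i0) <= sin (x i).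
  move: xmono; rewrite le_eqVlt => /orP[/eqP ->//|h].
  by rewrite ltW // ltr_sin // in_itv /=; lra.
have s2 : (x i0 / 2) ^+ 2 <= sin (x i) ^+ 2.
  by rewrite lerXn2r ?nnegrE; lra.
rewrite /lambda -/(x i).
apply: (@le_trans _ _ (4 * (x i0 / 2) ^+ 2)); last by rewrite ler_pM2l.
have -> : 4 * (x i0 / 2) ^+ 2 = i0%:R ^+ 2 * (pi ^+ 2 / (4 * n%:R ^+ 2)).
  by rewrite /x; field; rewrite gt_eqF.
have -> : (4 * L ^+ 2)^-1 = (n%:R / (2 * L)) ^+ 2 * (1 / n%:R ^+ 2) :> R.
  by field; rewrite gt_eqF //=; lra.
apply: ler_pM; rewrite ?sqr_ge0 ?divr_ge0 ?sqr_ge0 //.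
  rewrite lerXn2r ?nnegrE ?Jtau_first_ge // divr_ge0 //; lra.
have -> : 1 / n%:R ^+ 2 = 4 / (4 * n%:R ^+ 2) :> R by field; rewrite gt_eqF.
rewrite ler_wpM2r ?invr_ge0 ?mulr_ge0 ?sqr_ge0 //.
by rewrite (_ : 4 = 2 ^+ 2); [rewrite lerXn2r ?nnegrE //; lra | ring].
Qed.

Definition Jtau_weight i : R := rho * (lam i)^-1.

(** The logarithm in the first frequency keeps the weights below (2 / n) 4 L^2, hence O(n^(-1/2)) by
    [log2_bounds]; so the signal contributes little to [t_hat]. *)
Lemma Jtau_weight_bounds i : i \in Jtau_range ->
  0 <= Jtau_weight i <= 8 * 64 / q /\ Jtau_weight i * lam i = rho.
Proof.
move=> ir; have h := Jtau_lambda ir.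
have [_ L64] := log2_bounds.
have /andP[r1 r2] := Jtau_scale_bounds; have L4' := L4; have nn := n0.
have L0 : 0 < (4 * L ^+ 2)^-1.
  by rewrite invr_gt0 mulr_gt0 // exprn_gt0 //; lra.
have l0 : 0 < lam i by exact: lt_le_trans h.
have rho0 : 0 <= rho by apply: le_trans r1; rewrite invr_ge0 ltW.
split; last by rewrite /Jtau_weight -mulrA mulVf ?mulr1 // gt_eqF.
rewrite (mulr_ge0 rho0) ?invr_ge0 ?(ltW l0) //=.
have q4 := sqrt_n_gt4.
have -> : 8 * 64 / q = 2 / n%:R * (4 * 64 * q).
  by have := sqrt_n_sqr; move: q q4 => Q4 Q4' <-; field; lra.
apply: ler_pM => //; first by rewrite invr_ge0 ltW.
have : (lam i)^-1 <= 4 * L ^+ 2.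
  by rewrite -[leRHS]invrK lef_pV2 ?posrE // invr_gt0 // -invr_gt0.
lra.
Qed.

End estimator_weights.

(** * Bias of the quadratic forms in the spectral statistics *)

Section spectral_means.
Context {R : realType}.
Variables (n k : nat) (S U K : R) (t cbar : nat -> R) (C : nat -> nat -> R).
Hypothesis n16 : (16 < n)%N.
Hypothesis t_bound : forall l, (0 < l <= n)%N -> 0 <= t l <= U.
Hypothesis cbar_bound : forall j, (0 < j < n)%N -> 0 <= cbar j <= S / n%:R.
Hypothesis C_bound : forall j j', (0 < j < n)%N -> (0 < j' < n)%N ->
  `|C j j' - (j == j')%:R * cbar j| <= K / n%:R ^+ 2.
Local Notation q := (Num.sqrt (n%:R : R)).
Hypothesis kq : k%:R ^+ 2 <= q.

Local Notation f := (@grid_basis R n k).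
Local Notation s := (@sine_coef R n).
Local Notation lam := (@lambda R n).
Local Notation a := (@noise_coef R n k).
Local Notation Gam := (spectral_cov n k t C).
Local Notation A := (noise_level n k t).

(** The quantity that [s_hat] estimates at finite [n]. *)
Definition signal_level : R := \sum_(1 <= j < n) f j ^+ 2 * cbar j.

Let n0 : (0 < n)%N. Proof. by rewrite (leq_trans _ n16). Qed.
Let nR0 : 0 < n%:R :> R. Proof. by rewrite ltr0n. Qed.

Let SUK : [/\ 0 <= S, 0 <= U & 0 <= K].
Proof.
have h1 : (0 < 1 < n)%N by rewrite (leq_trans _ n16).
have /andP[a1 a2] := cbar_bound h1; have b := C_bound h1 h1.
have /andP[c1 c2] : 0 <= t n <= U by apply: t_bound; rewrite n0 /=.
split; last 1 first.
- by have := le_trans (normr_ge0 _) b; rewrite pmulr_lge0 // invr_gt0 exprn_gt0.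
- by have := le_trans a1 a2; rewrite pmulr_lge0 // invr_gt0.
- exact: le_trans c2.
Qed.

(** The share of the i-th variance due to the deviation of [C] from its diagonal model. *)
Definition signal_err i : R := \sum_(1 <= j < n) \sum_(1 <= j' < n)
  s i j * f j * (s i j' * f j') * (C j j' - (j == j')%:R * cbar j).

Lemma spectral_cov_diag i : Gam i i =
  \sum_(1 <= j < n) s i j ^+ 2 * (f j ^+ 2 * cbar j) + signal_err i +
  \sum_(1 <= l < n.+1) a i l * a i l * t l.
Proof.
rewrite /spectral_cov /signal_err -big_split; congr (_ + _).
apply: eq_big_nat => j hj /=.
transitivity (\sum_(1 <= j' < n) (s i j * f j * (s i j' * f j') * ((j == j')%:R * cbar j) +
  s i j * f j * (s i j' * f j') * (C j j' - (j == j')%:R * cbar j))).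
  by apply: eq_bigr => j' _; rewrite -mulrDr; congr (_ * _); ring.
rewrite big_split /=; congr (_ + _).
rewrite (bigD1_seq j) ?mem_index_iota ?iota_uniq //= eqxx mul1r big1 ?addr0.
  by ring.
by move=> j' /negPf jj'; rewrite eq_sym jj' mul0r mulr0.
Qed.

Lemma weighted_mean (r : seq nat) (w : nat -> R) :
  \sum_(i <- r) w i * Gam i i =
  \sum_(i <- r) w i * (\sum_(1 <= j < n) s i j ^+ 2 * (f j ^+ 2 * cbar j)) +
  \sum_(i <- r) w i * signal_err i +
  \sum_(i <- r) w i * (\sum_(1 <= l < n.+1) a i l * a i l * t l).
Proof.
rewrite -!big_split; apply: eq_bigr => i _ /=.
by rewrite spectral_cov_diag; ring.
Qed.

(* The linear statistics with weights [w] have covariance at most a multiple of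
   [max (w (lambda + 1 / n))]. *)
Lemma weighted_quadratic_le (r : seq nat) (w : nat -> R) (rho0 : R) (c : nat -> R) :
  uniq r -> (forall i, i \in r -> (0 < i < n)%N) ->
  (forall i, i \in r -> 0 <= w i) ->
  (forall i, i \in r -> w i * (lam i + n%:R^-1) <= rho0) ->
  \sum_(1 <= j < n) \sum_(1 <= j' < n)
    (\sum_(i <- r) c i * Num.sqrt (w i) * s i j) * f j *
    ((\sum_(i <- r) c i * Num.sqrt (w i) * s i j') * f j') * C j j' +
  \sum_(1 <= l < n.+1) t l * (\sum_(i <- r) c i * Num.sqrt (w i) * a i l) ^+ 2 <=
  (2 * (S + K) + 16 * U) * rho0 * \sum_(i <- r) c i ^+ 2.
Proof.
move=> ur hr w0 wr; have [S0 U0 K0] := SUK.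
pose d i := c i * Num.sqrt (w i).
have d2 i : i \in r -> d i ^+ 2 = c i ^+ 2 * w i.
  by move=> /w0 h; rewrite exprMn sqr_sqrtr.
have := signal_quadratic_le n0 cbar_bound C_bound
  (fun j => (\sum_(i <- r) d i * s i j) * f j).
set X := \sum_(1 <= j < n) \sum_(1 <= j' < n) _.
set Y := \sum_(1 <= l < n.+1) _.
have HY := noise_quadratic_le k n0 t_bound ur hr d.
rewrite -/Y in HY.
have HX : \sum_(1 <= j < n) ((\sum_(i <- r) d i * s i j) * f j) ^+ 2 <=
   2 * \sum_(i <- r) d i ^+ 2.
  rewrite -(sine_parseval ur hr) mulr_sumr ler_sum_nat // => j _.
  by rewrite exprMn mulrC ler_wpM2r ?sqr_ge0 // grid_basis_sqr_le.
move=> hX.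
have {}hX : X <= (S + K) / n%:R * (2 * \sum_(i <- r) d i ^+ 2).
  apply: le_trans hX _; apply: ler_wpM2l => //.
  by apply: divr_ge0; [lra|exact: ltW nR0].
apply: le_trans (lerD hX HY) _.
rewrite -mulrA !mulr_sumr -big_split /= big_seq [leRHS]big_seq.
apply: ler_sum => i ir; rewrite d2 //.
(* The term created by the variation of the cosine weight is absorbed into the 1 / n that comes from
   the signal. *)
have k2n : k%:R ^+ 2 / n%:R ^+ 2 <= n%:R^-1 :> R.
  have : k%:R ^+ 2 <= n%:R :> R.
    apply: le_trans kq _; have := @sqrt_n_gt4 R _ n16; have := @sqrt_n_sqr R n.
    by move: q => Q <-; nra.
  move=> h; rewrite ler_pdivrMr ?exprn_gt0 // expr2 mulKf // gt_eqF //.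
have W := wr i ir; have c0 := sqr_ge0 (c i); have w0i := w0 i ir.
have l0 : 0 <= lam i by exact: lambda_ge0.
have n0i : 0 < n%:R^-1 :> R by rewrite invr_gt0.
have E2 : w i / n%:R <= rho0 by apply: le_trans W; rewrite ler_wpM2l //; lra.
have E3 : w i * (4 * lam i + 16 * k%:R ^+ 2 / n%:R ^+ 2) <= 16 * rho0.
  apply: (@le_trans _ _ (16 * (w i * (lam i + n%:R^-1)))); last lra.
  rewrite [leRHS](_ : _ = w i * (16 * lam i + 16 * n%:R^-1)); last by ring.
  by rewrite ler_wpM2l // -mulrA; lra.
rewrite [leLHS](_ : _ = c i ^+ 2 * (2 * (S + K) * (w i / n%:R) +
  U * (w i * (4 * lam i + 16 * k%:R ^+ 2 / n%:R ^+ 2)))); last by ring.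
rewrite [leRHS](_ : _ =
  c i ^+ 2 * (2 * (S + K) * rho0 + U * (16 * rho0))); last by ring.
apply: ler_wpM2l => //; apply: lerD; apply: ler_wpM2l => //; lra.
Qed.

Let q_pos : [/\ 4 < q, q ^+ 2 = n%:R & 0 < q^-1].
Proof.
have h := sqrt_n_gt4 (R := R) n16; split=> //; first exact: sqrt_n_sqr.
by rewrite invr_gt0; lra.
Qed.

(** n^(-1/4), the value of [delta] in [noise_mean_diff]: as k^2 <= sqrt n, both terms of that bound
    become O([dlt]), with square O(n^(-1/2)). *)
Let dlt := Num.sqrt q^-1.
Let dlt_sqr : dlt ^+ 2 = q^-1.
Proof. by rewrite sqr_sqrtr //; have [_ _ h] := q_pos; rewrite ltW. Qed.
Let dlt_gt0 : 0 < dlt.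
Proof. by rewrite sqrtr_gt0; have [_ _ h] := q_pos. Qed.
Let dlt_inv : dlt^-1 + 1 <= 2 * dlt * q.
Proof.
have [q4 _ q0] := q_pos.
have E : dlt^-1 = dlt * q.
  by apply: (mulfI (lt0r_neq0 dlt_gt0)); rewrite divff ?gt_eqF // mulrA -expr2 dlt_sqr mulVf // gt_eqF //; lra.
have : dlt <= 1.
  rewrite -(@expr_le1 _ 2) ?(ltW dlt_gt0) // dlt_sqr invf_le1; lra.
have h1 : 0 < dlt^-1 by rewrite invr_gt0.
rewrite -mulrA -E => h; have : 1 <= dlt^-1 by rewrite invf_ge1.
lra.
Qed.

Let level_bound : 0 <= signal_level <= 2 * S.
Proof.
have H j : (1 <= j < n)%N -> 0 <= f j ^+ 2 * cbar j <= 2 * S / n%:R.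
  move=> hj; have /andP[c0 cS] := cbar_bound hj.
  rewrite mulr_ge0 ?sqr_ge0 //= -mulrA; apply: ler_pM; rewrite ?sqr_ge0 //.
  exact: grid_basis_sqr_le.
have [S0 _ _] := SUK.
apply/andP; split.
  by rewrite /signal_level big_nat sumr_ge0 // => j hj; case/andP: (H j hj).
apply: (@le_trans _ _ (\sum_(1 <= j < n) 2 * S / n%:R)).
  by apply: ler_sum_nat => j hj; case/andP: (H j hj).
rewrite sumr_const_nat -[leLHS]mulr_natr mulrAC ler_pdivrMr //.
by rewrite ler_wpM2l ?ler_nat ?leq_subr //; lra.
Qed.

Lemma sqr_sum6 (x1 x2 x3 x4 x5 x6 : R) :
  (x1 + x2 + x3 + x4 + x5 + x6) ^+ 2 <=
  6 * (x1 ^+ 2 + x2 ^+ 2 + x3 ^+ 2 + x4 ^+ 2 + x5 ^+ 2 + x6 ^+ 2).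
Proof.
have H x y : 2 * (x * y) <= x ^+ 2 + y ^+ 2 :> R.
  by have := sqr_ge0 (x - y); rewrite sqrrB; lra.
have := H x1 x2; have := H x1 x3; have := H x1 x4; have := H x1 x5; have := H x1 x6.
have := H x2 x3; have := H x2 x4; have := H x2 x5; have := H x2 x6.
have := H x3 x4; have := H x3 x5; have := H x3 x6.
have := H x4 x5; have := H x4 x6; have := H x5 x6.
by rewrite !expr2; nra.
Qed.

Let sum6_le (x1 x2 x3 x4 x5 x6 c1 c2 c3 c4 c5 c6 z : R) :
  x1 <= c1 / z -> x2 <= c2 / z -> x3 <= c3 / z -> x4 <= c4 / z ->
  x5 <= c5 / z -> x6 <= c6 / z -> 6 * (x1 + x2 + x3 + x4 + x5 + x6) <=
  6 * (c1 + c2 + c3 + c4 + c5 + c6) / z.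
Proof. by move=> *; rewrite -mulrA !mulrDl; lra. Qed.

Let level_sum_bound : 0 <= A <= 2 * U.
Proof. exact: noise_level_bound. Qed.

Let div_q_le (x : R) : 0 <= x -> (x / q) ^+ 2 <= x ^+ 2 / q.
Proof.
move=> x0; have [q4 _ q0] := q_pos; rewrite exprMn ler_wpM2l ?sqr_ge0 //.
have h : q^-1 <= 1 by rewrite invf_le1; lra.
by rewrite expr2; apply: ler_piMl => //; exact: ltW.
Qed.

Let J_in i : i \in J_range (R := R) n -> (0 < i < n)%N /\ (2 * i < n)%N.
Proof. by move=> ir; have [h1 h2] := J_range_in n16 ir; split=> //; lia. Qed.

Let J_size_const (x : R) : 0 <= x ->
  \sum_(i <- J_range (R := R) n) x <= q * x.
Proof.
move=> x0; rewrite sum_weights_const ler_wpM2r //.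
have /andP[h _] := @J_first_itv R n.
by rewrite subSS mul2n -addnn addnK.
Qed.

(** The six summands bound the squares of [p1] to [p6] in the next proof; 6 comes from
    [sqr_sum6]. *)
Definition J_mean_const : R :=
  6 * ((2 * S) ^+ 2 + 2 * S ^+ 2 + 4 * K ^+ 2 + (144 * U) ^+ 2 +
       (64 * 64 * (2 * U)) ^+ 2 + 64 * 64 * (2 * U ^+ 2)).

(** The bias is split into six errors: normalisation of the weights, signal oscillation,
    off-diagonal covariance, frozen cosine weight, the limit 7 pi^2 / 3, and noise oscillation. *)
Lemma J_mean_error :
  (\sum_(i <- J_range (R := R) n) q * Gam i i - signal_level -
     7 * pi ^+ 2 / 3 * A) ^+ 2 <= J_mean_const / q.
Proof.
have [q4 q2 qi] := q_pos; have [S0 U0 K0] := SUK.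
have /andP[A0 AU] := level_sum_bound; have /andP[X0 XS] := level_bound.
have q0 : 0 < q by lra.
rewrite weighted_mean signal_main.
set r := J_range n; have ur : uniq r by exact: iota_uniq.
have hr i : i \in r -> (0 < i < n)%N by move=> /J_in[].
have hr2 i : i \in r -> (2 * i < n)%N by move=> /J_in[].
pose N1 := \sum_(i <- r) q * (\sum_(1 <= l < n.+1) a i l * a i l * t l).
pose N2 := \sum_(i <- r) q * (\sum_(1 <= l < n.+1)
  t l * f l ^+ 2 * (s i l.-1 - s i l) ^+ 2).
rewrite -/N1 -/signal_level.
have N2E := noise_main k t n0 r (fun=> q); rewrite /= -/N2 in N2E.
pose p1 := (\sum_(i <- r) q) / n%:R * signal_level - signal_level.
pose p2 := - \sum_(i <- r) q * signal_osc n k cbar i.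
pose p3 := \sum_(i <- r) q * signal_err i.
pose p4 := N1 - N2.
pose p5 := (\sum_(i <- r) q * lam i - 7 * pi ^+ 2 / 3) * A.
pose p6 := \sum_(i <- r) q * lam i * noise_osc n k t i.
rewrite [X in X ^+ 2](_ : _ = p1 + p2 + p3 + p4 + p5 + p6); last first.
  by rewrite /p1 /p2 /p3 /p4 /p5 /p6 N2E; ring.
apply: le_trans (sqr_sum6 _ _ _ _ _ _) _.
have W2 : \sum_(i <- r) q ^+ 2 <= q * n%:R.
  by apply: le_trans (J_size_const (sqr_ge0 q)) _; rewrite q2.
have E1 : p1 ^+ 2 <= (2 * S) ^+ 2 / q.
  apply: (@le_trans _ _ ((2 * S / q) ^+ 2)); last by apply: div_q_le; lra.
  apply: sqr_le_of_norm.
  have -> : p1 = ((\sum_(i <- r) q) / n%:R - 1) * signal_level by rewrite /p1; ring.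
  rewrite normrM (ger0_norm X0) mulrC; apply: ler_pM => //.
  rewrite sum_weights_const subSS mul2n -addnn addnK.
  have /andP[h1 h2] := @J_first_itv R n.
  (* The weights sum to n up to the factor [sqrt n] / sqrt n, which differs from 1 by at most 1 /
     sqrt n. *)
  have -> : (J_first (R := R) n)%:R * q / n%:R = (J_first (R := R) n)%:R / q.
    move: (J_first n)%:R => M; by have := q2; have := q4; move: q => Q Q4 <-; field; lra.
  rewrite ler_norml lerBlDr lerBrDr ler_pdivrMr // mulrDl mulVf ?gt_eqF // mul1r.
  apply/andP; split; last lra.
  by rewrite ler_pdivlMr // mulrDl mulNr mulVf ?gt_eqF //; lra.
have E2 : p2 ^+ 2 <= 2 * S ^+ 2 / q.
  rewrite sqrrN; apply: le_trans (sqr_sum_mul_le W2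
    (signal_osc_sqr_sum k n0 cbar_bound ur hr hr2)) _.
  rewrite le_eqVlt; apply/orP; left; apply/eqP.
  by have := q2; have := q4; move: q => Q Q4 <-; field; lra.
have E3 : p3 ^+ 2 <= 4 * K ^+ 2 / q.
  apply: le_trans (sqr_sum_mul_le W2
    (signal_error_sqr_sum k n0 C_bound ur hr)) _.
  rewrite le_eqVlt; apply/orP; left; apply/eqP.
  by have := q2; have := q4; move: q => Q Q4 <-; field; lra.
have L64 i : i \in r -> 0 <= q * lam i <= 64 / q.
  move=> ir; rewrite mulr_ge0 ?lambda_ge0 ?(ltW q0) //=.
  rewrite -(ler_pM2l qi) mulKf ?gt_eqF //.
  apply: le_trans (J_lambda n16 ir) _; rewrite le_eqVlt; apply/orP; left; apply/eqP.
  by have := q2; have := q4; move: q => Q Q4 <-; field; lra.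
have Wl : \sum_(i <- r) q * lam i <= 64.
  apply: (@le_trans _ _ (\sum_(i <- r) 64 / q)).
    by rewrite big_seq [leRHS]big_seq; apply: ler_sum => i /L64 /andP[].
  have := J_size_const (_ : 0 <= 64 / q); rewrite divr_ge0 ?(ltW q0) // => /(_ isT).
  by rewrite mulrCA divff ?mulr1 // gt_eqF.
have Wl2 : \sum_(i <- r) (q * lam i) ^+ 2 <= 64 * 64 / q.
  apply: (@le_trans _ _ (\sum_(i <- r) (64 / q) ^+ 2)).
    rewrite big_seq [leRHS]big_seq; apply: ler_sum => i /L64 /andP[h1 h2].
    by apply: sqr_le_of_norm; rewrite ger0_norm.
  apply: le_trans (J_size_const (sqr_ge0 _)) _.
  by rewrite le_eqVlt; apply/orP; left; apply/eqP; field; lra.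
have W1 : \sum_(i <- r) q <= n%:R.
  by apply: le_trans (J_size_const (ltW q0)) _; rewrite -expr2 q2.
have E4 : p4 ^+ 2 <= (144 * U) ^+ 2 / q.
  rewrite -dlt_sqr -exprMn; apply: sqr_le_of_norm.
  apply: le_trans (noise_mean_diff k n0 t_bound hr dlt_gt0 (fun i _ => ltW q0)) _.
  have h1 : 2 * dlt * (\sum_(i <- r) q * lam i) <= 128 * dlt.
    have := ler_wpM2l (ltW dlt_gt0) Wl; lra.
  have h2 : (dlt^-1 + 1) * (8 * k%:R ^+ 2 / n%:R ^+ 2) * (\sum_(i <- r) q) <=
      2 * dlt * q * (8 * q / n%:R ^+ 2) * n%:R.
    have dd : 0 <= dlt^-1 by rewrite invr_ge0 ltW.
    have k0 := sqr_ge0 (k%:R : R).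
    have hk : 8 * k%:R ^+ 2 / n%:R ^+ 2 <= 8 * q / n%:R ^+ 2.
      by rewrite ler_wpM2r ?invr_ge0 ?sqr_ge0 // ler_pM2l.
    have hk0 : 0 <= 8 * k%:R ^+ 2 / n%:R ^+ 2 :> R.
      by apply: divr_ge0; [apply: mulr_ge0|exact: sqr_ge0].
    apply: ler_pM => //.
    - by apply: mulr_ge0 => //; lra.
    - by apply: sumr_ge0 => i _; lra.
    - by apply: ler_pM => //; lra.
  have h3 : 2 * dlt * q * (8 * q / n%:R ^+ 2) * n%:R = 16 * dlt.
    move: dlt => D; by have := q2; have := q4; move: q => Q Q4 <-; field; lra.
  rewrite [leRHS](_ : _ = U * (128 * dlt + 16 * dlt)); last by ring.
  by apply: ler_wpM2l => //; apply: lerD => //; rewrite -h3.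
have E5 : p5 ^+ 2 <= (64 * 64 * (2 * U)) ^+ 2 / q.
  apply: (@le_trans _ _ ((64 * 64 * (2 * U) / q) ^+ 2)); last first.
    by apply: div_q_le; rewrite !mulr_ge0.
  apply: sqr_le_of_norm; rewrite normrM (ger0_norm A0).
  rewrite [leRHS](_ : _ = 64 * 64 / q * (2 * U)); last by ring.
  by apply: ler_pM => //; exact: J_lambda_sum.
have E6 : p6 ^+ 2 <= 64 * 64 * (2 * U ^+ 2) / q.
  apply: le_trans (sqr_sum_mul_le Wl2 (noise_osc_sqr_sum k n0 t_bound ur hr hr2)) _.
  by rewrite le_eqVlt; apply/orP; left; apply/eqP; ring.
exact: sum6_le E1 E2 E3 E4 E5 E6.
Qed.

(** At the midpoints, a cosine of frequency 2 (n - i) is minus the one of frequency 2 i. *)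
Lemma noise_osc_reflect i : (i <= n)%N ->
  noise_osc n k t (n - i) = - noise_osc n k t i.
Proof.
move=> ni; rewrite /noise_osc -[RHS]mulNr -sumrN; congr (_ / _).
apply: eq_big_nat => l /andP[l0 _]; rewrite -[RHS]mulNr; congr (_ * _).
have -> : 2 * (n - i)%:R * pi * (l%:R - 1 / 2) / n%:R =
    (- (2 * i%:R * pi * (l%:R - 1 / 2) / n%:R) + pi) + l.-1%:R * (2 * pi) :> R.
  by case: l l0 => // l _; rewrite natrB // succnK -natr1; field; rewrite gt_eqF.
by rewrite cosDn2pi cosDpi cosN.
Qed.

(** Reflection maps the sum to its opposite. It lets the sum over the high frequencies, which leave
    the orthogonality range, be replaced by minus the sum over the low ones. *)
Lemma noise_osc_sum0 : \sum_(1 <= i < n) noise_osc n k t i = 0.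
Proof.
have : \sum_(1 <= i < n) noise_osc n k t i = - \sum_(1 <= i < n) noise_osc n k t i.
  rewrite {1}big_nat_rev -sumrN; apply: eq_big_nat => i /andP[_ /ltnW h] /=.
  by rewrite add1n subSS noise_osc_reflect.
by move=> h; lra.
Qed.

Let T_in i : i \in Jtau_range (R := R) n -> (0 < i < n)%N.
Proof. exact: Jtau_range_in. Qed.

Let T_low_in i : i \in index_iota 1 (Jtau_first (R := R) n) ->
  (0 < i < n)%N /\ (2 * i < n)%N.
Proof.
have := @Jtau_first_small R n n16; rewrite mem_index_iota.
by move: (Jtau_first n); clear; lia.
Qed.

Let T_sum_le (F : nat -> R) (x : R) : 0 <= x ->
  (forall i, i \in Jtau_range (R := R) n -> F i <= x) ->
  \sum_(i <- Jtau_range (R := R) n) F i <= n%:R * x.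
Proof.
move=> x0 H; apply: (@le_trans _ _ (\sum_(i <- Jtau_range (R := R) n) x)).
  by rewrite big_seq [leRHS]big_seq; apply: ler_sum.
by rewrite sum_weights_const ler_wpM2r // ler_nat leq_subr.
Qed.

Let inv_n_le (x : R) : 0 <= x -> x / n%:R <= x / q.
Proof.
move=> x0; have [q4 q2 q0] := q_pos; rewrite ler_wpM2l // lef_pV2 ?posrE //; last lra.
by rewrite -[leRHS]q2 expr2 ler_peMr; lra.
Qed.

Definition Jtau_mean_const : R :=
  6 * ((8 * 64 * (2 * S)) ^+ 2 + 0 + (8 * 64) ^+ 2 * (4 * K ^+ 2) +
   (U * (4 + 16 * (8 * 64))) ^+ 2 + (4 * U) ^+ 2 + 8 * U ^+ 2).

Lemma Jtau_mean_error :
  (\sum_(i <- Jtau_range (R := R) n) @Jtau_weight R n i * Gam i i - A) ^+ 2 <=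
  Jtau_mean_const / q.
Proof.
have [q4 q2 qi] := q_pos; have [S0 U0 K0] := SUK.
have /andP[A0 AU] := level_sum_bound.
have q0 : 0 < q by lra.
rewrite weighted_mean.
set r := Jtau_range n; have ur : uniq r by exact: iota_uniq.
pose w := @Jtau_weight R n; rewrite -/w.
have wb i : i \in r -> 0 <= w i <= 8 * 64 / q by move=> /(Jtau_weight_bounds n16)[].
have wl i : i \in r -> w i * lam i = @Jtau_scale R n by move=> /(Jtau_weight_bounds n16)[].
have /andP[rho1 rho2] := @Jtau_scale_bounds R n n16.
set rho := @Jtau_scale R n in wl rho1 rho2.
have rho0 : 0 <= rho by apply: le_trans rho1; rewrite invr_ge0 ltW.
have wlE : \sum_(i <- r) w i * lam i = (n - Jtau_first (R := R) n)%:R * rho.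
  by rewrite -sum_weights_const big_seq [RHS]big_seq; apply: eq_bigr => i /wl.
have i0n : (Jtau_first (R := R) n <= n)%N by apply: leq_trans (leq_pmull _ _) (@Jtau_first_small R n n16).
pose N1 := \sum_(i <- r) w i * (\sum_(1 <= l < n.+1) a i l * a i l * t l).
pose N2 := \sum_(i <- r) w i * (\sum_(1 <= l < n.+1)
  t l * f l ^+ 2 * (s i l.-1 - s i l) ^+ 2).
rewrite -/N1.
have N2E := noise_main k t n0 r w; rewrite /= -/N2 in N2E.
pose p1 := \sum_(i <- r) w i * (\sum_(1 <= j < n) s i j ^+ 2 * (f j ^+ 2 * cbar j)).
pose p3 := \sum_(i <- r) w i * signal_err i.
pose p4 := N1 - N2.
pose p5 := (\sum_(i <- r) w i * lam i - 1) * A.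
pose p6 := \sum_(i <- r) w i * lam i * noise_osc n k t i.
(* The 0 fills the second place, so that the six-term inequality is reused. *)
rewrite [X in X ^+ 2](_ : _ = p1 + 0 + p3 + p4 + p5 + p6); last first.
  by rewrite /p1 /p3 /p4 /p5 /p6 N2E; ring.
apply: le_trans (sqr_sum6 _ _ _ _ _ _) _.
have c0 : 0 <= 8 * 64 / q by apply: divr_ge0; [exact: mulr_ge0|lra].
have E1 : p1 ^+ 2 <= (8 * 64 * (2 * S)) ^+ 2 / q.
  apply: (@le_trans _ _ ((8 * 64 * (2 * S) / q) ^+ 2)); last first.
    by apply: div_q_le; rewrite !mulr_ge0.
  apply: sqr_le_of_norm.
  have h1 i : i \in r -> 0 <= \sum_(1 <= j < n) s i j ^+ 2 * (f j ^+ 2 * cbar j) <= 2 * S / n%:R.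
    move=> ir; apply/andP; split.
      rewrite big_nat sumr_ge0 // => j hj; apply: mulr_ge0; first exact: sqr_ge0.
      by apply: mulr_ge0; [exact: sqr_ge0|case/andP: (cbar_bound hj)].
    rewrite [leRHS](_ : _ = (\sum_(1 <= j < n) s i j * s i j) * (2 * S / n%:R)).
      2: by rewrite sine_orthonormal ?T_in // eqxx mul1r.
    rewrite mulr_suml; apply: ler_sum_nat => j hj; rewrite -expr2.
    apply: ler_wpM2l; first exact: sqr_ge0.
    have /andP[b0 b1] := cbar_bound hj; rewrite -[leRHS]mulrA; apply: ler_pM => //.
      exact: sqr_ge0.
    exact: grid_basis_sqr_le.
  have p0 : 0 <= p1.
    rewrite /p1 big_seq sumr_ge0 // => i ir; have /andP[a0 _] := wb i ir.
    by apply: mulr_ge0 => //; case/andP: (h1 i ir).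
  rewrite ger0_norm //.
  have -> : 8 * 64 * (2 * S) / q = n%:R * (8 * 64 / q * (2 * S / n%:R)).
    by field; rewrite !gt_eqF.
  apply: T_sum_le.
    by apply: mulr_ge0 => //; apply: divr_ge0; [exact: mulr_ge0|exact: ltW].
  move=> i ir; have /andP[a0 a1] := wb i ir; have /andP[b0 b1] := h1 i ir.
  exact: ler_pM.
have E2 : (0 : R) ^+ 2 <= 0 / q by rewrite expr0n mul0r.
have E3 : p3 ^+ 2 <= (8 * 64) ^+ 2 * (4 * K ^+ 2) / q.
  have W2 : \sum_(i <- r) w i ^+ 2 <= n%:R * (8 * 64 / q) ^+ 2.
    apply: T_sum_le; first exact: sqr_ge0.
    move=> i ir; have /andP[a0 a1] := wb i ir.
    by apply: sqr_le_of_norm; rewrite ger0_norm.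
  apply: le_trans (sqr_sum_mul_le W2
    (signal_error_sqr_sum k n0 C_bound ur T_in)) _.
  have -> : n%:R * (8 * 64 / q) ^+ 2 * (4 * K ^+ 2 / n%:R ^+ 2) =
      (8 * 64) ^+ 2 * (4 * K ^+ 2) / n%:R / n%:R.
    have := q2; have := q4; move: (8 * 64) q => Z Q Q4 <-; field; lra.
  apply: (@le_trans _ _ ((8 * 64) ^+ 2 * (4 * K ^+ 2) / n%:R)).
    apply: ler_piMr; last by rewrite invf_le1 // ler1n.
    apply: divr_ge0; last exact: ltW.
    by apply: mulr_ge0; [exact: sqr_ge0|apply: mulr_ge0; [|exact: sqr_ge0]].
  apply: inv_n_le.
  by apply: mulr_ge0; [exact: sqr_ge0|apply: mulr_ge0; [|exact: sqr_ge0]].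
have Wl : \sum_(i <- r) w i * lam i <= 2.
  rewrite wlE; apply: (@le_trans _ _ (n%:R * (2 / n%:R))).
    by apply: ler_pM => //; rewrite ler_nat leq_subr.
  by rewrite mulrCA divff ?mulr1 // gt_eqF.
have E4 : p4 ^+ 2 <= (U * (4 + 16 * (8 * 64))) ^+ 2 / q.
  rewrite -dlt_sqr -exprMn; apply: sqr_le_of_norm.
  apply: le_trans (noise_mean_diff k n0 t_bound T_in dlt_gt0 _) _.
    by move=> i /wb /andP[].
  have h1 : 2 * dlt * (\sum_(i <- r) w i * lam i) <= 4 * dlt.
    have := ler_wpM2l (ltW dlt_gt0) Wl; lra.
  have W1 : \sum_(i <- r) w i <= n%:R * (8 * 64 / q).
    by apply: T_sum_le => // i /wb /andP[].
  have h2 : (dlt^-1 + 1) * (8 * k%:R ^+ 2 / n%:R ^+ 2) * (\sum_(i <- r) w i) <=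
      2 * dlt * q * (8 * q / n%:R ^+ 2) * (n%:R * (8 * 64 / q)).
    have dd : 0 <= dlt^-1 by rewrite invr_ge0 ltW.
    have k0 := sqr_ge0 (k%:R : R).
    have hk : 8 * k%:R ^+ 2 / n%:R ^+ 2 <= 8 * q / n%:R ^+ 2.
      by rewrite ler_wpM2r ?invr_ge0 ?sqr_ge0 // ler_pM2l.
    have hk0 : 0 <= 8 * k%:R ^+ 2 / n%:R ^+ 2 :> R.
      by apply: divr_ge0; [apply: mulr_ge0|exact: sqr_ge0].
    apply: ler_pM => //.
    - by apply: mulr_ge0 => //; lra.
    - by rewrite big_seq; apply: sumr_ge0 => i /wb /andP[].
    - by apply: ler_pM => //; lra.
  have h3 : 2 * dlt * q * (8 * q / n%:R ^+ 2) * (n%:R * (8 * 64 / q)) <=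
      16 * (8 * 64) * dlt.
    have -> : 2 * dlt * q * (8 * q / n%:R ^+ 2) * (n%:R * (8 * 64 / q)) =
      16 * (8 * 64) * dlt * q^-1.
      have := q2; have := q4; move: dlt (8 * 64) q => D Z Q Q4 <-; field; lra.
    apply: ler_piMr; last by rewrite invf_le1; lra.
    by apply: mulr_ge0; [exact: mulr_ge0|exact: ltW].
  rewrite [leRHS](_ : _ = U * (4 * dlt + 16 * (8 * 64) * dlt)); last by ring.
  by apply: ler_wpM2l => //; apply: lerD => //; exact: le_trans h2 h3.
have E5 : p5 ^+ 2 <= (4 * U) ^+ 2 / q.
  apply: (@le_trans _ _ ((4 * U / q) ^+ 2)); last first.
    by apply: div_q_le; rewrite !mulr_ge0.
  apply: sqr_le_of_norm; rewrite normrM (ger0_norm A0).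
  apply: (@le_trans _ _ (4 * U / n%:R)); last by apply: inv_n_le; rewrite mulr_ge0.
  rewrite [leRHS](_ : _ = 2 / n%:R * (2 * U)); last by ring.
  apply: ler_pM => //; apply: le_trans rho2.
  have /andP[j1 j2] := @Jtau_first_itv R n n16.
  have dd : 0 < n%:R - n%:R / log2 n%:R :> R.
    by rewrite -invr_gt0; apply: lt_le_trans rho1; rewrite invr_gt0.
  have -> : \sum_(i <- r) w i * lam i - 1 =
     (n%:R / log2 n%:R - (Jtau_first (R := R) n)%:R) * rho.
    have e : (n%:R - n%:R / log2 n%:R) * rho = 1.
      by rewrite [rho]/(_^-1) mulfV // gt_eqF.
    rewrite wlE natrB //; transitivity ((n%:R - (Jtau_first (R := R) n)%:R) * rho -
      (n%:R - n%:R / log2 n%:R) * rho); [by rewrite e|ring].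
  by rewrite ger0_norm ?mulr_ge0 ?subr_ge0 // ler_piMl //; lra.
have E6 : p6 ^+ 2 <= 8 * U ^+ 2 / q.
  pose r' := index_iota 1 (Jtau_first (R := R) n).
  have hr' i : i \in r' -> (0 < i < n)%N /\ (2 * i < n)%N.
    exact: T_low_in.
  (* The weights times [lambda] are the constant [rho], so the vanishing total sum moves the problem
     to the low frequencies [r'], where Bessel applies. *)
  have -> : p6 = - rho * \sum_(i <- r') noise_osc n k t i.
    have := noise_osc_sum0; rewrite (@big_cat_nat _ _ _ (Jtau_first (R := R) n)) //=;
      last exact: Jtau_first_gt0.
    move=> /(canRL (addKr _)); rewrite addr0 => h.
    rewrite mulNr -mulrN -h mulr_sumr /p6 big_seq [RHS]big_seq.
    by apply: eq_bigr => i /wl ->.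
  rewrite exprMn sqrrN.
  have h1 : (\sum_(i <- r') 1 * noise_osc n k t i) ^+ 2 <= n%:R * (2 * U ^+ 2).
    apply: (sqr_sum_mul_le _ (noise_osc_sqr_sum k n0 t_bound _ _ _)).
    - rewrite expr1n sum_weights_const mulr1 ler_nat.
      by rewrite (leq_trans (leq_subr _ _)).
    - exact: iota_uniq.
    - by move=> i /hr'[].
    - by move=> i /hr'[].
  under [in leLHS]eq_bigr do rewrite -[noise_osc _ _ _ _]mul1r.
  apply: (@le_trans _ _ ((2 / n%:R) ^+ 2 * (n%:R * (2 * U ^+ 2)))).
    apply: ler_pM => //; rewrite ?sqr_ge0 //.
    by apply: sqr_le_of_norm; rewrite ger0_norm.
  have -> : (2 / n%:R) ^+ 2 * (n%:R * (2 * U ^+ 2)) = 8 * U ^+ 2 / n%:R.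
    by field; rewrite gt_eqF.
  by apply: inv_n_le; apply: mulr_ge0; [|exact: sqr_ge0].
exact: sum6_le E1 E2 E3 E4 E5 E6.
Qed.

Lemma J_weight_bound i : i \in J_range (R := R) n ->
  q * (lam i + n%:R^-1) <= 65 / q.
Proof.
have [q4 q2 qi] := q_pos; move=> ir.
rewrite [leRHS](_ : _ = q * (64 / n%:R + n%:R^-1)); last first.
  by have := q2; have := q4; move: q => Q Q4 <-; field; lra.
apply: ler_wpM2l; first by lra.
by rewrite lerD2r; exact: J_lambda.
Qed.

Lemma Jtau_weight_bound i : i \in Jtau_range (R := R) n ->
  @Jtau_weight R n i * (lam i + n%:R^-1) <= 130 / n%:R.
Proof.
have [q4 q2 qi] := q_pos; move=> ir.
have [/andP[h0 h1] h2] := Jtau_weight_bounds n16 ir.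
have /andP[_ h3] := @Jtau_scale_bounds R n n16.
(* The part in [lambda] equals the scale, at most 2 / n; the weight itself is at most 512 / q <=
   128. *)
rewrite mulrDr h2 (_ : 130 = 2 + 8 * 16); last by ring.
rewrite mulrDl; apply: lerD => //; apply: ler_wpM2r; first by rewrite invr_ge0 ltW.
apply: le_trans h1 _; rewrite ler_pdivrMr; lra.
Qed.

End spectral_means.

(** * Calculus of integrals with prescribed value *)

Section integrals.
Context {d : measure_display} {T : measurableType d} {R : realType}.
Variables (mu : {measure set T -> \bar R}) (D : set T).
Hypothesis mD : measurable D.

(** Integrability and value are carried together, so that linear combinations compose without side
    conditions. *)
Definition has_integral (X : T -> R) (x : R) : Prop :=
  mu.-integrable D (EFin \o X) /\ (\int[mu]_(w in D) (X w)%:E = x%:E)%E.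

Lemma eq_has_integral (X Y : T -> R) x :
  (forall w, D w -> X w = Y w) -> has_integral X x -> has_integral Y x.
Proof.
move=> XY [iX eX]; split.
  by apply: eq_integrable iX => // w /[!inE] Dw /=; rewrite XY.
by rewrite -eX; apply: eq_integral => w /[!inE] Dw; rewrite XY.
Qed.

Lemma has_integralD (X Y : T -> R) x y :
  has_integral X x -> has_integral Y y ->
  has_integral (fun w => X w + Y w) (x + y).
Proof.
move=> [iX eX] [iY eY]; split.
  have -> : EFin \o (fun w => X w + Y w) = ((EFin \o X) \+ (EFin \o Y))%E.
    by apply/funext => w /=; rewrite EFinD.
  exact: integrableD.
under eq_integral do rewrite EFinD.
by rewrite integralD //= eX eY.
Qed.

Lemma has_integralZ (c : R) (X : T -> R) x :
  has_integral X x -> has_integral (fun w => c * X w) (c * x).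
Proof.
move=> [iX eX]; split.
  have -> : EFin \o (fun w => c * X w) = (fun w => (c%:E * (EFin \o X) w)%E).
    by apply/funext => w /=; rewrite EFinM.
  exact: integrableZl.
under eq_integral do rewrite EFinM.
by rewrite integralZl //= eX.
Qed.

Lemma has_integralB (X Y : T -> R) x y :
  has_integral X x -> has_integral Y y ->
  has_integral (fun w => X w - Y w) (x - y).
Proof.
move=> hX hY; apply: (eq_has_integral (X := fun w => X w + -1 * Y w)).
  by move=> w _; rewrite mulN1r.
by rewrite -[- y]mulN1r; apply: has_integralD => //; exact: has_integralZ.
Qed.

Lemma has_integral0 : has_integral (fun=> 0) 0.
Proof. by split; [exact: integrable0|rewrite integral0]. Qed.

Lemma has_integral_sum (I : Type) (r : seq I) (X : I -> T -> R) (x : I -> R) :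
  (forall i, has_integral (X i) (x i)) ->
  has_integral (fun w => \sum_(i <- r) X i w) (\sum_(i <- r) x i).
Proof.
move=> H; elim: r => [|i r IH].
  rewrite big_nil; apply: eq_has_integral has_integral0 => w _.
  by rewrite big_nil.
rewrite big_cons; apply: eq_has_integral (has_integralD (H i) IH) => w _.
by rewrite big_cons.
Qed.

Lemma has_integral_unique (X : T -> R) x y :
  has_integral X x -> has_integral X y -> x = y.
Proof. by move=> [_ e] [_]; rewrite e => -[]. Qed.

Lemma le_has_integral (X Y : T -> R) x y :
  (forall w, D w -> X w <= Y w) -> has_integral X x -> has_integral Y y -> x <= y.
Proof.
move=> XY hX hY; rewrite -subr_ge0; have [_ e] := has_integralB hY hX.
by rewrite -lee_fin -e; apply: integral_ge0 => w Dw; rewrite lee_fin subr_ge0 XY.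
Qed.

End integrals.

(** * Expectations and the variance of quadratic forms *)

Section means.
Context {d : measure_display} {T : measurableType d} {R : realType}.
Variable P : probability T R.

Definition has_mean (X : T -> R) (x : R) : Prop := has_integral P setT X x.

Lemma eq_has_mean (X Y : T -> R) x : X =1 Y -> has_mean X x -> has_mean Y x.
Proof. by move=> /funext ->. Qed.

Lemma has_mean_cst (x : R) : has_mean (fun=> x) x.
Proof.
split; first exact: finite_measure_integrable_cst.
by rewrite integral_cst //= probability_setT mule1.
Qed.

Lemma has_meanD (X Y : T -> R) x y :
  has_mean X x -> has_mean Y y -> has_mean (fun w => X w + Y w) (x + y).
Proof. exact: has_integralD. Qed.

Lemma has_meanZ (c : R) (X : T -> R) x :
  has_mean X x -> has_mean (fun w => c * X w) (c * x).
Proof. exact: has_integralZ. Qed.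

Lemma has_meanB (X Y : T -> R) x y :
  has_mean X x -> has_mean Y y -> has_mean (fun w => X w - Y w) (x - y).
Proof. exact: has_integralB. Qed.

Lemma has_mean_sum (I : Type) (r : seq I) (X : I -> T -> R) (x : I -> R) :
  (forall i, has_mean (X i) (x i)) ->
  has_mean (fun w => \sum_(i <- r) X i w) (\sum_(i <- r) x i).
Proof. exact: has_integral_sum. Qed.

(* The first two and the fourth order moments behave as those of independent
   centred variables with variances [v] and bounded kurtosis. *)
Definition fourth_moments (I : finType) (Z : I -> T -> R) (v : I -> R) (K : R) :=
  [/\ (forall i, 0 <= v i),
      (forall i j, has_mean (fun w => Z i w * Z j w) ((i == j)%:R * v i)) &
      exists m : I -> I -> I -> I -> R,
        (forall a b c e, has_mean (fun w => Z a w * Z b w * (Z c w * Z e w)) (m a b c e)) /\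
        (forall a b c e, `|m a b c e - (a == b)%:R * v a * ((c == e)%:R * v c)| <=
          K * v a * v b * ((c == a)%:R * (e == b)%:R + (c == b)%:R * (e == a)%:R))].

(** The centred form is the sum over (a, b) of M a b (Z a Z b - E[Z a Z b]). Squaring gives
    fourth-order covariances, which by assumption are carried by the two pairings of (a, b) with (c,
    e); what remains is the squared Frobenius norm of the Gram matrix. *)
Lemma quadratic_variance (I : finType) (Z : I -> T -> R) (v : I -> R) (K : R)
    (r : seq nat) (B : nat -> I -> R) : 0 <= K -> fourth_moments Z v K ->
  exists2 V, has_mean (fun w => (\sum_(i <- r) (\sum_a B i a * Z a w) ^+ 2 -
      \sum_(i <- r) \sum_a B i a * B i a * v a) ^+ 2) V &
    V <= 2 * K * \sum_(i <- r) \sum_(j <- r) (\sum_a B i a * B j a * v a) ^+ 2.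
Proof.
move=> K0 [v0 m2 [m [m4 mB]]].
pose M a b := \sum_(i <- r) B i a * B i b.
have Msym a b : M a b = M b a by apply: eq_bigr => i _; rewrite mulrC.
have E1 w : \sum_(i <- r) (\sum_a B i a * Z a w) ^+ 2 - \sum_(i <- r) \sum_a B i a * B i a * v a =
    \sum_a \sum_b M a b * (Z a w * Z b w - (a == b)%:R * v a).
  under [X in X - _]eq_bigr => i _.
    rewrite expr2 mulr_suml; under eq_bigr do rewrite mulr_sumr.
    over.
  rewrite exchange_big /= [X in _ - X]exchange_big /= -sumrB; apply: eq_bigr => a _.
  rewrite exchange_big /=.
  transitivity (\sum_b M a b * (Z a w * Z b w) - M a a * v a).
    congr (_ - _); last by rewrite /M mulr_suml.
    apply: eq_bigr => b _; rewrite /M mulr_suml; apply: eq_bigr => i _; ring.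
  transitivity (\sum_b M a b * (Z a w * Z b w) - \sum_b M a b * ((a == b)%:R * v a)).
    congr (_ - _); rewrite (bigD1 a) //= eqxx mul1r big1 ?addr0 //.
    by move=> b /negPf ab; rewrite eq_sym ab mul0r mulr0.
  by rewrite -sumrB; apply: eq_bigr => b _; rewrite mulrBr.
pose D a b c e := m a b c e - (a == b)%:R * v a * ((c == e)%:R * v c).
have HD a b c e : has_mean (fun w => (Z a w * Z b w - (a == b)%:R * v a) *
   (Z c w * Z e w - (c == e)%:R * v c)) (D a b c e).
  have h := has_meanD (has_meanB (has_meanB (m4 a b c e)
     (has_meanZ ((a == b)%:R * v a) (m2 c e))) (has_meanZ ((c == e)%:R * v c) (m2 a b)))
     (has_mean_cst ((a == b)%:R * v a * ((c == e)%:R * v c))).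
  rewrite (_ : D a b c e = m a b c e - (a == b)%:R * v a * ((c == e)%:R * v c) -
     (c == e)%:R * v c * ((a == b)%:R * v a) + (a == b)%:R * v a * ((c == e)%:R * v c)).
    by apply: eq_has_mean h => w; ring.
  by rewrite /D; ring.
have H : has_mean (fun w => (\sum_a \sum_b M a b * (Z a w * Z b w - (a == b)%:R * v a)) ^+ 2)
   (\sum_a \sum_b \sum_c \sum_e M a b * M c e * D a b c e).
  apply: (eq_has_mean (X := fun w => \sum_a \sum_b \sum_c \sum_e M a b * M c e *
     ((Z a w * Z b w - (a == b)%:R * v a) * (Z c w * Z e w - (c == e)%:R * v c)))).
    move=> w; rewrite expr2 mulr_suml; apply: eq_bigr => a _.
    rewrite mulr_suml; apply: eq_bigr => b _; rewrite mulr_sumr; apply: eq_bigr => c _.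
    by rewrite mulr_sumr; apply: eq_bigr => e _; ring.
  do 4 apply: has_mean_sum => ?; exact: has_meanZ.
exists (\sum_a \sum_b \sum_c \sum_e M a b * M c e * D a b c e).
  by apply: eq_has_mean H => w; rewrite E1.
(* The Gram matrix indexed by [r] and the matrix [M] weighted by [v] have the same Frobenius norm;
   only the order of summation changes. *)
have S : \sum_(i <- r) \sum_(j <- r) (\sum_a B i a * B j a * v a) ^+ 2 =
   \sum_a \sum_b M a b ^+ 2 * (v a * v b).
  transitivity (\sum_(i <- r) \sum_(j <- r) \sum_a \sum_b
     (B i a * B i b) * (B j a * B j b) * (v a * v b)).
    apply: eq_bigr => i _; apply: eq_bigr => j _; rewrite expr2 mulr_suml.
    by apply: eq_bigr => a _; rewrite mulr_sumr; apply: eq_bigr => b _; ring.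
  under eq_bigr do rewrite exchange_big /=.
  rewrite exchange_big /=; apply: eq_bigr => a _.
  under eq_bigr do rewrite exchange_big /=.
  rewrite exchange_big /=; apply: eq_bigr => b _.
  rewrite expr2 -mulrA {1}/M mulr_suml; apply: eq_bigr => i _.
  by rewrite /M mulr_suml mulr_sumr; apply: eq_bigr => j _; ring.
rewrite S mulr_sumr; apply: ler_sum => a _; rewrite mulr_sumr; apply: ler_sum => b _.
apply: (@le_trans _ _ (\sum_c \sum_e `|M a b * M c e| * (K * v a * v b *
  ((c == a)%:R * (e == b)%:R + (c == b)%:R * (e == a)%:R)))).
  apply: ler_sum => c _; apply: ler_sum => e _.
  by apply: le_trans (ler_norm _) _; rewrite normrM ler_wpM2l // mB.
have pick (F : I -> I -> R) x y :
    \sum_c \sum_e F c e * ((c == x)%:R * (e == y)%:R) = F x y.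
  rewrite (bigD1 x) //= [X in _ + X]big1 ?addr0; last first.
    by move=> c /negPf cx; rewrite big1 // => e _; rewrite cx mul0r mulr0.
  rewrite (bigD1 y) //= [X in _ + X]big1 ?addr0; last first.
    by move=> e /negPf ey; rewrite ey !mulr0.
  by rewrite !eqxx !mulr1.
have := pick (fun c e => `|M a b * M c e| * (K * v a * v b)) a b.
have := pick (fun c e => `|M a b * M c e| * (K * v a * v b)) b a.
move=> h1 h2.
rewrite (_ : \sum_c _ = `|M a b * M a b| * (K * v a * v b) + `|M a b * M b a| * (K * v a * v b)).
  rewrite (Msym b a) -expr2 ger0_norm ?sqr_ge0 // le_eqVlt; apply/orP; left; apply/eqP; ring.
rewrite -h2 -h1 -big_split /=; apply: eq_bigr => c _; rewrite -big_split /=.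
by apply: eq_bigr => e _; ring.
Qed.

End means.

(** * Expectations of products of independent variables *)

Section independence_means.
Context {d : measure_display} {T : measurableType d} {R : realType}.
Variable P : probability T R.

(** Independence says that the law of (U, V) is the product of the laws; Fubini's theorem for x y
    then factors the mean. *)
Lemma independent_mean (U V : {mfun T >-> R}) (u v : R) :
  (forall A B, measurable A -> measurable B ->
     P (U @^-1` A `&` V @^-1` B) = (P (U @^-1` A) * P (V @^-1` B))%E) ->
  has_mean P U u -> has_mean P V v ->
  has_mean P (fun w => U w * V w) (u * v).
Proof.
move=> UV [iU eU] [iV eV].
pose X w := (U w, V w).
have mX : measurable_fun setT X by exact: measurable_fun_pair.
pose X' : {mfun T >-> (R * R)%type} := [the {mfun T >-> (R * R)%type} of mfun_Sub (mem_set mX)].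
have XE (A : set (R * R)) : measurable A ->
    (distribution P U \x distribution P V)%E A = distribution P X' A.
  by move=> mA; apply: product_measure_unique.
pose f := (fun z : R * R => (z.1 * z.2)%:E).
have mf : measurable_fun setT f.
  apply/measurable_EFinP; apply: measurable_funM.
    exact: measurable_fst.
  exact: measurable_snd.
have aU : (\int[distribution P U]_x `|x%:E| < +oo)%E.
  rewrite ge0_integral_distribution //; last exact: measurableT_comp.
  by have /integrableP[] := iU.
have aV : (\int[distribution P V]_x `|x%:E| < +oo)%E.
  rewrite ge0_integral_distribution //; last exact: measurableT_comp.
  by have /integrableP[] := iV.
have fi : (distribution P U \x distribution P V)%E.-integrable setT f.
  apply/integrable12ltyP => //.
  under eq_integral => x _.
    under eq_integral => y _ do rewrite /f /= normrM EFinM.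
    rewrite ge0_integralZl //; last exact: measurableT_comp.
    over.
  rewrite /= ge0_integralZr //.
  - have h : (0 <= \int[distribution P U]_x `|x%:E|)%E by exact: integral_ge0.
    by apply: lte_mul_pinfty => //; rewrite ge0_fin_numE.
  - exact: measurableT_comp.
  - exact: integral_ge0.
have e12 : (\int[distribution P U \x distribution P V]_z f z = (u * v)%:E)%E.
  rewrite -integral12_prod_meas1 // /fubini_F /f /=.
  under eq_integral => x _.
    under eq_integral => y _ do rewrite EFinM.
    rewrite integralZl //; last first.
      apply/integrableP; split => //; exact: measurable_EFinP.
    rewrite integral_distribution ?eV //; over.
  rewrite /= integralZr //.
    by rewrite integral_distribution ?eU.
  by apply/integrableP; split => //; exact: measurable_EFinP.
have fX : P.-integrable setT (f \o X').
  apply/integrableP; split; first exact: measurableT_comp.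
  rewrite -(@ge0_integral_distribution _ _ _ _ _ P X' (abse \o f)).
  - rewrite -(eq_measure_integral _ (fun A mA _ => XE A mA)).
    by case/integrableP: fi.
  - exact: measurableT_comp.
  - by move=> y /=.
split; first exact: fX.
rewrite -[LHS]/(\int[P]_w (f \o X') w)%E -integral_distribution //.
by rewrite -(eq_measure_integral _ (fun A mA _ => XE A mA)).
Qed.

(** For fixed [A], the finite measures E -> P(Z i in A, E) and E -> P(Z i in A) P(E) agree on the
    rectangles in the other variables. These are stable under intersection, so the measures agree on
    the generated sigma-algebra. *)
Lemma sigma_independent_family (I : choiceType) (D : set I) (Z : I -> {mfun T >-> R})
    (i : I) (s : seq I) (A : set R) (E : set T) :
  mutually_independent P D (fun i => Z i : T -> R) ->
  uniq (i :: s) -> (forall j, j \in i :: s -> D j) -> measurable A ->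
  <<s [set E | exists B : I -> set R, (forall j, measurable (B j)) /\
      E = \big[setI/setT]_(j <- s) Z j @^-1` B j] >> E ->
  P (Z i @^-1` A `&` E) = (P (Z i @^-1` A) * P E)%E.
Proof.
move=> ind us sD mA.
set G := [set E | _] => GE.
have mpre j B : measurable B -> measurable (Z j @^-1` B).
  by move=> mB; rewrite -[X in measurable X]setTI; exact: measurable_funP.
have mG : G `<=` measurable.
  move=> _ [B [mB ->]]; elim/big_rec : _ => // j x _ mx.
  by apply: measurableI => //; exact: mpre.
have GI : setI_closed G.
  move=> _ _ [B [mB ->]] [C [mC ->]]; exists (fun j => B j `&` C j); split.
    by move=> j; exact: measurableI.
  by rewrite -big_split.
have GT : G setT.
  exists (fun=> setT); split => //.
  by rewrite big1.
pose m1 := mrestr P (mpre i A mA).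
have fA : P (Z i @^-1` A) \is a fin_num by apply: fin_num_measure; exact: (mpre i A mA).
pose c : {nonneg R} := NngNum (fine_ge0 (measure_ge0 P (Z i @^-1` A))).
pose m2 := mscale c P.
have m12 F : G F -> m1 F = m2 F.
  move=> [B [mB ->]]; rewrite /m1 /m2 /mrestr /mscale /= fineK //.
  pose B' j := if j == i then A else B j.
  have mB' j : measurable (B' j) by rewrite /B'; case: ifP.
  have := ind (i :: s) B' us sD mB'; rewrite !big_cons {1 3}/B' eqxx.
  have e : {in s, forall j, B' j = B j}.
    move=> j js; rewrite /B'; case: eqVneq => // ji.
    by move: us => /=; rewrite -ji js.
  have -> : \big[setI/setT]_(j <- s) Z j @^-1` B' j = \big[setI/setT]_(j <- s) Z j @^-1` B j.
    by apply: eq_big_seq => j js; rewrite e.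
  have -> : (\prod_(j <- s) P (Z j @^-1` B' j) = \prod_(j <- s) P (Z j @^-1` B j))%E.
    by apply: eq_big_seq => j js; rewrite e.
  rewrite setIC => ->; congr (_ * _)%E.
  have us' : uniq s by move: us => /= /andP[].
  by rewrite (ind s B us') // => j js; apply: sD; rewrite inE js orbT.
have := @g_sigma_algebra_measure_unique _ R T G mG (fun=> setT) (fun=> GT) _ m1 m2 GI m12 _ E GE.
have h1 : \bigcup_(_ : nat) [set: T] = setT by rewrite bigcup_const //; exists 0%N.
have h2 : forall k : nat, (m1 setT < +oo)%E.
  by move=> _; rewrite /m1 /mrestr setTI -ge0_fin_numE.
move=> /(_ h1 h2) H; rewrite setIC; apply: (etrans H).
by transitivity ((fine (P (Z i @^-1` A)))%:E * P E)%E => //; rewrite fineK.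
Qed.

(** Induction on [s]: the product over the tail is measurable for the sigma-algebra generated by the
    other variables, hence independent of the head. *)
Lemma mean_prod_independent (I : choiceType) (D : set I) (Z : I -> {mfun T >-> R})
    (g : I -> {mfun R >-> R}) (x : I -> R) (s : seq I) :
  mutually_independent P D (fun i => Z i : T -> R) ->
  uniq s -> (forall j, j \in s -> D j) ->
  (forall i, i \in s -> has_mean P (fun w => g i (Z i w)) (x i)) ->
  has_mean P (fun w => \prod_(i <- s) g i (Z i w)) (\prod_(i <- s) x i).
Proof.
move=> ind; elim: s => [|i s IH] us sD hm.
  rewrite big_nil; apply: eq_has_mean (has_mean_cst P 1) => w.
  by rewrite big_nil.
have us' : uniq s by move: us => /= /andP[].
have {}IH := IH us' (fun j js => sD j (mem_behead (s := i :: s) js))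
  (fun j js => hm j (mem_behead (s := i :: s) js)).
rewrite big_cons.
have mpre j B : measurable B -> measurable (Z j @^-1` B).
  by move=> mB; rewrite -[X in measurable X]setTI; exact: measurable_funP.
pose G := [set E | exists B : I -> set R, (forall j, measurable (B j)) /\
      E = \big[setI/setT]_(j <- s) Z j @^-1` B j].
have mG : G `<=` measurable.
  move=> _ [B [mB ->]]; elim/big_rec : _ => // j y _ my.
  by apply: measurableI => //; exact: mpre.
have mV : measurable_fun (setT : set (g_sigma_algebraType G))
    (fun w => \prod_(j <- s) g j (Z j w)).
  apply: measurable_prod => j js; apply: measurableT_comp => //.
  move=> _ B mB; rewrite setTI; apply: sub_sigma_algebra.
  exists (fun k => if k == j then B else setT); split.
    by move=> k; case: ifP.
  rewrite (bigD1_seq j) //= eqxx big1 ?setIT // => k /negPf ->.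
  by rewrite preimage_setT.
have mV' : measurable_fun setT (fun w => \prod_(j <- s) g j (Z j w)).
  by apply: measurable_prod => j js; apply: measurableT_comp.
have mU' : measurable_fun setT (fun w => g i (Z i w)) by apply: measurableT_comp.
pose U : {mfun T >-> R} := mfun_Sub (mem_set mU').
pose V : {mfun T >-> R} := mfun_Sub (mem_set mV').
apply: (eq_has_mean (X := fun w => U w * V w)).
  by move=> w; rewrite big_cons.
apply: independent_mean => //; last by apply: hm; rewrite mem_head.
move=> A B mA mB.
rewrite -[U @^-1` A]/(Z i @^-1` (g i @^-1` A)).
apply: (sigma_independent_family ind us sD).
  by rewrite -[X in measurable X]setTI; exact: measurable_funP.
by have := mV measurableT B mB; rewrite setTI.
Qed.

End independence_means.

(** * Mixed fourth moments of independent centred variables *)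

Section fourth_moments_of_independent.
Context {d : measure_display} {T : measurableType d} {R : realType}.
Variable P : probability T R.

Lemma prod_count (I : finType) (x : I -> R) (l : seq I) :
  \prod_(a <- l) x a = \prod_i x i ^+ count_mem i l.
Proof.
elim: l => [|a l IH]; first by rewrite big_nil big1.
rewrite big_cons IH /=; under [RHS]eq_bigr do rewrite exprD.
rewrite big_split /=; congr (_ * _).
rewrite (bigD1 a) //= eqxx expr1 big1 ?mulr1 //.
by move=> i /negPf ia; rewrite eq_sym ia.
Qed.

Variables (I : finType) (Z : I -> {mfun T >-> R}) (v : I -> R) (kappa : R).
Hypothesis indZ : mutually_independent P setT (fun i => Z i : T -> R).
Hypothesis v0 : forall i, 0 <= v i.
Hypothesis Z1 : forall i, has_mean P (Z i) 0.
Hypothesis Z2 : forall i, has_mean P (fun w => Z i w ^+ 2) (v i).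
Hypothesis Z4 : forall i, exists2 m, has_mean P (fun w => Z i w ^+ 4) m &
  m <= kappa * v i ^+ 2.
Hypothesis kappa0 : 0 <= kappa.

Let mom i e : R := fine (\int[P]_w (Z i w ^+ e)%:E).

Let mZe i e : measurable_fun setT (fun w => Z i w ^+ e).
Proof. exact: measurable_funX. Qed.

(** Lower powers are integrable because |z|^e <= 1 + z^4. *)
Let mom_mean i e : (e <= 4)%N -> has_mean P (fun w => Z i w ^+ e) (mom i e).
Proof.
move=> e4; have [m [i4 _] _] := Z4 i.
have ie : P.-integrable setT (EFin \o (fun w => Z i w ^+ e)).
  apply: (@le_integrable _ _ _ _ _ measurableT _ (EFin \o (fun w => 1 + Z i w ^+ 4))).
  - by apply/measurable_EFinP; exact: mZe.
  - move=> w _ /=; rewrite lee_fin normrX.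
    have z0 : 0 <= `|Z i w| by [].
    have -> : Z i w ^+ 4 = `|Z i w| ^+ 4.
      by rewrite -[4%N]/(2 * 2)%N !exprM real_normK ?num_real.
    set z := `|Z i w| in z0 *; rewrite ger0_norm; last by rewrite addr_ge0 ?exprn_ge0.
    have [z1|z1] := leP z 1.
      by apply: (@le_trans _ _ 1); [exact: exprn_ile1|rewrite lerDl exprn_ge0].
    by apply: (@le_trans _ _ (z ^+ 4)); [apply: ler_weXn2l => //; exact: ltW|rewrite lerDr].
  - have [//] : has_mean P (fun w => 1 + Z i w ^+ 4) (1 + fine (\int[P]_w (Z i w ^+ 4)%:E)).
    apply: has_meanD; first exact: has_mean_cst.
    by split => //; rewrite fineK //; exact: integrable_fin_num.
by split => //; rewrite fineK //; exact: integrable_fin_num.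
Qed.

Let mom0 i : mom i 0 = 1.
Proof.
rewrite /mom; under eq_integral do rewrite expr0.
by rewrite integral_cst //= probability_setT mule1.
Qed.

Let mom1 i : mom i 1 = 0.
Proof.
by rewrite /mom; under eq_integral do rewrite expr1; case: (Z1 i) => _ ->.
Qed.

Let mom2 i : mom i 2 = v i.
Proof. by rewrite /mom; case: (Z2 i) => _ ->. Qed.

Let mom4 i : 0 <= mom i 4 <= kappa * v i ^+ 2.
Proof.
have [m [_ e] h] := Z4 i; rewrite /mom e h andbT -lee_fin -e.
apply: integral_ge0 => w _; rewrite lee_fin -[4%N]/(2 * 2)%N exprM; exact: sqr_ge0.
Qed.

Let mean_list (l : seq I) : (size l <= 4)%N ->
  has_mean P (fun w => \prod_(a <- l) Z a w) (\prod_i mom i (count_mem i l)).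
Proof.
move=> l4.
apply: (eq_has_mean (X := fun w => \prod_i Z i w ^+ count_mem i l)).
  by move=> w; rewrite [RHS]prod_count.
have mg i : measurable_fun (setT : set R) (fun x : R => x ^+ count_mem i l).
  by apply: measurable_funX; exact: measurable_id.
pose g i : {mfun R >-> R} := mfun_Sub (mem_set (mg i)).
have := @mean_prod_independent _ _ _ P I setT Z g
  (fun i => mom i (count_mem i l)) (index_enum I) indZ (index_enum_uniq I).
apply => // i _.
by apply: mom_mean; apply: leq_trans (count_size _ _) l4.
Qed.

Let m4 a b c e := \prod_i mom i (count_mem i [:: a; b; c; e]).

Let m4_zero a b c e i : count_mem i [:: a; b; c; e] = 1%N -> m4 a b c e = 0.
Proof. by move=> h; rewrite /m4 (bigD1 i) // h mom1 /= mul0r. Qed.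

Let m4_pair a b c e : a != b ->
  (forall i, count_mem i [:: a; b; c; e] = (2 * (a == i) + 2 * (b == i))%N) ->
  m4 a b c e = v a * v b.
Proof.
have ma i : mom i (2 * true + 2 * false) = v i := mom2 i.
have mb i : mom i (2 * false + 2 * true) = v i := mom2 i.
have m0 i : mom i (2 * false + 2 * false) = 1 := mom0 i.
move=> ab H; rewrite /m4; under eq_bigr => i _ do rewrite H.
have ba : b != a by rewrite eq_sym.
rewrite (bigD1 a) //= (bigD1 b) //= !eqxx (negPf ab) (negPf ba).
rewrite ma mb big1 ?mulr1 // => i /andP[ia ib].
by rewrite [a == i]eq_sym (negPf ia) [b == i]eq_sym (negPf ib) m0.
Qed.

(** A mixed moment vanishes as soon as one index occurs exactly once. What is left are the pairings:
    a = b with c = e gives the product of variances, the two others are allowed on the right-hand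
    side, and [kappa] enters when all four indices coincide. *)
Lemma fourth_moments_independent :
  fourth_moments P (fun i => Z i : T -> R) v (kappa + 1).
Proof.
split => //.
  move=> i j; have h := mean_list (l := [:: i; j]) isT.
  have {}h : has_mean P (fun w => Z i w * Z j w) (\prod_k mom k (count_mem k [:: i; j])).
    by apply: eq_has_mean h => w; rewrite big_cons big_seq1.
  rewrite (_ : _ * v i = \prod_k mom k (count_mem k [:: i; j])) //.
  rewrite (bigD1 i) //=; have [<-|ij] := eqVneq i j.
    rewrite eqxx mom2 mul1r big1 ?mulr1 // => k /negPf ki.
    by rewrite eq_sym ki mom0.
  by rewrite eqxx mom1 !mul0r.
exists m4; split=> [a b c e|a b c e].
  apply: eq_has_mean (mean_list (l := [:: a; b; c; e]) isT) => w.
  by rewrite !big_cons big_nil mulr1 !mulrA.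
have va := v0 a; have vb := v0 b; have vab := mulr_ge0 va vb.
have K1 : 0 <= kappa + 1 by rewrite addr_ge0.
have [[-> ->]|n1] := pselect (c = a /\ e = b).
  rewrite !eqxx /= mul1r; have [<-|ab] := eqVneq a b.
    rewrite !mul1r (_ : m4 a a a a = mom a 4).
      have /andP[h1 h2] := mom4 a.
      apply: le_trans (ler_normB _ _) _; rewrite !ger0_norm ?mulr_ge0 //.
      rewrite (_ : true%:R = 1) //; rewrite expr2 in h2.
      by have v2 := mulr_ge0 va va; have := mulr_ge0 kappa0 v2; lra.
    rewrite /m4 (bigD1 a) //= !eqxx big1 ?mulr1 // => i /negPf ia.
    by rewrite eq_sym ia mom0.
  rewrite !mul0r subr0 addr0 mulr1 m4_pair //=.
    by rewrite ger0_norm // -mulrA ler_peMl // lerDr.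
  by move=> i; lia.
have [[cb ea]|n2] := pselect (c = b /\ e = a).
  subst c e; have ab : a != b by apply/eqP => ab; apply: n1; rewrite ab.
  rewrite !eqxx (negPf ab) eq_sym (negPf ab) !mul0r subr0 add0r !mulr1.
  rewrite m4_pair //=.
    by rewrite ger0_norm // -mulrA ler_peMl // lerDr.
  by move=> i; lia.
have R0 : 0 <= (kappa + 1) * v a * v b *
    ((c == a)%:R * (e == b)%:R + (c == b)%:R * (e == a)%:R).
  by rewrite mulr_ge0 ?addr_ge0 ?mulr_ge0.
suff -> : m4 a b c e = (a == b)%:R * v a * ((c == e)%:R * v c) by rewrite subrr normr0.
have E x y : (x == y :> I) = false -> (y == x) = false by rewrite eq_sym.
have [ab|ab] := eqVneq a b; rewrite ?mul1r ?mul0r.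
  have [ce|ce] := eqVneq c e; rewrite ?mul1r ?mul0r ?mulr0.
    subst b e; have ac : a != c by apply/eqP => ac; apply: n1.
    have ca : c != a by rewrite eq_sym.
    rewrite /m4 (bigD1 a) //= (bigD1 c) //= !eqxx (negPf ac) (negPf ca) /=.
    rewrite !mom2 big1 ?mulr1 // => i /andP[ia ic].
    by rewrite eq_sym (negPf ia) eq_sym (negPf ic) mom0.
  subst b; have [ca|ca] := eqVneq c a.
    subst c; apply: (m4_zero (i := e)) => /=.
    by rewrite (negPf ce) eqxx.
  apply: (m4_zero (i := c)) => /=.
  by rewrite eq_sym (negPf ca) eqxx eq_sym (negPf ce).
have [ca|ca] := eqVneq c a.
  apply: (m4_zero (i := b)) => /=; rewrite ca (negPf ab) eqxx.
  by case: eqVneq => // eb; case: n1.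
have [ea|ea] := eqVneq e a.
  apply: (m4_zero (i := b)) => /=; rewrite ea (negPf ab) eqxx.
  by case: eqVneq => // cb; case: n2.
by apply: (m4_zero (i := a)) => /=; rewrite eqxx (negPf ca) (negPf ea) eq_sym (negPf ab).
Qed.

End fourth_moments_of_independent.

(** * Moments of the centred normal law *)

Section normal_moments.
Context {R : realType}.
Variable s : R.
Hypothesis s0 : 0 < s.
Local Notation mu := (@lebesgue_measure R).

Let s1 : s != 0. Proof. by rewrite gt_eqF. Qed.

Let phi (x : R) : R := normal_peak s * expR (- x ^+ 2 / (2 * s ^+ 2)).

Let phiE : normal_pdf 0 s = phi.
Proof.
rewrite normal_pdfE //; apply/funext => x.
by rewrite /normal_fun subr0 /phi mulr_natl.
Qed.

Let phi_ge0 x : 0 <= phi x. Proof. by rewrite -phiE normal_pdf_ge0. Qed.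
Let phi_cont : continuous phi.
Proof. by rewrite -phiE; exact: continuous_normal_pdf. Qed.
Let phi_meas : measurable_fun setT phi.
Proof. exact: continuous_measurable_fun. Qed.

Let phi_int : (\int[mu]_x (phi x)%:E = 1)%E.
Proof. by rewrite -phiE; exact: integral_normal_pdf. Qed.

(** [normal_prob] has density [normal_pdf], which agrees almost everywhere with the Radon-Nikodym
    derivative since both have the same integrals. *)
Lemma normal_prob_integral (f : R -> \bar R) :
  measurable_fun setT f -> (forall x, 0 <= f x)%E ->
  (\int[normal_prob 0%R s]_x f x = \int[mu]_x (f x * (normal_pdf 0 s x)%:E))%E.
Proof.
move=> mf f0.
have dom : normal_prob 0 s `<< mu by exact: normal_prob_dominates.
rewrite -(Radon_Nikodym_SigmaFinite.change_of_variables dom f0) //.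
apply: ae_eq_integral => //.
- apply: emeasurable_funM => //; apply: (measurable_int mu).
  exact: Radon_Nikodym_SigmaFinite.f_integrable.
- apply: emeasurable_funM => //; apply/measurable_EFinP; exact: measurable_normal_pdf.
- apply: ae_eqe_mul2l; apply: integral_ae_eq => //.
  + exact: Radon_Nikodym_SigmaFinite.f_integrable.
  + by apply/measurable_EFinP; exact: measurable_normal_pdf.
  + by move=> E _ mE; rewrite -Radon_Nikodym_SigmaFinite.f_integral.
Qed.

Let F (x : R) : R := - (x * phi x).

(** F = - x phi is the primitive behind the second moment: the integral of F' over the half-line is
    0, so x^2 / s^2 and 1 have the same integral against phi. *)
Let F_derive (x : R) : is_derive x (1 : R) F ((x ^+ 2 / s ^+ 2 - 1) * phi x).
Proof.
pose c := - (2 * s ^+ 2)^-1.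
have h : is_derive x (1 : R) (c \*: (@id R ^+ 2)) (- x / s ^+ 2).
  apply: is_derive_eq; rewrite /GRing.scale /= expr1 mulr1 -mulr_natl /c.
  by field.
have e : (fun y : R => - y ^+ 2 / (2 * s ^+ 2)) = c \*: (@id R ^+ 2).
  by apply/funext => y; rewrite /c /= /GRing.scale /= mulNr mulNr mulrC.
have hE : is_derive x (1 : R) (expR \o (c \*: (@id R ^+ 2))) (expR (- x ^+ 2 / (2 * s ^+ 2)) * (- x / s ^+ 2)).
  have := is_derive1_comp (is_derive_expR _) h.
  by rewrite -[(c \*: @id R ^+ 2) x](congr1 (fun f => f x) e).
have eF : F = - (@id R * (normal_peak s \*: (expR \o (c \*: (@id R ^+ 2))))).
  by apply/funext => y; rewrite /F /phi -e.
move: (c \*: @id R ^+ 2) e h hE eF => g e h hE eF.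
rewrite eF; apply: is_derive_eq; rewrite /GRing.scale /=.
rewrite -(congr1 (fun f => f x) e).
by rewrite -[_ *: expR _]/(_ * expR _) /phi; field.
Qed.

Let f (x : R) : R := (x ^+ 2 / s ^+ 2 - 1) * phi x.

Let f_cont : continuous f.
Proof.
move=> x; apply: cvgM; last exact: phi_cont.
apply: cvgB; last exact: cvg_cst.
by apply: cvgM; [exact: exprn_continuous|exact: cvg_cst].
Qed.

Let F_cont : continuous F.
Proof. by move=> x; apply: cvgN; apply: cvgM; [exact: cvg_id|exact: phi_cont]. Qed.

Let F_cvg : F x @[x --> +oo] --> (0 : R).
Proof.
pose C := normal_peak s * (2 * s ^+ 2).
have C0 : 0 < C by rewrite mulr_gt0 ?normal_peak_gt0 // mulr_gt0 // exprn_gt0.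
apply/cvgrPdist_le => e e0; near=> x.
have x0 : 0 < x by near: x; apply: nbhs_pinfty_gt; exact: num_real.
have xe : C / e <= x by near: x; apply: nbhs_pinfty_ge; exact: num_real.
rewrite sub0r normrN /F normrN ger0_norm; last by rewrite mulr_ge0 // ltW.
pose y := x ^+ 2 / (2 * s ^+ 2).
have y0 : 0 < y by rewrite divr_gt0 ?mulr_gt0 ?exprn_gt0.
have : expR (- y) <= y^-1.
  rewrite expRN lef_pV2 ?posrE ?expR_gt0 //.
  by apply: le_trans (expR_ge1Dx _); rewrite lerDr.
move=> h; apply: (@le_trans _ _ (x * (normal_peak s * y^-1))).
  rewrite ler_pM2l // /phi ler_pM2l ?normal_peak_gt0 //.
  by rewrite mulNr.
have -> : x * (normal_peak s * y^-1) = C / x.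
  by rewrite /y /C; field; rewrite s1 gt_eqF.
by rewrite ler_pdivrMr // mulrC -ler_pdivrMr.
Unshelve. all: by end_near. Qed.

(** The half-line is cut at [s], where the integrand changes sign; the parts on both sides have the
    same absolute value s phi(s). *)
Let tail_int : (\int[mu]_(x in `[s, +oo[) (f x)%:E = (s * phi s)%:E)%E.
Proof.
rewrite (@ge0_continuous_FTC2y R f F s 0).
- by rewrite sub0e -EFinN /F opprK.
- move=> x sx; rewrite mulr_ge0 // subr_ge0 ler_pdivlMr ?exprn_gt0 // mul1r.
  by rewrite lerXn2r ?nnegrE // ltW // (lt_le_trans s0).
- exact: continuous_subspaceT.
- exact: F_cvg.
- by move=> x _; have [] := F_derive x.
- exact/cvg_at_right_filter/F_cont.
- by move=> x _; rewrite derive1E; have [_ ->] := F_derive x.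
Qed.

Let head_int : (\int[mu]_(x in `[0%R, s]) (- f x)%:E = (s * phi s)%:E)%E.
Proof.
rewrite (@continuous_FTC2 R (fun x => - f x) (fun x => - F x) 0 s) //.
- by rewrite /F /= !opprK mul0r sube0.
- by apply: continuous_subspaceT => x; apply: cvgN; exact: f_cont.
- split.
  + move=> x _; have [h _] := F_derive x; exact: derivableN.
  + by apply: cvg_at_right_filter; apply: cvgN; exact: F_cont.
  + by apply: cvg_at_left_filter; apply: cvgN; exact: F_cont.
- move=> x _; rewrite derive1E deriveN; last by have [] := F_derive x.
  by have [_ ->] := F_derive x.
Qed.

Let split_half (g : R -> R) : measurable_fun setT g -> (forall x, 0 <= g x) ->
  (\int[mu]_(x in `[0%R, +oo[) (g x)%:E =
   \int[mu]_(x in `[0%R, s]) (g x)%:E + \int[mu]_(x in `[s, +oo[) (g x)%:E)%E.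
Proof.
move=> mg g0; have mg' : measurable_fun setT (EFin \o g) by exact/measurable_EFinP.
rewrite -(@integral_itv_obnd_cbnd _ s) //; last exact: measurable_funTS.
rewrite -ge0_integral_setU //=.
- congr (integral _ _ _); apply/seteqP; split=> x /=; rewrite !in_itv /= !andbT.
    by move=> x0; have [xs|xs] := leP x s; [left; rewrite x0|right].
  by case=> [/andP[]//|h]; rewrite ltW // (lt_trans s0).
- exact: measurable_funTS.
- by move=> x _; rewrite lee_fin.
- apply/eqP/seteqP; split=> x //= []; rewrite !in_itv /= andbT => /andP[_ h1] h2.
  by move: (lt_le_trans h2 h1); rewrite ltxx.
Qed.

Let g2 (x : R) : R := x ^+ 2 / s ^+ 2 * phi x.
Let g2_ge0 x : 0 <= g2 x.
Proof. by rewrite mulr_ge0 // divr_ge0 ?sqr_ge0. Qed.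
Let g2_cont : continuous g2.
Proof.
move=> x; apply: cvgM; last exact: phi_cont.
by apply: cvgM; [exact: exprn_continuous|exact: cvg_cst].
Qed.
Let g2_meas : measurable_fun setT g2.
Proof. exact: continuous_measurable_fun. Qed.

Let half_moment : (\int[mu]_(x in `[0%R, +oo[) (g2 x)%:E = \int[mu]_(x in `[0%R, +oo[) (phi x)%:E)%E.
Proof.
rewrite !split_half //.
have -> : (\int[mu]_(x in `[0%R, s]) (phi x)%:E =
    \int[mu]_(x in `[0%R, s]) (g2 x)%:E + (s * phi s)%:E)%E.
  rewrite -head_int -ge0_integralD //=.
  - by apply: eq_integral => x _; rewrite -EFinD /f /g2; congr EFin; ring.
  - by move=> x _; rewrite lee_fin.
  - exact/measurable_EFinP/measurable_funTS.
  - move=> x; rewrite in_itv /= => /andP[x0 xs]; rewrite lee_fin -mulNr.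
    rewrite mulr_ge0 // opprB subr_ge0 ler_pdivrMr ?exprn_gt0 // mul1r.
    by rewrite lerXn2r ?nnegrE // ltW.
  - apply/measurable_EFinP/measurable_funTS; apply: measurableT_comp => //.
    exact: continuous_measurable_fun.
have -> : (\int[mu]_(x in `[s, +oo[) (g2 x)%:E =
    (s * phi s)%:E + \int[mu]_(x in `[s, +oo[) (phi x)%:E)%E.
  rewrite -tail_int -ge0_integralD //=.
  - by apply: eq_integral => x _; rewrite -EFinD /f /g2; congr EFin; ring.
  - move=> x; rewrite in_itv /= andbT => sx; rewrite lee_fin.
    rewrite mulr_ge0 // subr_ge0 ler_pdivlMr ?exprn_gt0 // mul1r.
    by rewrite lerXn2r ?nnegrE // ltW // (lt_le_trans s0).
  - apply/measurable_EFinP/measurable_funTS; exact: continuous_measurable_fun.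
  - by move=> x _; rewrite lee_fin.
  - exact/measurable_EFinP/measurable_funTS.
by rewrite addeA.
Qed.

Let phi_even : phi =1 phi \o -%R.
Proof. by move=> x; rewrite /phi /= sqrrN. Qed.

Lemma normal_second_moment :
  (\int[normal_prob 0%R s]_x (x ^+ 2)%:E = (s ^+ 2)%:E)%E.
Proof.
rewrite normal_prob_integral; first last.
- by move=> x; rewrite lee_fin sqr_ge0.
- apply/measurable_EFinP; exact: exprn_measurable.
rewrite phiE.
transitivity ((s ^+ 2)%:E * \int[mu]_x (g2 x)%:E)%E.
  rewrite -ge0_integralZl //.
  - apply: eq_integral => x _; rewrite -!EFinM /g2; congr EFin; field.
    by rewrite s1.
  - exact/measurable_EFinP.
  - by move=> x _; rewrite lee_fin.
  - by rewrite lee_fin sqr_ge0.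
suff -> : (\int[mu]_x (g2 x)%:E = 1)%E by rewrite mule1.
rewrite ge0_symfun_integralT //; last by move=> x; rewrite /g2 [phi x]phi_even /= sqrrN.
rewrite -set_itvcy half_moment set_itvcy -ge0_symfun_integralT //.
Qed.

(** Completing the square turns the integrand into exp(1 / 2) times the normal density of mean e
    s. *)
Let exp_moment (e : R) : e ^+ 2 = 1 ->
  (\int[mu]_x (expR (e * x / s) * phi x)%:E = (expR (1 / 2))%:E)%E.
Proof.
move=> e1; transitivity ((expR (1 / 2))%:E * \int[mu]_x (normal_pdf (e * s) s x)%:E)%E.
  rewrite -ge0_integralZl //.
  - apply: eq_integral => x _; rewrite normal_pdfE // /normal_fun -EFinM.
    congr EFin; rewrite /phi mulrCA [RHS]mulrCA; congr (_ * _); rewrite -!expRD.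
    congr expR; rewrite -mulr_natl.
    have -> : - (x - e * s) ^+ 2 = - x ^+ 2 + 2 * (e * s) * x - e ^+ 2 * s ^+ 2 by ring.
    by rewrite e1; field.
  - by apply/measurable_EFinP; exact: measurable_normal_pdf.
  - by move=> x _; rewrite lee_fin normal_pdf_ge0.
by rewrite integral_normal_pdf mule1.
Qed.

(** An upper bound is enough: y^4 <= 4^4 (exp y + exp (- y)) at y = x / s, together with the
    exponential moments. *)
Lemma normal_fourth_moment :
  (\int[normal_prob 0%R s]_x (x ^+ 4)%:E <= (2 * 4 ^+ 4 * expR (1 / 2) * (s ^+ 2) ^+ 2)%:E)%E.
Proof.
have four0 (x : R) : 0 <= x ^+ 4 by rewrite -[4%N]/(2 * 2)%N exprM sqr_ge0.
rewrite normal_prob_integral; first last.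
- by move=> x; rewrite lee_fin.
- by apply/measurable_EFinP; exact: exprn_measurable.
rewrite phiE.
pose h e (x : R) := expR (e * x / s) * phi x.
have h0 e x : 0 <= h e x by rewrite mulr_ge0 // expR_ge0.
have mh e : measurable_fun setT (h e).
  apply: measurable_funM => //; apply: measurableT_comp => //.
  by apply: measurable_funM => //; apply: measurable_funM.
have key (y : R) : y ^+ 4 <= 4 ^+ 4 * (expR y + expR (- y)).
  have pos (z : R) : 0 <= z -> z ^+ 4 <= 4 ^+ 4 * expR z.
    move=> z0; have := expR_ge1Dx (z / 4) => hz.
    have -> : expR z = expR (z / 4) ^+ 4.
      by rewrite -expRM_natl; congr expR; field.
    have -> : z ^+ 4 = 4 ^+ 4 * (z / 4) ^+ 4 by field.
    rewrite ler_pM2l ?exprn_gt0 // lerXn2r ?nnegrE ?expR_ge0 //; lra.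
  have [y0|/ltW y0] := leP 0 y.
    by apply: le_trans (pos y y0) _; rewrite ler_pM2l ?exprn_gt0 // lerDl expR_ge0.
  rewrite -oppr_ge0 in y0.
  have -> : y ^+ 4 = (- y) ^+ 4 by rewrite -[4%N]/(2 * 2)%N !exprM sqrrN.
  by apply: le_trans (pos _ y0) _; rewrite ler_pM2l ?exprn_gt0 // lerDr expR_ge0.
apply: (@le_trans _ _ (\int[mu]_x ((4 ^+ 4 * s ^+ 4)%:E * ((h 1 x)%:E + (h (-1) x)%:E)))%E).
  apply: ge0_le_integral => //.
  - by move=> x _; rewrite mule_ge0 // lee_fin.
  - apply: emeasurable_funM; apply/measurable_EFinP; [exact: exprn_measurable|exact: phi_meas].
  - apply: emeasurable_funM => //; apply: emeasurable_funD; apply/measurable_EFinP; exact: mh.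
  - move=> x _; rewrite -EFinM -EFinD -EFinM lee_fin /h !mul1r mulN1r mulNr -mulrDl mulrA.
    apply: ler_wpM2r => //; have := key (x / s); rewrite expr_div_n => hk.
    by rewrite -mulrA mulrCA mulrC -ler_pdivrMr ?exprn_gt0.
rewrite ge0_integralZl //; first last.
- by rewrite lee_fin mulr_ge0 ?exprn_ge0 // ltW.
- by move=> x _; rewrite -EFinD lee_fin addr_ge0.
- by apply: emeasurable_funD; apply/measurable_EFinP; exact: mh.
rewrite ge0_integralD //; first last.
- apply/measurable_EFinP; exact: mh.
- by move=> x _; rewrite lee_fin.
- apply/measurable_EFinP; exact: mh.
- by move=> x _; rewrite lee_fin.
rewrite !exp_moment ?sqrrN ?expr1n // -EFinD -EFinM lee_fin.
by rewrite le_eqVlt; apply/orP; left; apply/eqP; ring.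
Qed.

(** The vanishing of the mean, stated with nonnegative integrands: |x| + x is 2 |x| on the positive
    half-line and 0 on the negative one, and the density is even. *)
Lemma normal_first_moment :
  (\int[normal_prob 0%R s]_x (`|x| + x)%:E = \int[normal_prob 0%R s]_x `|x|%:E)%E.
Proof.
have a0 (x : R) : 0 <= `|x| + x by rewrite -lerBlDr sub0r -normrN ler_norm.
have mabs : measurable_fun setT (fun x : R => `|x|) by exact: measurableT_comp.
have nc : continuous (fun x : R => `|x|) by exact: (@norm_continuous R R^o).
have m1 : measurable_fun setT (fun x : R => (`|x| + x)%:E).
  by apply/measurable_EFinP; exact: measurable_funD.
have m2 : measurable_fun setT (fun x : R => `|x|%:E) by exact/measurable_EFinP.
have p1 (x : R) : (0 <= (`|x| + x)%:E)%E by rewrite lee_fin.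
have p2 (x : R) : (0 <= `|x|%:E)%E by rewrite lee_fin.
rewrite (normal_prob_integral m1 p1) (normal_prob_integral m2 p2) phiE.
under [RHS]eq_integral do rewrite -EFinM.
rewrite [RHS]ge0_symfun_integralT; last 3 first.
- by move=> x; rewrite mulr_ge0.
- by move=> x; apply: cvgM; [exact: nc|exact: phi_cont].
- by move=> x; rewrite [phi x]phi_even /= normrN.
rewrite -ge0_integralZl //; first last.
- by move=> x _; rewrite lee_fin mulr_ge0.
- by apply/measurable_EFinP/measurable_funTS; exact: measurable_funM.
- by rewrite -set_itvcy.
rewrite [RHS]integral_mkcond; apply: eq_integral => x _.
rewrite patchE; case: ifPn => [|].
  rewrite inE /= => x0; rewrite ger0_norm // -!EFinM; congr EFin; ring.
rewrite notin_setE /= => /negP; rewrite -ltNge => x0.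
by rewrite ltr0_norm // addNr mul0e.
Qed.

End normal_moments.

(** * Moments of a normal random variable *)

Section normal_random_variables.
Context {d : measure_display} {T : measurableType d} {R : realType}.
Variable P : probability T R.

Lemma normal_mean (D : {RV P >-> R}) (s : R) : 0 < s ->
  (forall B, measurable B -> P (D @^-1` B) = normal_prob 0 s B) ->
  [/\ has_mean P D 0, has_mean P (fun w => D w ^+ 2) (s ^+ 2) &
    exists2 m, has_mean P (fun w => D w ^+ 4) m &
      m <= 2 * 4 ^+ 4 * expR (1 / 2) * (s ^+ 2) ^+ 2].
Proof.
move=> s0 hD.
have I (g : R -> R) : measurable_fun setT g -> (forall x, 0 <= g x) ->
    (\int[P]_w (g (D w))%:E = \int[normal_prob 0%R s]_x (g x)%:E)%E.
  move=> mg g0.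
  have mD : @measurable_fun _ _ T (measurableTypeR R) setT D.
    by move=> _ B mB; exact: measurable_funP.
  pose D' := @mfun_Sub _ _ T (measurableTypeR R) _ (mem_set mD).
  rewrite -[LHS](@ge0_integral_distribution _ _ _ (measurableTypeR R) _ P D' (EFin \o g)).
  - apply: (@eq_measure_integral _ (measurableTypeR R) _ setT (normal_prob 0%R s)).
    by move=> A mA _; exact: (hD A mA).
  - exact/measurable_EFinP.
  - by move=> x; rewrite lee_fin.
have mD : measurable_fun setT (D : T -> R) by [].
have mpow e : measurable_fun setT (fun x : R => x ^+ e) by exact: exprn_measurable.
have M (X : T -> R) (x : R) : measurable_fun setT X -> (forall w, 0 <= X w) ->
    (\int[P]_w (X w)%:E = x%:E)%E -> has_mean P X x.
  move=> mX X0 eX; split=> //; apply/integrableP; split; first exact/measurable_EFinP.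
  under eq_integral do rewrite /= ger0_norm //.
  by rewrite eX ltry.
have four0 (x : R) : 0 <= x ^+ 4 by rewrite -[4%N]/(2 * 2)%N exprM sqr_ge0.
have m2 : has_mean P (fun w => D w ^+ 2) (s ^+ 2).
  apply: M; first exact: measurable_funX.
    by move=> w; exact: sqr_ge0.
  by rewrite (I _ (mpow 2%N) (@sqr_ge0 R)) normal_second_moment.
have e4 : (\int[P]_w (D w ^+ 4)%:E = \int[normal_prob 0%R s]_x (x ^+ 4)%:E)%E.
  exact: (I _ (mpow 4%N) four0).
have b4 := normal_fourth_moment s0.
have f4 : (\int[normal_prob 0%R s]_x (x ^+ 4)%:E)%E \is a fin_num.
  rewrite ge0_fin_numE; first exact: le_lt_trans b4 (ltry _).
  by apply: integral_ge0 => x _; rewrite lee_fin.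
have iD : P.-integrable setT (EFin \o D).
  have [i2 _] := has_meanD (has_mean_cst P 1) m2.
  apply: le_integrable i2 => //; first exact/measurable_EFinP.
  move=> w _ /=; rewrite lee_fin (@ger0_norm _ (1 + _)); last by rewrite addr_ge0 ?sqr_ge0.
  have := sqr_ge0 (`|D w| - 1); have := normr_ge0 (D w).
  rewrite (_ : (`|D w| - 1) ^+ 2 = `|D w| ^+ 2 - 2 * `|D w| + 1); last by ring.
  by rewrite real_normK ?num_real //; lra.
split => //; last first.
  exists (fine (\int[normal_prob 0%R s]_x (x ^+ 4)%:E)); last by rewrite -lee_fin fineK.
  by apply: M; [exact: measurable_funX|by []|rewrite e4 fineK].
split=> //.
have iA := integrable_norm iD.
have mabs : measurable_fun setT (fun x : R => `|x|) by exact: measurableT_comp.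
have a0 (x : R) : 0 <= `|x| + x by rewrite -lerBlDr sub0r -normrN ler_norm.
have := I (fun x => `|x| + x) _ a0; rewrite normal_first_moment //.
move=> /(_ ltac:(exact: measurable_funD)).
rewrite -(I (fun x => `|x|)) //.
under [X in X = _ -> _]eq_integral do rewrite EFinD.
rewrite integralD //= => h.
have fA : (\int[P]_w `|D w|%:E)%E \is a fin_num by exact: integrable_fin_num iA.
have fD : (\int[P]_w (D w)%:E)%E \is a fin_num by exact: integrable_fin_num iD.
by move: h; rewrite -(fineK fA) -(fineK fD) -EFinD => -[] h; congr EFin; lra.
Qed.

End normal_random_variables.

(** * The estimators as weighted sums of squares *)

Section quadratic_forms.
Context {R : realType}.
Variables (n k : nat).

(** The i-th entry of the transposed sine matrix applied to the weighted increments. *)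
Definition spectral_stat (y : nat -> R) (i : nat) : R :=
  \sum_(1 <= j < n) sine_coef n i j * (grid_basis n k j * (y j.+1 - y j)).

Lemma quad_form_diag (g : nat -> R) (y : nat -> R) :
  quad_form (diag_mx (\row_(i < n.-1) g i.+1)) (increments n y k) =
  \sum_(1 <= i < n) g i * spectral_stat y i ^+ 2.
Proof.
have L i : ((sine_mx n)^T *m increments n y k) i 0 = spectral_stat y i.+1 :> R.
  rewrite mxE /spectral_stat big_add1 /= big_mkord; apply: eq_bigr => j _.
  rewrite !mxE /sine_coef /grid_basis; congr (_ * sin _ * _); last by rewrite mulrC.
  by congr (_ * _ / _); rewrite mulrC.
have L' i : ((increments n y k)^T *m sine_mx n) 0 i = spectral_stat y i.+1 :> R.
  have -> : (increments n y k)^T *m sine_mx n = ((sine_mx n)^T *m increments n y k)^T.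
    by rewrite trmx_mul trmxK.
  by rewrite mxE L.
rewrite /quad_form -!mulmxA mulmxA.
rewrite mxE big_add1 /= big_mkord; apply: eq_bigr => i _.
rewrite L' mul_diag_mx mxE L !mxE expr2; ring.
Qed.

Lemma J_form (y : nat -> R) : (16 < n)%N ->
  quad_form (J n) (increments n y k) =
  \sum_(i <- J_range (R := R) n) Num.sqrt n%:R * spectral_stat y i ^+ 2.
Proof.
move=> n16; rewrite /J -/(J_first n).
rewrite (quad_form_diag (fun i => if (J_first (R := R) n < i <= 2 * J_first (R := R) n)%N
   then Num.sqrt n%:R else 0)).
rewrite /J_range; set m := J_first n.
have m2 : (2 * m < n)%N.
  have [m0|m0] := posnP m; first by rewrite m0 muln0 (leq_trans _ n16).
  have : (2 * m)%N \in J_range (R := R) n by rewrite mem_index_iota -/m; lia.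
  by move=> /(J_range_in n16)[_]; lia.
rewrite (@big_cat_nat _ _ _ m.+1) //=; last by lia.
rewrite [X in X + _]big_nat_cond big1 ?add0r; last first.
  by move=> i /andP[/andP[_ h] _]; rewrite ltnNge -ltnS h /= mul0r.
rewrite (@big_cat_nat _ _ _ (2 * m).+1) //=; last by lia.
rewrite [X in _ + X]big_nat_cond [X in _ + X]big1 ?addr0; last first.
  by move=> i /andP[/andP[h _] _]; rewrite [(i <= _)%N]leqNgt h andbF mul0r.
apply: eq_big_nat => i /andP[h1 h2].
by rewrite h1 -ltnS h2.
Qed.

Lemma Jtau_form (y : nat -> R) : (16 < n)%N ->
  quad_form (J_tau n) (increments n y k) =
  \sum_(i <- Jtau_range (R := R) n) @Jtau_weight R n i * spectral_stat y i ^+ 2.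
Proof.
move=> n16; rewrite /J_tau -/(Jtau_first n).
rewrite (quad_form_diag (fun i => if (Jtau_first (R := R) n <= i)%N
   then @Jtau_weight R n i else 0)).
have i0 := @Jtau_first_gt0 R n n16; have i4 := @Jtau_first_small R n n16.
rewrite (@big_cat_nat _ _ _ (Jtau_first (R := R) n)) //=; last by lia.
rewrite [X in X + _]big_nat_cond big1 ?add0r; last first.
  by move=> i /andP[/andP[_ h] _]; rewrite leqNgt h /= mul0r.
by apply: eq_big_nat => i /andP[h1 h2]; rewrite h1.
Qed.

Lemma s_hatE (y : nat -> R) : (16 < n)%N -> s_hat n y k =
  \sum_(i <- J_range (R := R) n) Num.sqrt n%:R * spectral_stat y i ^+ 2 -
  7 * pi ^+ 2 / 3 *
    \sum_(i <- Jtau_range (R := R) n) @Jtau_weight R n i * spectral_stat y i ^+ 2.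
Proof. by move=> n16; rewrite /s_hat /t_hat J_form // Jtau_form. Qed.

Lemma measurable_spectral_stat d (T : measurableType d) (Y : nat -> T -> R) i :
  (forall j, (1 <= j <= n)%N -> measurable_fun setT (Y j)) ->
  measurable_fun setT (fun w => spectral_stat (Y^~ w) i).
Proof.
move=> mY; rewrite /spectral_stat; under eq_fun do rewrite big_add1 big_mkord.
apply: measurable_sum => j.
have h : (j.+2 <= n)%N by case: (n) j => [|n'] [j /=].
apply: measurable_funM => //; apply: measurable_funM => //.
by apply: measurable_funB; apply: mY; rewrite ?h //= ltnW.
Qed.

Lemma measurable_s_hat d (T : measurableType d) (Y : nat -> T -> R) :
  (16 < n)%N -> (forall j, (1 <= j <= n)%N -> measurable_fun setT (Y j)) ->
  measurable_fun setT (fun w => s_hat n (Y^~ w) k).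
Proof.
move=> n16 mY; under eq_fun do rewrite s_hatE //.
have mS i := measurable_spectral_stat i mY.
apply: measurable_funB; last apply: measurable_funM => //.
  apply: measurable_sum => i; apply: measurable_funM => //.
  exact: measurable_funX.
apply: measurable_sum => i; apply: measurable_funM => //.
exact: measurable_funX.
Qed.

End quadratic_forms.

(** * Mean square error of [s_hat] for data linear in independent variables *)

Section estimation_error.
Context {d : measure_display} {T : measurableType d} {R : realType}.
Variable P : probability T R.
Variables (n k : nat) (S U K K4 : R) (t cbar : nat -> R).
Variables (A : finType) (beta : nat -> A -> R) (v : A -> R).
Variables (Z : A + 'I_n -> T -> R) (Y : nat -> T -> R).
Hypothesis n16 : (16 < n)%N.
Hypothesis t_bound : forall l, (0 < l <= n)%N -> 0 <= t l <= U.
Hypothesis cbar_bound : forall j, (0 < j < n)%N -> 0 <= cbar j <= S / n%:R.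
(** Covariance of the signal increments when the signal at node i is the combination of independent
    variables with coefficients [beta i] and variances [v]. *)
Definition increment_cov j j' : R :=
  \sum_a (beta j.+1 a - beta j a) * (beta j'.+1 a - beta j' a) * v a.
Hypothesis C_bound : forall j j', (0 < j < n)%N -> (0 < j' < n)%N ->
  `|increment_cov j j' - (j == j')%:R * cbar j| <= K / n%:R ^+ 2.
Local Notation q := (Num.sqrt (n%:R : R)).
Hypothesis kq : k%:R ^+ 2 <= q.
Hypothesis K40 : 0 <= K4.
Hypothesis Z4 : fourth_moments P Z
  (fun x => match x with inl a => v a | inr _ => 1 end) K4.
Hypothesis mZ : forall x, measurable_fun setT (Z x).
Hypothesis YE : forall i w, (i < n)%N ->
  forall (hi : (i < n)%N), Y i.+1 w =
  \sum_a beta i.+1 a * Z (inl a) w + Num.sqrt (t i.+1) * Z (inr (Ordinal hi)) w.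

Local Notation V := (fun x : A + 'I_n => match x with inl a => v a | inr _ => 1 end).
Local Notation f := (@grid_basis R n k).
Local Notation s := (@sine_coef R n).
Local Notation a := (@noise_coef R n k).
Local Notation Gam := (spectral_cov n k t increment_cov).

(** Coefficients of the i-th statistic in the variables [Z]: the left summand carries the Brownian
    part, the right one the errors. *)
Definition stat_coef (i : nat) (x : A + 'I_n) : R :=
  match x with
  | inl b => \sum_(1 <= j < n) s i j * f j * (beta j.+1 b - beta j b)
  | inr l => a i l.+1 * Num.sqrt (t l.+1)
  end.

Let n0 : (0 < n)%N. Proof. by rewrite (leq_trans _ n16). Qed.

Lemma big_sum_type (F : A + 'I_n -> R) :
  \sum_x F x = \sum_b F (inl b) + \sum_(l < n) F (inr l).
Proof. by rewrite big_sumType. Qed.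

(** Moves the difference from the errors, which are independent, to the smooth factor; [g] vanishes
    at both ends because the sines do. *)
Lemma summation_by_parts (g y : nat -> R) (m : nat) : g 0%N = 0 -> g m.+1 = 0 ->
  \sum_(1 <= j < m.+1) g j * (y j.+1 - y j) =
  \sum_(0 <= l < m.+1) y l.+1 * (g l - g l.+1).
Proof.
move=> g0 gm.
have H p : \sum_(0 <= l < p.+1) y l.+1 * (g l - g l.+1) =
   \sum_(1 <= j < p.+1) g j * (y j.+1 - y j) - y p.+1 * g p.+1.
  elim: p => [|p IH].
    by rewrite big_nat1 big_geq // g0; ring.
  by rewrite big_nat_recr //= IH [in RHS]big_nat_recr //=; ring.
by rewrite H gm mulr0 subr0.
Qed.

Lemma spectral_statE i w :
  spectral_stat n k (Y^~ w) i = \sum_x stat_coef i x * Z x w.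
Proof.
rewrite big_sum_type /=.
pose y1 j := \sum_b beta j b * Z (inl b) w.
pose e l := if insub l.-1 is Some l' then Num.sqrt (t l) * Z (inr l') w else 0.
have YE' j : (1 <= j <= n)%N -> Y j w = y1 j + e j.
  case: j => // j hj; rewrite (YE w hj) /e /=.
  by rewrite insubT.
have -> : spectral_stat n k (Y^~ w) i =
   \sum_(1 <= j < n) s i j * f j * (y1 j.+1 - y1 j) +
   \sum_(1 <= j < n) s i j * f j * (e j.+1 - e j).
  rewrite -big_split; apply: eq_big_nat => j /andP[j1 jn] /=.
  by rewrite !YE' ?j1 ?(ltnW jn) //; ring.
congr (_ + _).
  transitivity (\sum_(1 <= j < n) \sum_b
      s i j * f j * (beta j.+1 b - beta j b) * Z (inl b) w).
    apply: eq_bigr => j _; rewrite -sumrB mulr_sumr.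
    by apply: eq_bigr => b _; ring.
  by rewrite exchange_big; apply: eq_bigr => b _; rewrite mulr_suml.
have := @summation_by_parts (fun j => s i j * f j) e n.-1.
rewrite prednK // sine_coef0 mul0r sine_coefn // mul0r => /(_ erefl erefl) ->.
rewrite big_mkord; apply: eq_bigr => l _; rewrite /e /= insubT //= /noise_coef.
move=> hl; rewrite (_ : Sub (val l) hl = l); last exact: val_inj.
by ring.
Qed.

Lemma stat_cov i i' : \sum_x stat_coef i x * stat_coef i' x * V x = Gam i i'.
Proof.
rewrite big_sum_type /spectral_cov; congr (_ + _).
  transitivity (\sum_b \sum_(1 <= j < n) \sum_(1 <= j' < n)
      s i j * f j * (beta j.+1 b - beta j b) *
      (s i' j' * f j' * (beta j'.+1 b - beta j' b)) * v b).
    apply: eq_bigr => b _; rewrite /= !mulr_suml; apply: eq_bigr => j _.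
    by rewrite mulr_sumr mulr_suml.
  rewrite exchange_big; apply: eq_bigr => j _; rewrite exchange_big.
  apply: eq_bigr => j' _; rewrite /increment_cov mulr_sumr.
  by apply: eq_bigr => b _; ring.
rewrite big_add1 big_mkord; apply: eq_bigr => l _ /=.
have /andP[tl _] : 0 <= t l.+1 <= U by apply: t_bound; rewrite /= ltn_ord.
by rewrite -[t l.+1 in RHS](sqr_sqrtr tl); ring.
Qed.

(** Absorbing the square roots of the weights into the coefficients gives a plain sum of squares.
    [weighted_quadratic_le] bounds its Gram matrix in spectral norm, [gram_frobenius] in Frobenius
    norm. *)
Lemma weighted_variance (r : seq nat) (w : nat -> R) (rho0 : R) :
  uniq r -> (forall i, i \in r -> (0 < i < n)%N) ->
  (forall i, i \in r -> 0 <= w i) -> 0 < rho0 ->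
  (forall i, i \in r -> w i * (lambda n i + n%:R^-1) <= rho0) ->
  exists2 E, has_mean P (fun z => (\sum_(i <- r) w i * spectral_stat n k (Y^~ z) i ^+ 2 -
     \sum_(i <- r) w i * Gam i i) ^+ 2) E &
   E <= 2 * K4 * (((2 * (S + K) + 16 * U + 1) * rho0) ^+ 2 * (size r)%:R).
Proof.
move=> ur hr w0 rho00 wr.
pose B i x := Num.sqrt (w i) * stat_coef i x.
have [E hE EB] := quadratic_variance r B K40 Z4.
exists E.
  apply: eq_has_mean hE => z; congr ((_ - _) ^+ 2); apply: eq_big_seq => i ir.
    rewrite spectral_statE -[w i in RHS]sqr_sqrtr ?w0 // -exprMn mulr_sumr.
    by congr (_ ^+ 2); apply: eq_bigr => x _; rewrite /B mulrA.
  rewrite -stat_cov -[w i in RHS]sqr_sqrtr ?w0 // mulr_sumr.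
  apply: eq_bigr => x _; rewrite /B. move: (stat_coef i x) (Num.sqrt (w i)) => e g; case: x => ?; ring.
apply: le_trans EB _; rewrite ler_wpM2l ?mulr_ge0 //.
have h1 : (0 < 1 < n)%N by rewrite (leq_trans _ n16).
have S0 : 0 <= S.
  by have /andP[c0 c1] := cbar_bound h1; have := le_trans c0 c1; rewrite pmulr_lge0 // invr_gt0 ltr0n.
have U0 : 0 <= U.
  have /andP[c0 c1] : 0 <= t 1%N <= U by apply: t_bound; rewrite /= n0.
  exact: le_trans c0 c1.
have K0 : 0 <= K.
  have := le_trans (normr_ge0 _) (C_bound h1 h1).
  by rewrite pmulr_lge0 // invr_gt0 exprn_gt0 // ltr0n.
(* The added 1 makes the norm bound strictly positive, as [gram_frobenius] requires. *)
have c0 : 0 < 2 * (S + K) + 16 * U + 1 by lra.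
have [v0 _ _] := Z4.
apply: gram_frobenius => //; first exact: mulr_gt0.
move=> c; rewrite big_sum_type.
have := weighted_quadratic_le n16 t_bound cbar_bound C_bound kq c ur hr w0 wr.
set X := _ + _; set c2 := \sum_(i <- r) c i ^+ 2 => hX.
have c20 : 0 <= c2 by apply: sumr_ge0 => i _; exact: sqr_ge0.
apply: (@le_trans _ _ X); last first.
  apply: le_trans hX _; rewrite ler_wpM2r // ler_pM2r //; lra.
rewrite le_eqVlt; apply/orP; left; apply/eqP; rewrite /X; congr (_ + _).
  pose u j := (\sum_(i <- r) c i * Num.sqrt (w i) * s i j) * f j.
  transitivity (\sum_b v b * (\sum_(1 <= j < n) u j * (beta j.+1 b - beta j b)) ^+ 2).
    apply: eq_bigr => b _; congr (_ * _ ^+ 2).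
    transitivity (\sum_(i <- r) \sum_(1 <= j < n)
        c i * Num.sqrt (w i) * s i j * f j * (beta j.+1 b - beta j b)).
      by apply: eq_bigr => i _; rewrite /B /= !mulr_sumr; apply: eq_bigr => j _; ring.
    rewrite exchange_big; apply: eq_bigr => j _; rewrite /u !mulr_suml.
    by apply: eq_bigr => i _.
  under [RHS]eq_bigr => j _.
    under eq_bigr => j' _ do rewrite -/(u j) -/(u j') /increment_cov mulr_sumr.
    rewrite exchange_big /=; over.
  rewrite exchange_big /=; apply: eq_bigr => b _.
  rewrite expr2 mulr_suml mulr_sumr; apply: eq_bigr => j _.
  by rewrite !mulr_sumr; apply: eq_bigr => j' _; ring.
rewrite big_add1 big_mkord; apply: eq_bigr => l _ /=.
have /andP[tl _] : 0 <= t l.+1 <= U by apply: t_bound; rewrite /= ltn_ord.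
rewrite mul1r -[in RHS](sqr_sqrtr tl) -exprMn mulr_sumr; congr (_ ^+ 2).
by apply: eq_bigr => i _; rewrite /B /=; ring.
Qed.

Lemma sqr_sum4 (x1 x2 x3 x4 : R) :
  (x1 + x2 + x3 + x4) ^+ 2 <= 4 * (x1 ^+ 2 + x2 ^+ 2 + x3 ^+ 2 + x4 ^+ 2).
Proof.
have H x y : 2 * (x * y) <= x ^+ 2 + y ^+ 2 :> R.
  by have := sqr_ge0 (x - y); rewrite sqrrB; lra.
have := H x1 x2; have := H x1 x3; have := H x1 x4.
have := H x2 x3; have := H x2 x4; have := H x3 x4.
by rewrite !expr2; lra.
Qed.

Let combine (e1 e2 x y c a1 a2 a3 a4 z : R) : e1 <= a1 / z ->
  c * e2 <= c * (a2 / z) -> x <= a3 / z -> c * y <= c * (a4 / z) ->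
  4 * (e1 + c * e2 + (x + c * y)) <= 4 * (a1 + c * a2 + a3 + c * a4) / z.
Proof. by move: z^-1 => z'; lra. Qed.

Definition s_hat_const : R :=
  let c := 7 * pi ^+ 2 / 3 in
  4 * (2 * K4 * ((2 * (S + K) + 16 * U + 1) * 65) ^+ 2 +
       c ^+ 2 * (2 * K4 * ((2 * (S + K) + 16 * U + 1) * 130) ^+ 2) +
       J_mean_const S U K + c ^+ 2 * Jtau_mean_const S U K).

(** Two fluctuations and two biases. For [J] the norm is O(1 / q) over at most q frequencies, for
    [J_tau] it is O(1 / n) over at most n; so the variances are O(1 / q) and O(1 / n). *)
Lemma s_hat_error :
  (\int[P]_z ((s_hat n (Y^~ z) k - signal_level n k cbar) ^+ 2)%:E <=
   (s_hat_const / q)%:E)%E.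
Proof.
have q4 := @sqrt_n_gt4 R n n16; have q2 := @sqrt_n_sqr R n.
have nR0 : 0 < n%:R :> R by rewrite ltr0n.
have [E1 h1 b1] := @weighted_variance (J_range (R := R) n) (fun=> q) (65 / q)
  (iota_uniq _ _) (fun i ir => let: conj h1 h2 := J_range_in n16 ir in
    introT andP (conj h1 (leq_ltn_trans (leq_pmull _ (ltn0Sn 1)) h2)))
  (fun i _ => sqrtr_ge0 _) ltac:(apply: divr_gt0; lra)
  (fun i ir => J_weight_bound n16 ir).
have [E2 h2 b2] := @weighted_variance (Jtau_range (R := R) n) (@Jtau_weight R n) (130 / n%:R)
  (iota_uniq _ _) (Jtau_range_in n16)
  (fun i ir => proj1 (andP (proj1 (Jtau_weight_bounds n16 ir)))) ltac:(apply: divr_gt0 => //; lra)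
  (fun i ir => Jtau_weight_bound n16 ir).
have m1 := J_mean_error n16 t_bound cbar_bound C_bound kq.
have m2 := Jtau_mean_error n16 t_bound cbar_bound C_bound kq.
set M1 := \sum_(i <- J_range n) q * Gam i i in h1 m1.
set M2 := \sum_(i <- Jtau_range n) Jtau_weight n i * Gam i i in h2 m2.
set c := 7 * pi ^+ 2 / 3 in m1.
set X := signal_level n k cbar in m1 *.
set L := noise_level n k t in m1 m2.
have H := has_meanZ 4 (has_meanD (has_meanD h1 (has_meanZ (c ^+ 2) h2))
  (has_mean_cst P ((M1 - X - c * L) ^+ 2 + c ^+ 2 * (M2 - L) ^+ 2))).
have [iH eH] := H.
apply: (@le_trans _ _ (4 * (E1 + c ^+ 2 * E2 + ((M1 - X - c * L) ^+ 2 + c ^+ 2 * (M2 - L) ^+ 2)))%:E).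
  rewrite -eH; apply: ge0_le_integral => //.
  - by move=> z _; rewrite lee_fin sqr_ge0.
  - apply/measurable_EFinP; apply: measurable_funX; apply: measurable_funB => //.
    apply: measurable_s_hat => // j /andP[j1 jn].
    case: j j1 jn => // j _ jn.
    rewrite (_ : Y j.+1 = fun w => \sum_a beta j.+1 a * Z (inl a) w +
       Num.sqrt (t j.+1) * Z (inr (Ordinal jn)) w); last first.
      by apply/funext => w; exact: YE.
    apply: measurable_funD; last exact: measurable_funM.
    by apply: measurable_sum => b; exact: measurable_funM.
  - by case/integrableP: iH.
  - move=> z _; rewrite lee_fin s_hatE //.
    set Q1 := \sum_(i <- J_range n) _; set Q2 := \sum_(i <- Jtau_range n) _.
    (* The bias c L of the first form and that of the second, multiplied by c, cancel here. *)
    rewrite -/c (_ : Q1 - c * Q2 - X = (Q1 - M1) + - c * (Q2 - M2) +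
       (M1 - X - c * L) + - c * (M2 - L)); last by ring.
    apply: le_trans (sqr_sum4 _ _ _ _) _.
    by rewrite le_eqVlt; apply/orP; left; apply/eqP; ring.
rewrite lee_fin /s_hat_const -/c.
have qi : 0 < q^-1 by rewrite invr_gt0; lra.
have B1 : E1 <= 2 * K4 * ((2 * (S + K) + 16 * U + 1) * 65) ^+ 2 / q.
  apply: le_trans b1 _; rewrite -[leRHS]mulrA; apply: ler_wpM2l; first exact: mulr_ge0.
  set C := 2 * (S + K) + 16 * U + 1.
  apply: (@le_trans _ _ ((C * (65 / q)) ^+ 2 * q)).
    apply: ler_wpM2l; first exact: sqr_ge0.
    rewrite size_iota subSS mul2n -addnn addnK.
    by case/andP: (@J_first_itv R n).
  by rewrite le_eqVlt; apply/orP; left; apply/eqP; field; lra.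
have B2 : E2 <= 2 * K4 * ((2 * (S + K) + 16 * U + 1) * 130) ^+ 2 / q.
  apply: le_trans b2 _; rewrite -[leRHS]mulrA; apply: ler_wpM2l; first exact: mulr_ge0.
  set C := 2 * (S + K) + 16 * U + 1.
  apply: (@le_trans _ _ ((C * (130 / n%:R)) ^+ 2 * n%:R)).
    apply: ler_wpM2l; first exact: sqr_ge0.
    by rewrite size_iota ler_nat leq_subr.
  rewrite (_ : (C * (130 / n%:R)) ^+ 2 * n%:R = (C * 130) ^+ 2 / n%:R); last first.
    by field; rewrite gt_eqF.
  apply: ler_wpM2l; first exact: sqr_ge0.
  rewrite lef_pV2 ?posrE //; last lra.
  by rewrite -[leRHS]q2 expr2 ler_peMr; lra.
have c20 := sqr_ge0 c.
have c2B2 := ler_wpM2l c20 B2; have c2m2 := ler_wpM2l c20 m2.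
move: b1 b2 m1 m2 {h1 h2 H iH eH} B1 c2B2 c2m2 => _ _ m1 _ B1 c2B2 c2m2.
exact: combine B1 c2B2 m1 c2m2.
Qed.

End estimation_error.

(** * Orthogonality of the cosines on [0, 1] *)

Section cosine_series.
Context {R : realType}.
Local Notation mu := (@lebesgue_measure R).
Local Notation I01 := (`[0%R, 1%R]%classic : set R).

Definition has_int01 (g : R -> R) (x : R) : Prop := has_integral mu I01 g x.

Definition int01 (g : R -> R) : R := fine (\int[mu]_(x in I01) (g x)%:E)%E.

Lemma measurable01 : @measurable _ (measurableTypeR R) I01.
Proof. exact: measurable_itv. Qed.

Lemma mu01 : mu I01 = 1%E.
Proof. by rewrite lebesgue_measure_itv /= lte_fin ltr01 oppr0 adde0. Qed.

Lemma has_int01_bounded (g : R -> R) (M : R) : measurable_fun I01 g ->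
  (forall x, 0 <= x <= 1 -> `|g x| <= M) -> has_int01 g (int01 g).
Proof.
move=> mg gM.
have ig : mu.-integrable I01 (EFin \o g).
  apply: measurable_bounded_integrable => //.
    by apply: (le_lt_trans (y := 1%:E)); [rewrite -mu01|exact: ltry].
  exists M; split; first exact: num_real.
  by move=> y My x /=; rewrite in_itv /= => x01; apply: le_trans (gM x x01) (ltW My).
split=> //; rewrite /int01 fineK //; exact: integrable_fin_num.
Qed.

Lemma has_int01_cst (c : R) : has_int01 (fun=> c) c.
Proof.
have := @has_int01_bounded (fun=> c) `|c| (measurable_cst _) (fun _ _ => lexx _).
move=> [h _]; split=> //.
by rewrite integral_cst //= mu01 mule1.
Qed.

Lemma int01E g x : has_int01 g x -> int01 g = x.
Proof. by move=> [_ e]; rewrite /int01 e. Qed.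

Definition cosk (k : nat) (x : R) : R := cos (k%:R * pi * x).

Lemma continuous_cosk k : continuous (cosk k).
Proof.
move=> x; apply: (@continuous_comp _ _ _ (fun x : R => k%:R * pi * x) (@cos R)).
  by apply: cvgM; [exact: cvg_cst|exact: cvg_id].
exact: continuous_cos.
Qed.

Lemma measurable_cosk k D : measurable_fun D (cosk k).
Proof.
apply: measurable_funTS; apply: continuous_measurable_fun.
exact: continuous_cosk.
Qed.

Lemma has_int01_cosk k : has_int01 (cosk k) (k == 0)%:R.
Proof.
have h := has_int01_bounded (@measurable_cosk k I01) (fun x _ => cos_max _ : `|cosk k x| <= 1).
have [->|k0] := eqVneq k 0%N.
  apply: eq_has_integral (has_int01_cst 1) => // x _.
  by rewrite /cosk !mul0r cos0.
case: h => h _; split=> //=.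
have kp : k%:R * pi != 0 :> R by rewrite mulf_neq0 ?pnatr_eq0 // gt_eqF // pi_gt0.
pose F (x : R) := (k%:R * pi)^-1 * sin (k%:R * pi * x).
have dF (x : R) : is_derive x (1 : R) F (cosk k x).
  have h1 : is_derive x (1 : R) ((k%:R * pi) \*: @id R) (k%:R * pi).
    by apply: is_derive_eq; rewrite /GRing.scale /= mulr1.
  have h2 : is_derive x (1 : R) (@sin R \o ((k%:R * pi) \*: @id R)) (cosk k x * (k%:R * pi)).
    exact: (is_derive1_comp (is_derive_sin _) h1).
  have -> : F = (k%:R * pi)^-1 \*: (@sin R \o ((k%:R * pi) \*: @id R)) by [].
  by apply: is_derive_eq; rewrite /GRing.scale /= mulrCA mulVf ?mulr1.
have cF : continuous F.
  move=> x; apply: differentiable_continuous; apply/derivable1_diffP.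
  by have [] := dF x.
rewrite (@continuous_FTC2 R (cosk k) F 0 1) //.
- by rewrite /F mulr0 sin0 mulr1 sin_npi !mulr0 sube0.
- by apply: continuous_subspaceT; exact: continuous_cosk.
- split.
  + by move=> x _; have [] := dF x.
  + exact/cvg_at_right_filter/cF.
  + exact/cvg_at_left_filter/cF.
- by move=> x _; rewrite derive1E; have [_ ->] := dF x.
Qed.

Lemma has_int01_coskM k l : has_int01 (fun x => cosk k x * cosk l x)
  (((k + l)%N == 0%N)%:R / 2 + (k == l)%:R / 2).
Proof.
wlog kl : k l / (l <= k)%N.
  move=> H; have [h|/ltnW h] := leqP l k; first exact: H.
  rewrite addnC [k == l]eq_sym; apply: eq_has_integral (H _ _ h) => // x _.
  by rewrite mulrC.
have := has_integralD measurable01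
  (has_integralZ measurable01 (1 / 2) (has_int01_cosk (k + l)))
  (has_integralZ measurable01 (1 / 2) (has_int01_cosk (k - l))).
rewrite (_ : ((k - l)%N == 0%N) = (k == l)); last first.
  by rewrite subn_eq0 eqn_leq kl andbT.
rewrite !(mulrC (1 / 2) (_ == _)%:R) !mul1r => h.
apply: eq_has_integral h => // x _.
rewrite /cosk natrD natrB // cosMcos.
rewrite (_ : (k%:R + l%:R) * pi * x = k%:R * pi * x + l%:R * pi * x); last by ring.
rewrite (_ : (k%:R - l%:R) * pi * x = k%:R * pi * x - l%:R * pi * x); last by ring.
by field.
Qed.

Lemma cosine_sumE (c : nat -> R) m x :
  cosine_sum c m x = c 0%N + 2 * \sum_(1 <= i < m) c i * cosk i x.
Proof. by []. Qed.

Lemma has_int01_cosine_sqr (c : nat -> R) m :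
  has_int01 (fun x => cosine_sum c m x ^+ 2)
    (c 0%N ^+ 2 + 2 * \sum_(1 <= i < m) c i ^+ 2).
Proof.
have h1 := has_integral_sum measurable01 (index_iota 1 m)
    (fun i => has_integralZ measurable01 (c i) (has_int01_cosk i)).
have e1 : \sum_(1 <= i < m) c i * (i == 0)%:R = 0.
  rewrite big_nat big1 // => i /andP[i0 _].
  by rewrite eqn0Ngt i0 mulr0.
rewrite e1 in h1.
have h2 := has_integral_sum measurable01 (index_iota 1 m) (fun i =>
  has_integral_sum measurable01 (index_iota 1 m) (fun j =>
    has_integralZ measurable01 (c i * c j) (has_int01_coskM i j))).
have e2 : \sum_(1 <= i < m) \sum_(1 <= j < m) c i * c j *
    (((i + j)%N == 0%N)%:R / 2 + (i == j)%:R / 2) = 2^-1 * \sum_(1 <= i < m) c i ^+ 2.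
  rewrite mulr_sumr; apply: eq_big_nat => i /andP[i1 im].
  rewrite (bigD1_seq i) ?iota_uniq ?mem_index_iota ?i1 //= eqxx addn_eq0 [i == 0%N]eqn0Ngt i1 /=.
  rewrite big1 ?addr0 ?mul0r ?add0r ?expr2; first by ring.
  by move=> j /negPf ji; rewrite addn_eq0 [i == 0%N]eqn0Ngt i1 [i == j]eq_sym ji /= !mul0r addr0 mulr0.
rewrite e2 in h2.
have h := has_integralD measurable01 (has_int01_cst (c 0%N ^+ 2))
  (has_integralD measurable01 (has_integralZ measurable01 (4 * c 0%N) h1)
     (has_integralZ measurable01 4 h2)).
rewrite mulr0 add0r mulrA (_ : 4 * 2^-1 = 2 :> R) in h; last by lra.
apply: eq_has_integral h => // x _.
rewrite cosine_sumE; set S := \sum_(1 <= i < m) c i * cosk i x.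
rewrite (_ : \sum_(1 <= i < m) \sum_(1 <= j < m) _ = S ^+ 2); first by ring.
rewrite expr2 mulr_suml; apply: eq_bigr => i _; rewrite mulr_sumr.
by apply: eq_bigr => j _; ring.
Qed.

End cosine_series.

(** * Cosine coefficients and approximation error on the smoothness class *)

Section cosine_coefficients.
Context {R : realType}.
Local Notation mu := (@lebesgue_measure R).
Local Notation I01 := (`[0%R, 1%R]%classic : set R).
Variables (f : R -> R) (M : R).
Hypothesis mf : measurable_fun I01 f.
Hypothesis fM : forall x, 0 <= x <= 1 -> `|f x| <= M.

Definition cos_coef (g : R -> R) (i : nat) : R := int01 (fun x => g x * cosk i x).

(** By Pythagoras, the squared L^2 distance of [g] to its partial cosine sum with indices below
    [m]. *)
Definition cos_tail (g : R -> R) (m : nat) : R := int01 (fun x => g x ^+ 2) -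
  (cos_coef g 0 ^+ 2 + 2 * \sum_(1 <= i < m) cos_coef g i ^+ 2).

Lemma bound_ge0 : 0 <= M.
Proof. by apply: le_trans (fM (_ : 0 <= 0 <= 1)); rewrite ?normr_ge0 // lexx ler01. Qed.

Lemma has_int01_cos_coef i : has_int01 (fun x => f x * cosk i x) (cos_coef f i).
Proof.
apply: (@has_int01_bounded _ _ M).
  by apply: measurable_funM => //; exact: measurable_cosk.
move=> x x01; rewrite normrM -[M]mulr1.
by apply: ler_pM => //; [exact: fM|exact: cos_max].
Qed.

(** Pythagoras: distance to the projection plus distance inside the span. The factor 2 reflects that
    the i-th term of [cosine_sum] is 2 c i cos(i pi x), of squared norm 2 (c i)^2. *)
Lemma has_int01_cosine_dist (c : nat -> R) m :
  has_int01 (fun x => (f x - cosine_sum c m x) ^+ 2)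
    (cos_tail f m + (c 0%N - cos_coef f 0) ^+ 2 +
       2 * \sum_(1 <= i < m) (c i - cos_coef f i) ^+ 2).
Proof.
have h1 : has_int01 (fun x => f x ^+ 2) (int01 (fun x => f x ^+ 2)).
  apply: (@has_int01_bounded _ _ (M ^+ 2)); first exact: measurable_funX.
  by move=> x x01; rewrite normrX ler_pXn2r ?nnegrE ?fM // bound_ge0.
have h2 := has_integralD measurable01 (has_integralZ measurable01 (c 0%N) (has_int01_cos_coef 0))
  (has_integralZ measurable01 2 (has_integral_sum measurable01 (index_iota 1 m)
    (fun i => has_integralZ measurable01 (c i) (has_int01_cos_coef i)))).
have h := has_integralD measurable01
  (has_integralB measurable01 h1 (has_integralZ measurable01 2 h2)) (has_int01_cosine_sqr c m).
rewrite (_ : cos_tail f m + _ + _ = int01 (fun x => f x ^+ 2) -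
  2 * (c 0%N * cos_coef f 0 + 2 * \sum_(1 <= i < m) c i * cos_coef f i) +
  (c 0%N ^+ 2 + 2 * \sum_(1 <= i < m) c i ^+ 2)).
  apply: eq_has_integral h => // x _.
  rewrite cosine_sumE.
  rewrite (_ : \sum_(1 <= i < m) c i * (f x * cosk i x) = f x * \sum_(1 <= i < m) c i * cosk i x).
    by rewrite /cosk !mul0r cos0; ring.
  by rewrite mulr_sumr; apply: eq_bigr => i _; ring.
rewrite (_ : \sum_(1 <= i < m) (c i - cos_coef f i) ^+ 2 = \sum_(1 <= i < m) c i ^+ 2 +
   \sum_(1 <= i < m) cos_coef f i ^+ 2 - 2 * \sum_(1 <= i < m) c i * cos_coef f i).
  by rewrite /cos_tail; ring.
rewrite mulr_sumr -big_split -sumrB /=; apply: eq_bigr => i _; ring.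
Qed.

Lemma cos_tail_ge0 m : 0 <= cos_tail f m.
Proof.
have h := has_int01_cosine_dist (cos_coef f) m.
rewrite subrr expr0n addr0 big1 ?mulr0 ?addr0 in h; last first.
  by move=> i _; rewrite subrr expr0n.
apply: (le_has_integral measurable01 _ (has_int01_cst 0) h) => x _.
exact: sqr_ge0.
Qed.

Variables (alpha C : R).
Hypothesis alpha0 : 0 < alpha.
Hypothesis ft : Theta_s alpha C f.

(** The coefficients given by membership in [Theta_s] must be [cos_coef f]: each squared discrepancy
    is bounded by the L^2 distance of a late partial sum, which tends to 0. *)
Lemma cos_coef_decay : (cos_tail f m @[m --> \oo] --> (0 : R)) /\
  forall m, \sum_(1 <= i < m) i%:R `^ (2 * alpha) * cos_coef f i ^+ 2 <= C.
Proof.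
have [_ _ [th thf thC]] := ft.
have E m : (\int[mu]_(x in I01) ((f x - cosine_sum th m x) ^+ 2)%:E)%E =
  (cos_tail f m + (th 0%N - cos_coef f 0) ^+ 2 +
       2 * \sum_(1 <= i < m) (th i - cos_coef f i) ^+ 2)%:E.
  by have [_ ->] := has_int01_cosine_dist th m.
have L : (fun m => cos_tail f m + (th 0%N - cos_coef f 0) ^+ 2 +
       2 * \sum_(1 <= i < m) (th i - cos_coef f i) ^+ 2) @ \oo --> (0 : R).
  under [X in X @ _]eq_fun do rewrite -[_ + _]/(fine (_)%:E) -E.
  exact: fine_cvg.
have tE i : th i = cos_coef f i.
  apply/eqP; rewrite -subr_eq0 -sqrf_eq0 eq_le sqr_ge0 andbT.
  apply: (cvgr_to_ge L); near=> m.
  have im : (i < m)%N by near: m; exact: nbhs_infty_gt.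
  have s0 : 0 <= \sum_(1 <= j < m) (th j - cos_coef f j) ^+ 2.
    by apply: sumr_ge0 => j _; exact: sqr_ge0.
  have t0 := cos_tail_ge0 m.
  have [->|i0] := posnP i.
    by have := sqr_ge0 (th 0%N - cos_coef f 0); lra.
  have : (th i - cos_coef f i) ^+ 2 <= \sum_(1 <= j < m) (th j - cos_coef f j) ^+ 2.
    rewrite (bigD1_seq i) ?iota_uniq ?mem_index_iota ?i0 //= lerDl.
    by apply: sumr_ge0 => j _; exact: sqr_ge0.
  by have := sqr_ge0 (th 0%N - cos_coef f 0); lra.
split.
  apply: cvg_trans L; apply: near_eq_cvg; near=> m.
  by rewrite big1 ?mulr0 ?addr0 ?tE ?subrr ?expr0n ?addr0 // => i _; rewrite tE subrr expr0n.
move=> m; rewrite -lee_fin; apply: le_trans thC.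
rewrite -sumEFin; under eq_bigr do rewrite -tE.
apply: nneseries_lim_ge => i _ _.
by rewrite lee_fin mulr_ge0 ?powR_ge0 ?sqr_ge0.
Unshelve. all: by end_near.
Qed.

(** The tail is twice the sum of the squared coefficients of index above N, plus a later tail that
    tends to 0; above N the factor i^(2 alpha) is at least N^(2 alpha). *)
Lemma cos_tail_le N : (0 < N)%N -> cos_tail f N.+1 <= 2 * C * N%:R `^ (- (2 * alpha)).
Proof.
move=> N0; have [L S] := cos_coef_decay.
rewrite -subr_ge0.
have : (fun m => 2 * C * N%:R `^ (- (2 * alpha)) - cos_tail f N.+1 + cos_tail f m) @ \oo -->
  2 * C * N%:R `^ (- (2 * alpha)) - cos_tail f N.+1 + 0 by apply: cvgD => //; exact: cvg_cst.
rewrite addr0 => L'; apply: (cvgr_to_ge L'); near=> m.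
have Nm : (N.+1 <= m)%N by near: m; exact: nbhs_infty_ge.
rewrite {1}/cos_tail /cos_tail (@big_cat_nat _ _ _ N.+1 1 m) //=.
set A := \sum_(1 <= i < N.+1) _; set B := \sum_(N.+1 <= i < m) _.
have : B <= C * N%:R `^ (- (2 * alpha)).
  rewrite powRN ler_pdivlMr; last by rewrite powR_gt0 ?ltr0n.
  rewrite mulrC; apply: le_trans (S m).
  rewrite (@big_cat_nat _ _ _ N.+1 1 m) //= -[X in X <= _]add0r; apply: lerD.
    by apply: sumr_ge0 => i _; rewrite mulr_ge0 ?powR_ge0 ?sqr_ge0.
  rewrite mulr_sumr; apply: ler_sum_nat => i /andP[iN _].
  rewrite ler_wpM2r ?sqr_ge0 // ge0_ler_powR ?nnegrE ?ler_nat //; first by rewrite mulr_ge0 // ltW.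
  exact: ltnW.
lra.
Unshelve. all: by end_near.
Qed.

End cosine_coefficients.

(** * Cell averages and the Riemann sum of the signal *)

Section cells.
Context {R : realType}.
Local Notation mu := (@lebesgue_measure R).
Local Notation I01 := (`[0%R, 1%R]%classic : set R).

Definition itv_ind (a b x : R) : R := \1_(`]a, b]%classic) x.

Lemma itv_indE a b x : itv_ind a b x = ((a < x <= b)%R)%:R.
Proof. by rewrite /itv_ind indicE mem_setE in_itv. Qed.

Lemma measurable_itv_ind a b : measurable_fun I01 (itv_ind a b).
Proof. exact: measurable_indic. Qed.

Lemma itv_ind_le1 a b x : `|itv_ind a b x| <= 1.
Proof. by rewrite itv_indE; case: (_ && _); rewrite ?normr1 ?normr0. Qed.

Lemma has_int01_itv_ind a b : 0 <= a -> a <= b -> b <= 1 ->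
  has_int01 (itv_ind a b) (b - a).
Proof.
move=> a0 ab b1.
have [h _] := has_int01_bounded (measurable_itv_ind a b) (fun x _ => itv_ind_le1 a b x).
split=> //; rewrite /itv_ind (@integral_indic _ (measurableTypeR R)) //;
  try exact: measurable01; try exact: measurable_itv.
rewrite setIidl; last first.
  move=> x /=; rewrite !in_itv /= => /andP[ax xb].
  by rewrite (le_trans a0 (ltW ax)) (le_trans xb b1).
apply: etrans (lebesgue_measure_itv `]a, b]) _.
rewrite /= lte_fin; move: ab; rewrite le_eqVlt => /predU1P[->|->]; last by rewrite -EFinB.
by rewrite ltxx subrr.
Qed.

Variables (f : R -> R) (M : R).
Hypothesis mf : measurable_fun I01 f.
Hypothesis f_bound : forall x, 0 <= x <= 1 -> 0 <= f x <= M.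

Let fM x : 0 <= x <= 1 -> `|f x| <= M.
Proof. by move=> x01; have /andP[f0 h] := f_bound x01; rewrite ger0_norm. Qed.

Let M0 : 0 <= M. Proof. exact: bound_ge0 fM. Qed.

Definition cell (n j : nat) : R -> R := itv_ind (j%:R / n%:R) (j.+1%:R / n%:R).

(** For f = sigma^2 this is the variance of the j-th increment of the Wiener integral of sigma. *)
Definition cell_mean (n j : nat) : R := int01 (fun x => f x * cell n j x).

Variable n : nat.
Hypothesis n0 : (0 < n)%N.
Let nR0 : 0 < n%:R :> R. Proof. by rewrite ltr0n. Qed.

Lemma has_int01_cell_mean j : has_int01 (fun x => f x * cell n j x) (cell_mean n j).
Proof.
apply: (@has_int01_bounded _ _ M).
  by apply: measurable_funM => //; exact: measurable_itv_ind.
move=> x x01; rewrite normrM -[M]mulr1.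
by apply: ler_pM => //; [exact: fM|exact: itv_ind_le1].
Qed.

Lemma has_int01_cell j : (j < n)%N -> has_int01 (cell n j) (n%:R^-1).
Proof.
move=> jn; have -> : n%:R^-1 = j.+1%:R / n%:R - j%:R / n%:R :> R.
  by rewrite -mulrBl -natrB // subSnn mul1r.
apply: has_int01_itv_ind; first by rewrite divr_ge0.
  by rewrite ler_pM2r ?invr_gt0 // ler_nat.
by rewrite ler_pdivrMr // mul1r ler_nat.
Qed.

Lemma cell_mean_bound j : (j < n)%N -> 0 <= cell_mean n j <= M / n%:R.
Proof.
move=> jn; apply/andP; split.
  apply: (le_has_integral measurable01 _ (has_int01_cst 0) (has_int01_cell_mean j)).
  move=> x /=; rewrite in_itv /= => /f_bound /andP[f0 _].
  by rewrite mulr_ge0 // /cell itv_indE.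
apply: (le_has_integral measurable01 _ (has_int01_cell_mean j)
  (has_integralZ measurable01 M (has_int01_cell jn))).
move=> x /=; rewrite in_itv /= => /f_bound /andP[f0 h].
by rewrite ler_wpM2r // /cell itv_indE.
Qed.

Lemma cell_mean_lipschitz L j : (j < n)%N ->
  (forall x y, 0 <= x <= 1 -> 0 <= y <= 1 -> `|f x - f y| <= L * `|x - y|) ->
  `|f (j%:R / n%:R) / n%:R - cell_mean n j| <= L / n%:R ^+ 2.
Proof.
move=> jn fL; set y := j%:R / n%:R.
have L0 : 0 <= L.
  have := fL 1 0; rewrite !lexx ler01 subr0 normr1 mulr1 => /(_ erefl erefl).
  by apply: le_trans.
have y01 : 0 <= y <= 1.
  by rewrite /y divr_ge0 //= ler_pdivrMr // mul1r ler_nat ltnW.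
have hc := has_int01_cell jn.
have h := has_integralB measurable01 (has_integralZ measurable01 (f y) hc) (has_int01_cell_mean j).
have hL := has_integralZ measurable01 (L / n%:R) hc.
have -> : L / n%:R ^+ 2 = L / n%:R / n%:R by field; rewrite gt_eqF.
have D x : 0 <= x <= 1 -> `|f y * cell n j x - f x * cell n j x| <= L / n%:R * cell n j x.
  move=> x01; rewrite -mulrBl normrM /cell itv_indE.
  case: (boolP (_ && _)) => /=; last by rewrite normr0 !mulr0.
  move=> /andP[h1 h2]; rewrite normr1 !mulr1.
  apply: le_trans (fL _ _ y01 x01) _.
  rewrite ler_wpM2l // distrC gtr0_norm ?subr_gt0 //.
  by move: h2; rewrite -natr1 mulrDl mul1r /y; lra.
rewrite ler_norml; apply/andP; split.
  rewrite -subr_ge0 opprK.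
  apply: (le_has_integral measurable01 _ (has_int01_cst 0) (has_integralD measurable01 h hL)).
  move=> x /=; rewrite in_itv /= => /D; rewrite ler_norml => /andP[]; lra.
apply: (le_has_integral measurable01 _ h hL) => x /=.
by rewrite in_itv /= => /D; rewrite ler_norml => /andP[].
Qed.

(** The cells of index 1 to n - 1 miss (0, 1/n], since no increment starts at the time 0. *)
Lemma cell_partition (x : R) : n%:R^-1 < x <= 1 ->
  exists2 j, (1 <= j < n)%N & j%:R / n%:R < x <= j.+1%:R / n%:R.
Proof.
move=> /andP[nx x1].
have ex : exists j : nat, x * n%:R <= j.+1%:R.
  exists n; rewrite -natr1; apply: (@le_trans _ _ n%:R); last by rewrite lerDl.
  by rewrite -[leRHS]mul1r ler_wpM2r.
have [j xj jm] := ex_minnP ex.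
have j0 : (0 < j)%N.
  rewrite lt0n; apply/eqP => j0; move: xj; rewrite j0 -ler_pdivlMr // mul1r.
  by rewrite leNgt nx.
exists j; last first.
  rewrite ler_pdivlMr // xj andbT ltr_pdivrMr // ltNge; apply/negP => h.
  by have := jm j.-1; rewrite prednK // => /(_ h); rewrite leqNgt ltn_predL j0.
rewrite j0 /= -(ltn_predK n0) ltnS jm // prednK //.
by rewrite -[leRHS]mul1r ler_wpM2r.
Qed.

Lemma sum_cell (h : nat -> R) j (x : R) : (1 <= j < n)%N -> j%:R / n%:R < x <= j.+1%:R / n%:R ->
  \sum_(1 <= i < n) h i * cell n i x = h j.
Proof.
move=> jn xj; rewrite (bigD1_seq j) ?iota_uniq ?mem_index_iota //= /cell itv_indE xj mulr1.
rewrite big1_seq ?addr0 // => i /andP[ij _]; rewrite itv_indE.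
case: (boolP (_ && _)); rewrite ?mulr0 // => /andP[h1 h2].
case/andP: xj => h3 h4; move: h1 h2 h3 h4.
rewrite ltr_pdivrMr // ler_pdivlMr // ltr_pdivrMr // ler_pdivlMr // => h1 h2 h3 h4.
have := lt_le_trans h1 h4; have := lt_le_trans h3 h2; rewrite !ltr_nat !ltnS => a b.
by move: ij; rewrite eqn_leq a b.
Qed.

(** On a cell the squared weight varies by at most 4 k / n, since pi <= 4. The missing first cell
    costs at most 2 M / n, as the squared weight is at most 2. *)
Lemma signal_level_coef (k : nat) :
  `|signal_level n k (cell_mean n) -
     (cos_coef f 0 + (k != 0)%:R * cos_coef f k)| <= M * (4 * k%:R + 2) / n%:R.
Proof.
pose g x : R := cos_basis k x ^+ 2.
have gE x : g x = cosk 0 x + (k != 0)%:R * cosk k x.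
  by rewrite /g cos_basis_sqr /cosk !mul0r cos0.
have gL x y : `|g x - g y| <= 4 * k%:R * `|x - y|.
  rewrite /g !cos_basis_sqr opprD addrACA subrr add0r -mulrBr normrM normr_nat.
  apply: (@le_trans _ _ (1 * `|k%:R * pi * x - k%:R * pi * y|)).
    by apply: ler_pM => //; [case: (k != 0)%N|exact: normr_cosB_le].
  rewrite mul1r -mulrBr normrM ler_wpM2r // normrM normr_nat ger0_norm ?pi_ge0 //.
  rewrite mulrC ler_wpM2r //; have := pihalf_lt2 R; lra.
have hI := has_integral_sum measurable01 (index_iota 1 n) (fun j =>
  has_integralZ measurable01 (g (j%:R / n%:R)) (has_int01_cell_mean j)).
have hJ := has_integralD measurable01 (has_int01_cos_coef mf fM 0)
  (has_integralZ measurable01 (k != 0)%:R (has_int01_cos_coef mf fM k)).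
have h := has_integralB measurable01 hI hJ.
have n1 : n%:R^-1 <= 1 :> R by rewrite invf_le1 // ler1n.
have ni : 0 <= n%:R^-1 :> R by rewrite invr_ge0.
have hR := has_integralZ measurable01 M (has_integralB measurable01
  (has_int01_cst (4 * k%:R / n%:R + 2))
  (has_integralZ measurable01 2 (has_int01_itv_ind ni n1 (lexx 1)))).
have E : M * (4 * k%:R / n%:R + 2 - 2 * (1 - n%:R^-1)) = M * (4 * k%:R + 2) / n%:R.
  by ring.
rewrite E in hR.
have D x : 0 <= x <= 1 -> `|\sum_(1 <= j < n) g (j%:R / n%:R) * (f x * cell n j x) -
    (f x * cosk 0 x + (k != 0)%:R * (f x * cosk k x))| <=
    M * (4 * k%:R / n%:R + 2 - 2 * itv_ind n%:R^-1 1 x).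
  move=> x01; rewrite (_ : \sum_(1 <= j < n) _ - _ =
    f x * (\sum_(1 <= j < n) g (j%:R / n%:R) * cell n j x - g x)); last first.
    rewrite gE mulrBr; congr (_ - _); last by ring.
    by rewrite mulr_sumr; apply: eq_bigr => i _; ring.
  rewrite normrM; apply: ler_pM => //; first exact: fM.
  rewrite itv_indE; case: (boolP (_ && _)) => [nx|nx] /=.
    have [j jn xj] := cell_partition nx.
    rewrite (sum_cell (fun j => g (j%:R / n%:R)) jn xj) mulr1 addrK.
    apply: le_trans (gL _ _) _; rewrite -mulrA -mulrA ler_pM2l // ler_wpM2l //.
    case/andP: xj => h1 h2; rewrite distrC gtr0_norm ?subr_gt0 //.
    by move: h2; rewrite -natr1 mulrDl mul1r; lra.
  rewrite mulr0 subr0 big_nat big1 ?add0r.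
    rewrite normrN ger0_norm ?sqr_ge0 //; have := cos_basis_sqr_le k x.
    have : 0 <= 4 * k%:R / n%:R :> R by rewrite divr_ge0 // mulr_ge0.
    by rewrite /g; lra.
  move=> j /andP[j1 _]; rewrite /cell itv_indE; case: (boolP (_ && _)); rewrite ?mulr0 //.
  move=> /andP[jx _]; case/negP: nx; case/andP: x01 => _ ->; rewrite andbT.
  apply: le_lt_trans jx; rewrite -[leLHS]mul1r ler_pM2r ?invr_gt0 // ler1n //.
rewrite ler_norml; apply/andP; split.
  rewrite -subr_ge0 opprK.
  apply: (le_has_integral measurable01 _ (has_int01_cst 0) (has_integralD measurable01 h hR)).
  move=> x /=; rewrite in_itv /= => /D; rewrite ler_norml => /andP[]; lra.
apply: (le_has_integral measurable01 _ h hR) => x /=.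
by rewrite in_itv /= => /D; rewrite ler_norml => /andP[].
Qed.

End cells.

(** * From errors of coefficients to the integrated risk *)

Section risk_bound.
Context {d : measure_display} {T : measurableType d} {R : realType}.
Variable P : probability T R.
Local Notation I01 := (`[0%R, 1%R]%classic : set R).
Variables (f : R -> R) (M : R) (n : nat).
Hypothesis n16 : (16 < n)%N.
Hypothesis mf : measurable_fun I01 f.
Hypothesis f_bound : forall x, 0 <= x <= 1 -> 0 <= f x <= M.
Local Notation q := (Num.sqrt (n%:R : R)).

Let fM x : 0 <= x <= 1 -> `|f x| <= M.
Proof. by move=> x01; have /andP[f0 h] := f_bound x01; rewrite ger0_norm. Qed.

Let M0 : 0 <= M. Proof. exact: bound_ge0 fM. Qed.

(** The integral of [g] times the squared weight. The estimator subtracts [s_hat n y 0] for k >= 1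
    to isolate the k-th coefficient. *)
Definition s_target (g : R -> R) (k : nat) : R := cos_coef g 0 + (k != 0)%:R * cos_coef g k.

Lemma target_error (k : nat) (X : T -> R) (B : R) : measurable_fun setT X -> k%:R ^+ 2 <= q ->
  (\int[P]_w ((X w - signal_level n k (cell_mean f n)) ^+ 2)%:E <= (B / q)%:E)%E ->
  (\int[P]_w ((X w - s_target f k) ^+ 2)%:E <= ((2 * B + 80 * M ^+ 2) / q)%:E)%E.
Proof.
move=> mX kq H; set a := signal_level _ _ _ in H.
have n0 : (0 < n)%N by exact: leq_trans n16.
have q4 : 4 < q := sqrt_n_gt4 n16; have q2 : q ^+ 2 = n%:R := sqrt_n_sqr n.
have nR0 : 0 < n%:R :> R by rewrite ltr0n.
have D : (a - s_target f k) ^+ 2 <= 40 * M ^+ 2 / q.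
  have /sqr_le_of_norm := signal_level_coef mf f_bound n0 k; rewrite -/a -/(s_target f k).
  move/le_trans; apply.
  (* Uses k^2 <= q, 4 < q and (4 k - 2)^2 >= 0; the discretisation error is then of lower order than
     the stochastic one. *)
  have h : (4 * k%:R + 2) ^+ 2 <= 40 * q.
    by have := sqr_ge0 (4 * k%:R - 2 : R); move: kq q4; set x := k%:R; lra.
  rewrite (_ : (_ / _) ^+ 2 = M ^+ 2 * ((4 * k%:R + 2) ^+ 2 / n%:R ^+ 2)); last first.
    by field; rewrite gt_eqF.
  rewrite (_ : 40 * M ^+ 2 / q = M ^+ 2 * (40 / q)); last by ring.
  rewrite ler_wpM2l ?sqr_ge0 // ler_pdivrMr ?exprn_gt0 // (le_trans h) //.
  move: q4 q2; set z := Num.sqrt _ => q4 <-.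
  have -> : 40 / z * (z ^+ 2) ^+ 2 = 40 * z * z ^+ 2 by field; lra.
  by rewrite ler_peMr; [| |nra]; nra.
apply: (@le_trans _ _ (\int[P]_w (2%:E * ((X w - a) ^+ 2)%:E + (80 * M ^+ 2 / q)%:E))%E).
  apply: ge0_le_integral => //.
  - by move=> w _; rewrite lee_fin sqr_ge0.
  - by apply/measurable_EFinP; apply: measurable_funX; apply: measurable_funB.
  - apply: emeasurable_funD => //; apply: measurable_funeM.
    by apply/measurable_EFinP; apply: measurable_funX; apply: measurable_funB.
  move=> w _; rewrite -EFinM -EFinD lee_fin.
  have := sqr_ge0 ((X w - a) - (a - s_target f k)); lra.
rewrite ge0_integralD //.
- rewrite ge0_integralZl //.
  + rewrite (has_mean_cst P _).2.
    rewrite (_ : (2 * B + 80 * M ^+ 2) / q = 2 * (B / q) + 80 * M ^+ 2 / q); last by ring.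
    by rewrite [leRHS]EFinD; apply: leeD2r; rewrite [leRHS]EFinM lee_pmul2l.
  + by apply/measurable_EFinP; apply: measurable_funX; apply: measurable_funB.
  + by move=> w _; rewrite lee_fin sqr_ge0.
- by move=> w _; rewrite mule_ge0 // lee_fin sqr_ge0.
- apply: measurable_funeM.
  by apply/measurable_EFinP; apply: measurable_funX; apply: measurable_funB.
- by move=> w _; rewrite lee_fin divr_ge0 ?sqrtr_ge0 // mulr_ge0 ?sqr_ge0.
Qed.

Variables (alpha C : R).
Hypothesis alpha0 : 0 < alpha.
Hypothesis ft : Theta_s alpha C f.

(** Pythagoras for each outcome, then integration. For i >= 1 the error of the i-th coefficient is
    the difference of the errors of [s_hat] at i and at 0, so its square is at most twice the sum of
    their squares. *)
Lemma MISE_le (N : nat) (Y : nat -> T -> R) (B : R) : (0 < N)%N ->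
  (forall k, measurable_fun setT (fun w => s_hat n (Y^~ w) k)) ->
  (forall k, (k <= N)%N ->
     (\int[P]_w ((s_hat n (Y^~ w) k - s_target f k) ^+ 2)%:E <= B%:E)%E) ->
  (MISE P f n N Y <= (2 * C * N%:R `^ (- (2 * alpha)) + 9 * N%:R * B)%:E)%E.
Proof.
move=> N0 mS H.
pose g k w := (s_hat n (Y^~ w) k - s_target f k) ^+ 2.
(* The error at 0 enters every coefficient, hence its large weight. In total the weights are 1 + 8 N
   <= 9 N. *)
pose c k : R := if k == 0%N then 1 + 4 * N%:R else 4.
have c0 k : 0 <= c k by rewrite /c; case: ifP => // _; rewrite addr_ge0 // mulr_ge0.
have mg k : measurable_fun setT (g k) by apply: measurable_funX; apply: measurable_funB.
have g0 k w : 0 <= g k w by exact: sqr_ge0.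
have B0 : 0 <= B.
  rewrite -lee_fin; apply: le_trans (H 0%N isT); apply: integral_ge0 => w _.
  by rewrite lee_fin sqr_ge0.
set K := 2 * C * _.
have tK : cos_tail f N.+1 <= K by exact: (cos_tail_le mf fM alpha0 ft).
have K0 : 0 <= K by apply: le_trans tK; exact: (cos_tail_ge0 mf fM).
pose b w i := if i == 0%N then s_hat n (Y^~ w) 0 else s_hat n (Y^~ w) i - s_hat n (Y^~ w) 0.
pose r w := cos_tail f N.+1 + (b w 0%N - cos_coef f 0) ^+ 2 +
  2 * \sum_(1 <= i < N.+1) (b w i - cos_coef f i) ^+ 2.
have -> : MISE P f n N Y = (\int[P]_w (r w)%:E)%E.
  apply: eq_integral => w _.
  have [_ <-] := has_int01_cosine_dist mf fM (b w) N.+1.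
  apply: eq_integral => t _; congr (_%:E); rewrite -[in LHS]sqrrN opprB; congr ((_ - _) ^+ 2).
  rewrite /sigma2_hat /cosine_sum /b /=; congr (_ + _ * _).
  by apply: eq_big_nat => i /andP[i1 _]; rewrite eqn0Ngt i1.
have mb i : measurable_fun setT (b^~ i).
  by rewrite /b; case: (i == 0)%N => //; exact: measurable_funB.
have rle w : r w <= K + \sum_(0 <= k < N.+1) c k * g k w.
  have -> : K + \sum_(0 <= k < N.+1) c k * g k w =
      K + g 0%N w + \sum_(1 <= i < N.+1) (4 * g 0%N w + 4 * g i w).
    rewrite big_ltn // big_split /= sumr_const_nat subn1 /= {1}/c /=.
    rewrite (eq_big_nat _ _ (F2 := fun i => 4 * g i w)).
      by rewrite -[X in _ = _ + (X + _)]mulr_natr; ring.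
    by move=> i /andP[i1 _]; rewrite /c eqn0Ngt i1.
  apply: lerD; first by apply: lerD => //; rewrite /g /s_target /b mul0r addr0.
  rewrite mulr_sumr; apply: ler_sum_nat => i /andP[i1 _].
  rewrite /b /g /s_target eqn0Ngt i1 /= mul0r addr0 mul1r.
  set x := s_hat _ _ i; set y := s_hat _ _ 0; set p := cos_coef f 0; set p' := cos_coef f i.
  have := sqr_ge0 ((y - p) + (x - (p + p'))); lra.
apply: (@le_trans _ _ (\int[P]_w (K%:E + \sum_(0 <= k < N.+1) (c k)%:E * (g k w)%:E))%E).
  apply: ge0_le_integral => //.
  - move=> w _; rewrite lee_fin /r; apply: addr_ge0; [apply: addr_ge0|apply: mulr_ge0 => //].
    + exact: (cos_tail_ge0 mf fM).
    + exact: sqr_ge0.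
    + by apply: sumr_ge0 => i _; exact: sqr_ge0.
  - apply/measurable_EFinP; apply: measurable_funD.
      apply: measurable_funD => //; apply: measurable_funX; exact: measurable_funB.
    apply: measurable_funM => //; apply: measurable_sum => i.
    by apply: measurable_funX; exact: measurable_funB.
  - apply: emeasurable_funD => //; apply: emeasurable_sum => i.
    by apply: measurable_funeM; exact/measurable_EFinP.
  - move=> w _; under eq_bigr do rewrite -EFinM.
    by rewrite sumEFin -EFinD lee_fin.
have mcg k : measurable_fun setT (fun w => (c k)%:E * (g k w)%:E)%E.
  by apply: measurable_funeM; exact/measurable_EFinP.
have cg0 k w : (0 <= (c k)%:E * (g k w)%:E)%E by rewrite mule_ge0 // lee_fin.
rewrite ge0_integralD //; last 2 first.
- by move=> w _; apply: sume_ge0 => k _.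
- by apply: emeasurable_sum => i.
rewrite (has_mean_cst P _).2 [leRHS]EFinD; apply: leeD2l.
rewrite ge0_integral_sum //.
apply: (@le_trans _ _ (\sum_(0 <= k < N.+1) (c k)%:E * B%:E)%E).
  rewrite big_nat [leRHS]big_nat; apply: lee_sum => k /andP[_ kN].
  rewrite ge0_integralZl ?lee_fin //.
  - by apply: lee_wpmul2l; rewrite ?lee_fin // H.
  - exact/measurable_EFinP.
  - by move=> w _; rewrite lee_fin.
under eq_bigr do rewrite -EFinM.
rewrite sumEFin lee_fin -mulr_suml ler_wpM2r // big_ltn // /c /=.
rewrite (eq_big_nat _ _ (F2 := fun=> 4)); last by move=> i /andP[i1 _]; rewrite eqn0Ngt i1.
rewrite sumr_const_nat subn1 /= -[4 *+ N]mulr_natr.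
have : 1 <= N%:R :> R by rewrite ler1n.
lra.
Qed.

End risk_bound.

(** * Lipschitz continuity on the smoothness class for alpha > 3/2 *)

Section lipschitz.
Context {R : realType}.
Local Notation mu := (@lebesgue_measure R).
Local Notation I01 := (`[0%R, 1%R]%classic : set R).

Definition inv_power_bound (s : R) : R := (1 - 2 * 2 `^ (- s))^-1.

(** Condensation: pairing the terms 2 j and 2 j + 1 bounds a partial sum A by 1 + 2^(1 - s) A, and
    2^(1 - s) < 1. *)
Lemma sum_inv_power_le (s : R) (m : nat) : 1 < s ->
  \sum_(1 <= i < m) i%:R `^ (- s) <= inv_power_bound s.
Proof.
move=> s1; set g := fun i : nat => (i%:R : R) `^ (- s).
have g0 i : 0 <= g i by exact: powR_ge0.
have dec i j : (0 < i)%N -> (i <= j)%N -> g j <= g i.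
  move=> i0 ij; rewrite /g !powRN lef_pV2 ?posrE ?powR_gt0 ?ltr0n ?(leq_trans i0) //.
  by rewrite ge0_ler_powR ?nnegrE ?ler_nat //; lra.
have dyadic k : \sum_(1 <= i < 2 * k.+1) g i <= 1 + 2 * 2 `^ (- s) * \sum_(1 <= j < k.+1) g j.
  elim: k => [|k IH].
    by rewrite muln1 big_nat1 big_geq // mulr0 addr0 /g powR1.
  have -> : (2 * k.+2)%N = (2 * k.+1).+2 by rewrite mulnS.
  rewrite big_nat_recr //= big_nat_recr //=.
  rewrite [in leRHS]big_nat_recr //=.
  have h : g (2 * k.+1)%N = 2 `^ (- s) * g k.+1 by rewrite /g natrM powRM.
  have := dec (2 * k.+1)%N (2 * k.+1).+1 isT (leqnSn _); move: IH h.
  by set x := \sum_(1 <= i < k.+1) g i; set y := \sum_(1 <= i < (2 * k.+1)) g i; lra.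
have r1 : 2 * 2 `^ (- s) < 1 :> R.
  have h : 1 `^ (s - 1) < 2 `^ (s - 1) :> R.
    by rewrite gt0_ltr_powR ?nnegrE ?subr_gt0 ?ltr1n.
  rewrite powRN -/(2 / 2 `^ s) ltr_pdivrMr ?powR_gt0 // mul1r.
  rewrite -(@mulr_powRB1 _ 2 s) //; last by lra.
  by move: h; rewrite powR1; lra.
rewrite /inv_power_bound -[leRHS]mul1r ler_pdivlMr; last by lra.
case: m => [|m]; first by rewrite big_geq // mul0r.
have : \sum_(1 <= i < m.+1) g i <= \sum_(1 <= i < 2 * m.+1) g i.
  rewrite [leRHS](@big_cat_nat _ _ _ m.+1) //=; last by rewrite mul2n -addnn leq_addl.
  by rewrite lerDl; apply: sumr_ge0 => i _.
by have := dyadic m; set a := \sum_(1 <= i < m.+1) g i; lra.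
Qed.

Variables (f : R -> R) (M : R).
Hypothesis mf : measurable_fun I01 f.
Hypothesis fM : forall x, 0 <= x <= 1 -> `|f x| <= M.
Variables (alpha C : R).
Hypothesis alpha0 : 3 / 2 < alpha.
Hypothesis ft : Theta_s alpha C f.

Definition lipschitz_const : R := 4 * (C + inv_power_bound (2 * alpha - 2)).

(** The sum of i |a i| is finite: by AM-GM, 2 i |a i| <= i^(2 alpha) (a i)^2 + i^(2 - 2 alpha), and
    2 alpha - 2 > 1. The constant does not depend on [m]. *)
Lemma cosine_sum_lipschitz m x y :
  `|cosine_sum (cos_coef f) m x - cosine_sum (cos_coef f) m y| <= lipschitz_const * `|x - y|.
Proof.
have [_ H] := cos_coef_decay mf fM ft; have := H m; set a := cos_coef f => Hm.
rewrite !cosine_sumE opprD addrACA subrr add0r -mulrBr -sumrB normrM ger0_norm //.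
have D : \sum_(1 <= i < m) `|a i * cosk i x - a i * cosk i y| <=
   \sum_(1 <= i < m) 2 * (i%:R `^ (2 * alpha) * a i ^+ 2 + i%:R `^ (- (2 * alpha - 2))) * `|x - y|.
  apply: ler_sum_nat => i /andP[i1 _]; rewrite -mulrBr normrM.
  apply: (@le_trans _ _ (`|a i| * (4 * i%:R * `|x - y|))).
    rewrite ler_wpM2l //; apply: le_trans (normr_cosB_le _ _) _.
    rewrite -mulrBr normrM ler_wpM2r // normrM normr_nat ger0_norm ?pi_ge0 // mulrC ler_wpM2r //.
    by have := pihalf_lt2 R; lra.
  rewrite mulrA ler_wpM2r //.
  have iR : 0 < i%:R :> R by rewrite ltr0n.
  set z := i%:R `^ alpha.
  have z0 : 0 < z by exact: powR_gt0.
  have E1 : i%:R `^ (2 * alpha) = z ^+ 2.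
    by rewrite -powR_mulrn ?powR_ge0 // -powRrM mulrC.
  have -> : i%:R `^ (- (2 * alpha - 2)) = (i%:R / z) ^+ 2.
    rewrite opprB powRD; last by rewrite pnatr_eq0 -lt0n i1 implybT.
    by rewrite powR_mulrn ?ler0n // powRN E1 exprMn exprVn.
  rewrite E1.
  have := sqr_ge0 (z * `|a i| - i%:R / z).
  rewrite -(real_normK (num_real (a i))).
  have -> : (z * `|a i| - i%:R / z) ^+ 2 = z ^+ 2 * `|a i| ^+ 2 + (i%:R / z) ^+ 2 - 2 * (i%:R * `|a i|).
    by field; rewrite gt_eqF.
  lra.
apply: (@le_trans _ _ (2 * (\sum_(1 <= i < m) 2 * (i%:R `^ (2 * alpha) * a i ^+ 2 +
    i%:R `^ (- (2 * alpha - 2))) * `|x - y|))).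
  by rewrite ler_pM2l //; apply: le_trans D; exact: ler_norm_sum.
rewrite -mulr_suml mulrA ler_wpM2r // -mulr_sumr big_split /=.
have h2 : 1 < 2 * alpha - 2 by have h := alpha0; lra.
by have := sum_inv_power_le m h2; rewrite /lipschitz_const; lra.
Qed.

Hypothesis cf : {within I01, continuous f}.

Lemma near_interval x e : 0 <= x <= 1 -> 0 < e -> exists a b, [/\ 0 <= a, a < b, b <= 1 &
  forall t, a < t <= b -> `|x - t| < e /\ `|f x - f t| < e].
Proof.
move=> x01 e0.
have /subspace_continuousP/(_ x) := cf.
rewrite /= in_itv /= => /(_ x01) /cvgrPdist_lt /(_ e e0).
rewrite near_withinE => /nbhs_ballP[r /= r0 H].
pose s := Num.min r e / 2.
have s0 : 0 < s by rewrite divr_gt0 // lt_min r0.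
have [sr se] : s < r /\ s < e.
  have : 2 * s <= r /\ 2 * s <= e.
    by rewrite /s mulrC divfK // !ge_min !lexx orbT.
  by move=> [? ?]; split; lra.
exists (Num.max 0 (x - s)), (Num.min 1 (x + s)).
split; rewrite ?le_max ?lexx ?ge_min ?lexx //.
  by case/andP: x01 => x0 x1; rewrite gt_max !lt_min ltr01 /=; apply/andP; split; [lra|apply/andP; split; lra].
move=> t; rewrite gt_max le_min => /andP[/andP[t0 xt] /andP[t1 tx]].
have xts : `|x - t| <= s by rewrite ler_norml; apply/andP; split; lra.
split; first exact: le_lt_trans se.
apply: H; first exact: le_lt_trans sr.
by rewrite /= in_itv /= (ltW t0) t1.
Qed.

(** Only L^2 convergence of the partial sums is known. Near x and near y there are points where a
    late partial sum is close to [f]; the Lipschitz bound holds between these points, and continuity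
    carries it to x and y. *)
Lemma Theta_lipschitz x y : 0 <= x <= 1 -> 0 <= y <= 1 ->
  `|f x - f y| <= lipschitz_const * `|x - y|.
Proof.
move=> x01 y01.
have L0 : 0 <= lipschitz_const.
  by have := le_trans (normr_ge0 _) (cosine_sum_lipschitz 0 1 0); rewrite subr0 normr1 mulr1.
have [T _] := cos_coef_decay mf fM ft.
have E m := has_int01_cosine_dist mf fM (cos_coef f) m.
have {}E m : has_int01 (fun t => (f t - cosine_sum (cos_coef f) m t) ^+ 2) (cos_tail f m).
  have := E m; rewrite subrr expr0n addr0 big1 ?mulr0 ?addr0 //.
  by move=> i _; rewrite subrr expr0n.
have app u e : 0 <= u <= 1 -> 0 < e -> \forall m \near \oo, exists t,
    [/\ `|u - t| < e, `|f u - f t| < e & `|f t - cosine_sum (cos_coef f) m t| <= e].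
  move=> u01 e0; have [a [b [a0 ab b1 H]]] := near_interval u01 e0.
  have d0 : 0 < e ^+ 2 * (b - a) by rewrite mulr_gt0 ?exprn_gt0 // subr_gt0.
  have /cvgrPdist_lt /(_ _ d0) := T; apply: filterS => m; rewrite sub0r normrN.
  rewrite ger0_norm ?(cos_tail_ge0 mf fM) // => Tm.
  (* Otherwise the partial sum would be at distance more than [e] from [f] on all of ]a, b], and its
     squared L^2 distance would be at least e^2 (b - a). *)
  apply: contrapT => /forallNP nex; move: Tm; apply/negP; rewrite -leNgt.
  apply: (le_has_integral measurable01 _
    (has_integralZ measurable01 (e ^+ 2) (has_int01_itv_ind a0 (ltW ab) b1)) (E m)).
  move=> t _ /=; rewrite itv_indE; case: (boolP (_ && _)) => [abt|_]; last by rewrite mulr0 sqr_ge0.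
  rewrite mulr1 -(real_normK (num_real (f t - _))) ler_sqr ?nnegrE ?(ltW e0) //.
  have [h1 h2] := H t abt.
  by rewrite leNgt; apply/negP => /ltW h3; apply: (nex t).
apply/ler_addgt0Pr => e e0.
(* Four errors of size e / D, and twice e / D for the shift of the two points, multiplied by the
   Lipschitz constant. *)
set D := 4 + 2 * lipschitz_const.
have D0 : 0 < D by rewrite /D; lra.
have e'0 : 0 < e / D by rewrite divr_gt0.
have [m [[s [s1 s2 s3]] [t [t1 t2 t3]]]] := @filter_ex _ _ _ _ (filterI (app x _ x01 e'0) (app y _ y01 e'0)).
have eE : e = 4 * (e / D) + 2 * lipschitz_const * (e / D).
  by rewrite -mulrDl mulrC divfK // gt_eqF.
have h := cosine_sum_lipschitz m s t; rewrite eE; move: (e / D) e'0 s1 s2 s3 t1 t2 t3 => z z0 s1 s2 s3 t1 t2 t3.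
have st : `|s - t| <= `|x - y| + 2 * z.
  have -> : s - t = (x - y) + ((y - t) - (x - s)) by ring.
  have := ler_normD (x - y) ((y - t) - (x - s)); have := ler_normB (y - t) (x - s); lra.
have h' : lipschitz_const * `|s - t| <= lipschitz_const * (`|x - y| + 2 * z) by rewrite ler_wpM2l.
set A := cosine_sum _ m s in h s3; set B := cosine_sum _ m t in h t3.
have -> : f x - f y = (f x - f s) + ((f s - A) + ((A - B) - ((f t - B) + (f y - f t)))) by ring.
have := ler_normD (f x - f s) ((f s - A) + ((A - B) - ((f t - B) + (f y - f t)))).
have := ler_normD (f s - A) ((A - B) - ((f t - B) + (f y - f t))).
have := ler_normB (A - B) ((f t - B) + (f y - f t)).
have := ler_normD (f t - B) (f y - f t).
lra.
Qed.


End lipschitz.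

(** * Reindexing and merging independent families *)

Section independence_tools.
Context {d : measure_display} {T : measurableType d} {R : realType}.
Variable P : probability T R.

Lemma mutually_independent_inj (I J : choiceType) (D : set I) (X : I -> T -> R) (h : J -> I) :
  injective h -> (forall j, D (h j)) -> mutually_independent P D X ->
  mutually_independent P setT (fun j => X (h j)).
Proof.
move=> hI hD H s B us _ mB.
(* Transport of [B] along [h]: the fibre over [h j] is [j] alone, and the set is everything outside
   the image of [s]. *)
pose B' i := \big[setI/setT]_(j <- s | h j == i) B j.
have B'E j : j \in s -> B' (h j) = B j.
  move=> js; rewrite /B' -big_filter (eq_filter (a2 := pred1 j)).
    by rewrite filter_pred1_uniq // big_seq1.
  by move=> l; rewrite /= inj_eq.
have := H [seq h j | j <- s] B'; rewrite map_inj_uniq // !big_map.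
move=> /(_ us) e; rewrite (_ : \big[setI/setT]_(i <- s) (X (h i) @^-1` B i) =
   \big[setI/setT]_(i <- s) (X (h i) @^-1` B' (h i))); last first.
  by apply: eq_big_seq => j js; rewrite B'E.
rewrite e.
- by apply: eq_big_seq => j js; rewrite B'E.
- by move=> _ /mapP[j _ ->].
- by move=> i; apply: bigsetI_measurable.
Qed.

Section generated.
Variables (I : Type) (D : set I) (X : I -> T -> R).

Let G : set (set T) := \bigcup_(i in D) preimage_set_system setT (X i) measurable.

Lemma sigma_process_measurable_fun (i : I) : D i ->
  @measurable_fun _ _ (g_sigma_algebraType G) R setT (X i).
Proof.
move=> Di _ B mB; apply: sub_sigma_algebra; exists i => //.
by exists B.
Qed.

Lemma sigma_process_bigI (J : Type) (s : seq J) (Y : J -> T -> R) (B : J -> set R) :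
  (forall j, @measurable_fun _ _ (g_sigma_algebraType G) R setT (Y j)) ->
  (forall j, measurable (B j)) ->
  sigma_process D X (\big[setI/setT]_(j <- s) (Y j @^-1` B j)).
Proof.
move=> mY mB; rewrite /sigma_process -/G.
apply: (@bigsetI_measurable _ (g_sigma_algebraType G)) => j _.
by rewrite -[_ @^-1` _]setTI; apply: mY.
Qed.

End generated.

(** The event splits into a part in each of the two independent sigma-algebras; the family is then
    independent inside each part. *)
Lemma mutually_independent_sum (I J : finType) (A C : Type) (DA : set A) (DC : set C)
    (XA : A -> T -> R) (XC : C -> T -> R) (X : I + J -> T -> R) :
  independent_sigma P (sigma_process DA XA) (sigma_process DC XC) ->
  (forall i, @measurable_fun _ _
     (g_sigma_algebraType (\bigcup_(c in DC) preimage_set_system setT (XC c) measurable))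
     R setT (X (inl i))) ->
  (forall j, @measurable_fun _ _
     (g_sigma_algebraType (\bigcup_(a in DA) preimage_set_system setT (XA a) measurable))
     R setT (X (inr j))) ->
  mutually_independent P setT (fun i => X (inl i)) ->
  mutually_independent P setT (fun j => X (inr j)) ->
  mutually_independent P setT X.
Proof.
move=> ind mI mJ hI hJ s B us _ mB.
pose s1 := [seq i <- enum I | inl i \in s]; pose s2 := [seq j <- enum J | inr j \in s].
have u1 : uniq s1 by rewrite filter_uniq // enum_uniq.
have u2 : uniq s2 by rewrite filter_uniq // enum_uniq.
have ps : perm_eq s ([seq inl i | i <- s1] ++ [seq inr j | j <- s2]).
  apply: uniq_perm => //.
    rewrite cat_uniq !map_inj_uniq ?u1 ?u2 /= ?andbT; try by move=> ? ? [].
    by apply/hasPn => _ /mapP[j _ ->]; apply/mapP => -[].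
  case=> [i|j]; rewrite mem_cat.
    rewrite mem_map; last by move=> ? ? [].
    rewrite mem_filter mem_enum andbT.
    by case: (_ \in s) => //=; symmetry; apply/mapP => -[].
  rewrite orbC mem_map; last by move=> ? ? [].
  rewrite mem_filter mem_enum andbT.
  by case: (_ \in s) => //=; symmetry; apply/mapP => -[].
rewrite (perm_big _ ps) (perm_big _ ps) /= !big_cat !big_map /= setIC.
rewrite ind.
- by rewrite muleC hI // hJ.
- by apply: sigma_process_bigI.
- by apply: sigma_process_bigI.
Qed.

Lemma has_mean_nonneg (X : T -> R) (x : R) : measurable_fun setT X -> (forall w, 0 <= X w) ->
  (\int[P]_w (X w)%:E = x%:E)%E -> has_mean P X x.
Proof.
move=> mX X0 eX; split=> //; apply/integrableP; split; first exact/measurable_EFinP.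
under eq_integral do rewrite /= ger0_norm //.
by rewrite eX ltry.
Qed.

End independence_tools.

(** * Brownian increments over a grid together with the errors *)

Section noise_and_increments.
Context {d : measure_display} {T : measurableType d} {R : realType}.
Variable P : probability T R.
Variables (W : R -> {RV P >-> R}) (eps : nat -> nat -> {RV P >-> R}).
Hypothesis hW : standard_brownian_motion W.
Hypothesis heps : noise_array W eps.

Definition bm_increment (u : nat -> R) (j : nat) : {RV P >-> R} := W (u j.+1) \- W (u j).

(** The common fourth moment of the errors, read off from the first admissible row, n = 17. *)
Definition noise_kurtosis : R := fine (\int[P]_w (eps 17 1 w ^+ 4)%:E)%E.

Lemma noise_moments n i : (16 < n)%N -> (0 < i <= n)%N ->
  [/\ has_mean P (eps n i) 0, has_mean P (fun w => eps n i w ^+ 2) 1 &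
      has_mean P (fun w => eps n i w ^+ 4) noise_kurtosis].
Proof.
move=> n16 hi; have [_ _ hid hm] := heps.
have four0 (x : R) : 0 <= x ^+ 4 by rewrite -[4%N]/(2 * 2)%N exprM sqr_ge0.
have [m1 m2 m4] := hm n i n16 hi.
have [_ _ m4'] := hm 17%N 1%N isT isT.
move: m1 m2 m4 m4'; rewrite unlock => m1 m2 m4 m4'.
have h2 : has_mean P (fun w => eps n i w ^+ 2) 1.
  apply: has_mean_nonneg => //; first exact: measurable_funX.
  by move=> w; exact: sqr_ge0.
split => //.
  split=> //.
  have [i2 _] := has_meanD (has_mean_cst P 1) h2.
  apply: le_integrable i2 => //; first exact/measurable_EFinP.
  move=> w _ /=; rewrite lee_fin (@ger0_norm _ (1 + _)); last by rewrite addr_ge0 ?sqr_ge0.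
  have := sqr_ge0 (`|eps n i w| - 1); have := normr_ge0 (eps n i w).
  rewrite (_ : (`|eps n i w| - 1) ^+ 2 = `|eps n i w| ^+ 2 - 2 * `|eps n i w| + 1); last by ring.
  by rewrite real_normK ?num_real //; lra.
apply: has_mean_nonneg => //; first exact: measurable_funX.
have E (X : {RV P >-> R}) : (\int[P]_w (X w ^+ 4)%:E = \int[distribution P X]_x (x ^+ 4)%:E)%E.
  rewrite (@ge0_integral_distribution _ _ _ _ _ P X (fun x => (x ^+ 4)%:E)) //.
    by apply/measurable_EFinP; exact: exprn_measurable.
have -> : (\int[P]_w (eps n i w ^+ 4)%:E = \int[P]_w (eps 17 1 w ^+ 4)%:E)%E.
  rewrite !E; apply: eq_measure_integral => A mA _.
  exact: (hid n 17%N i 1%N n16 isT hi isT A mA).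
rewrite fineK // ge0_fin_numE //.
by apply: integral_ge0 => w _; rewrite lee_fin.
Qed.

Definition increment_kurtosis : R := 2 * 4 ^+ 4 * expR (1 / 2).

Variables (n k : nat) (u : nat -> R).
Hypothesis n16 : (16 < n)%N.
Hypothesis u0 : 0 <= u 0%N.
Hypothesis u1 : u k <= 1.
Hypothesis u_mono : forall j, (j < k)%N -> u j <= u j.+1.

Definition increments_noise (x : 'I_k + 'I_n) : {RV P >-> R} :=
  match x with inl j => bm_increment u j | inr i => eps n i.+1 end.

Definition increments_noise_var (x : 'I_k + 'I_n) : R :=
  match x with inl j => u j.+1 - u j | inr _ => 1 end.

Lemma grid_le i j : (i <= j <= k)%N -> u i <= u j.
Proof.
elim: j => [|j IH]; first by rewrite leqn0 => /andP[/eqP->].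
move=> /andP[ij jk]; move: ij; rewrite leq_eqVlt => /predU1P[->//|ij].
by apply: le_trans (u_mono jk); apply: IH; rewrite -ltnS ij ltnW.
Qed.

Lemma grid_itv j : (j <= k)%N -> 0 <= u j <= 1.
Proof.
move=> jk; rewrite (le_trans u0) ?grid_le ?jk //=.
by apply: le_trans u1; rewrite grid_le // jk leqnn.
Qed.

Lemma increments_noise_independent :
  mutually_independent P setT (fun x => increments_noise x : T -> R).
Proof.
have [_ hWi _ _] := hW; have [hei hind _ _] := heps.
apply: (mutually_independent_sum (hind n n16)).
- move=> j /=; apply: measurable_funB.
    apply: sigma_process_measurable_fun.
    by rewrite /= in_itv /= grid_itv.
  apply: sigma_process_measurable_fun.
  by rewrite /= in_itv /= grid_itv // ltnW.
- move=> i; apply: sigma_process_measurable_fun => /=; exact: ltn_ord.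
- apply: (@mutually_independent_inj _ _ _ P _ _ `I_k
    (fun j w => W (u j.+1) w - W (u j) w) (@nat_of_ord k)).
  + exact: ord_inj.
  + by move=> j; exact: ltn_ord.
  + exact: (hWi k u u0 u1 u_mono).
- apply: (@mutually_independent_inj _ _ _ P _ _ [set i | (1 <= i <= n)%N]
    (eps n) (fun i : 'I_n => i.+1)).
  + by move=> i j [] /ord_inj.
  + by move=> i /=; exact: ltn_ord.
  + exact: hei.
Qed.

Lemma increments_noise_moments :
  fourth_moments P (fun x => increments_noise x : T -> R) increments_noise_var
    (Num.max increment_kurtosis noise_kurtosis + 1).
Proof.
have [_ _ hWn _] := hW.
have ik0 : 0 <= increment_kurtosis by rewrite mulr_ge0 ?expR_ge0.
have v0 x : 0 <= increments_noise_var x.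
  by case: x => [j|//] /=; rewrite subr_ge0 u_mono.
have H x : [/\ has_mean P (increments_noise x) 0,
    has_mean P (fun w => increments_noise x w ^+ 2) (increments_noise_var x) &
    exists2 m, has_mean P (fun w => increments_noise x w ^+ 4) m &
      m <= Num.max increment_kurtosis noise_kurtosis * increments_noise_var x ^+ 2].
  case: x => [j|i]; last first.
    have [] := @noise_moments n i.+1 n16 (ltn_ord i) => m1 m2 m4; split=> //.
    by exists noise_kurtosis => //; rewrite /= expr1n mulr1 le_max lexx orbT.
  have jk := ltn_ord j; have /andP[a0 _] := grid_itv (ltnW jk); have /andP[_ b1] := grid_itv jk.
  (* Grid points may coincide; the increment is then 0, with variance 0. *)
  have := u_mono jk; rewrite le_eqVlt => /predU1P[e|lt].
    have Z w : increments_noise (inl j) w = 0 by rewrite /= -e subrr.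
    rewrite /increments_noise_var -e subrr; split.
    - by apply: eq_has_mean (has_mean_cst P 0) => w; rewrite Z.
    - by apply: eq_has_mean (has_mean_cst P 0) => w; rewrite Z expr0n.
    - exists 0; first by apply: eq_has_mean (has_mean_cst P 0) => w; rewrite Z expr0n.
      by rewrite expr0n mulr0.
  have s0 : 0 < Num.sqrt (u j.+1 - u j) by rewrite sqrtr_gt0 subr_gt0.
  have [] := @normal_mean _ _ _ P (bm_increment u j) _ s0.
    by move=> B mB; exact: hWn.
  rewrite sqr_sqrtr ?subr_ge0 ?(ltW lt) // => m1 m2 [m m4 mle]; split => //.
  exists m => //; apply: le_trans mle _.
  by rewrite ler_wpM2r ?sqr_ge0 // le_max lexx.
apply: fourth_moments_independent.
- exact: increments_noise_independent.
- by [].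
- by move=> x; have [] := H x.
- by move=> x; have [] := H x.
- by move=> x; have [] := H x.
- by rewrite le_max ik0.
Qed.

End noise_and_increments.

(** * Error of [s_hat] for grid data, and Model (II) *)

Section grid_observations.
Context {d : measure_display} {T : measurableType d} {R : realType}.
Variable P : probability T R.
Variables (W : R -> {RV P >-> R}) (eps : nat -> nat -> {RV P >-> R}).
Hypothesis hW : standard_brownian_motion W.
Hypothesis heps : noise_array W eps.
Local Notation I01 := (`[0%R, 1%R]%classic : set R).
Local Notation K4 := (Num.max (@increment_kurtosis R) (noise_kurtosis eps) + 1).

Definition target_const (M U K : R) : R := 2 * s_hat_const M U K K4 + 80 * M ^+ 2.

Variables (f : R -> R) (M U K : R) (t2 : R -> R) (n : nat).
Hypothesis n16 : (16 < n)%N.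
Hypothesis mf : measurable_fun I01 f.
Hypothesis f_bound : forall x, 0 <= x <= 1 -> 0 <= f x <= M.
Hypothesis t_bound : forall x, 0 <= x <= 1 -> 0 <= t2 x <= U.

Lemma node_itv l : (l <= n)%N -> 0 <= (l%:R / n%:R : R) <= 1.
Proof.
move=> ln; rewrite divr_ge0 //= ler_pdivrMr ?ltr0n ?(leq_trans _ n16) //.
by rewrite mul1r ler_nat.
Qed.

(** The common interface of both models: the signal is a linear combination of Brownian increments
    over an arbitrary grid [u], whose size does not enter the constant. *)
Lemma grid_s_hat_error (k kk : nat) (u : nat -> R) (beta : nat -> 'I_kk -> R) (Y : nat -> T -> R) :
  0 <= u 0%N -> u kk <= 1 -> (forall j, (j < kk)%N -> u j <= u j.+1) ->
  (forall j j', (0 < j < n)%N -> (0 < j' < n)%N ->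
    `|increment_cov beta (fun a => u a.+1 - u a) j j' -
      (j == j')%:R * cell_mean f n j| <= K / n%:R ^+ 2) ->
  (forall i w, (0 < i <= n)%N -> Y i w =
    \sum_a beta i a * bm_increment W u a w + Num.sqrt (t2 (i%:R / n%:R)) * eps n i w) ->
  k%:R ^+ 2 <= Num.sqrt (n%:R : R) ->
  (\int[P]_w ((s_hat n (Y^~ w) k - s_target f k) ^+ 2)%:E <=
    (target_const M U K / Num.sqrt n%:R)%:E)%E.
Proof.
move=> u0 u1 um hC hY kq.
have h4 := increments_noise_moments hW heps n16 u0 u1 um.
apply: (target_error n16 mf f_bound _ kq).
  apply: measurable_s_hat => // i hi.
  have -> : Y i = (fun w => \sum_a beta i a * bm_increment W u a w +
      Num.sqrt (t2 (i%:R / n%:R)) * eps n i w).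
    by apply/funext => w; apply: hY.
  apply: measurable_funD; last exact: measurable_funM.
  by apply: measurable_sum => a; apply: measurable_funM.
have := @s_hat_error _ _ _ P n k M U K K4 (fun l => t2 (l%:R / n%:R)) (cell_mean f n)
  'I_kk beta (fun a => u a.+1 - u a) (fun x => increments_noise W eps u x : T -> R) Y n16.
apply => //.
- by move=> l /andP[_ ln]; apply: t_bound; exact: node_itv.
- move=> j /andP[_ jn]; apply: (cell_mean_bound mf f_bound) => //; exact: leq_trans n16.
- by rewrite addr_ge0 // le_max /increment_kurtosis mulr_ge0 ?expR_ge0.
- by move=> i w hi hi'; rewrite (hY i.+1 w hi).
Qed.

(** Over the regular grid, sigma(i/n) W(i/n) has coefficients sigma(i/n) on the first i increments.
    Its i-th increment is sigma(i/n) times one Brownian increment plus O(1/n) times W at the next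
    node, by the Lipschitz assumption. *)
Lemma brownian_s_hat_error (k : nat) (L : R) (Y : nat -> T -> R) :
  (forall x y, 0 <= x <= 1 -> 0 <= y <= 1 -> `|f x - f y| <= L * `|x - y|) ->
  (forall x y, 0 <= x <= 1 -> 0 <= y <= 1 ->
    `|Num.sqrt (f x) - Num.sqrt (f y)| <= L * `|x - y|) ->
  K = L + 2 * Num.sqrt M * L + L ^+ 2 ->
  (forall i w, (0 < i <= n)%N -> Y i w =
    Num.sqrt (f (i%:R / n%:R)) * W (i%:R / n%:R) w + Num.sqrt (t2 (i%:R / n%:R)) * eps n i w) ->
  k%:R ^+ 2 <= Num.sqrt (n%:R : R) ->
  (\int[P]_w ((s_hat n (Y^~ w) k - s_target f k) ^+ 2)%:E <=
    (target_const M U K / Num.sqrt n%:R)%:E)%E.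
Proof.
move=> fL sL KE hY kq.
have n0 : (0 < n)%N by exact: leq_trans n16.
have nR0 : 0 < n%:R :> R by rewrite ltr0n.
pose x i : R := i%:R / n%:R.
pose sg i := Num.sqrt (f (x i)).
pose beta (i : nat) (a : 'I_n) : R := sg i * (a < i)%N%:R.
pose Y' i w := \sum_a beta i a * bm_increment W x a w + Num.sqrt (t2 (x i)) * eps n i w.
have L0 : 0 <= L.
  have := fL 1 0; rewrite !lexx ler01 subr0 normr1 mulr1 => /(_ erefl erefl).
  by apply: le_trans.
have H : (\int[P]_w ((s_hat n (Y'^~ w) k - s_target f k) ^+ 2)%:E <=
    (target_const M U K / Num.sqrt n%:R)%:E)%E.
  apply: (grid_s_hat_error (u := x) (beta := beta)) => //.
  - by rewrite /x mul0r.
  - by rewrite /x divff // gt_eqF.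
  - by move=> j _; rewrite /x ler_pM2r ?invr_gt0 // ler_nat.
  move=> j j' hj hj'.
  pose dl i := sg i.+1 - sg i.
  have bE i (a : 'I_n) : beta i.+1 a - beta i a = sg i * (nat_of_ord a == i)%:R + dl i * (a < i.+1)%N%:R.
    by rewrite /beta /dl ltnS leq_eqVlt; case: ltngtP => //= _; rewrite ?mulr0 ?mulr1 ?addr0 ?add0r ?subr0 ?subrr; ring.
  have [/andP[j0 jn] /andP[j0' jn']] := (hj, hj').
  have vE a : x a.+1 - x a = n%:R^-1 by rewrite /x -mulrBl -natrB // subSnn mul1r.
  have pickO i (hi : (i < n)%N) (F : 'I_n -> R) : \sum_a (nat_of_ord a == i)%:R * F a = F (Ordinal hi).
    rewrite (bigD1 (Ordinal hi)) //= eqxx mul1r big1 ?addr0 // => a.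
    by rewrite -val_eqE /= => /negPf ->; rewrite mul0r.
  (* Three corrections, each O(n^-2): node value against cell average, cross terms, and the product
     of two increments of sigma. *)
  have E : increment_cov beta (fun a : 'I_n => x a.+1 - x a) j j' - (j == j')%:R * cell_mean f n j =
     (j == j')%:R * (f (x j) / n%:R - cell_mean f n j) +
     (sg j * dl j' * (j < j'.+1)%N%:R + sg j' * dl j * (j' < j.+1)%N%:R) / n%:R +
     dl j * dl j' * (\sum_(a < n) (a < j.+1)%N%:R * (a < j'.+1)%N%:R) / n%:R.
    rewrite /increment_cov.
    transitivity (\sum_(a < n) ((nat_of_ord a == j)%:R * (sg j * sg j' * (nat_of_ord a == j')%:R +
         sg j * dl j' * (a < j'.+1)%N%:R) + (nat_of_ord a == j')%:R * (sg j' * dl j * (a < j.+1)%N%:R) +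
         dl j * dl j' * ((a < j.+1)%N%:R * (a < j'.+1)%N%:R)) / n%:R - (j == j')%:R * cell_mean f n j).
      congr (_ - _); apply: eq_bigr => a _; rewrite !bE vE; ring.
    rewrite -mulr_suml !big_split /= -mulr_sumr !pickO /=.
    rewrite (_ : sg j * sg j' * (j == j')%:R = (j == j')%:R * f (x j)); first by ring.
    case: eqVneq => [<-|_]; rewrite ?mulr0 ?mul0r // mulr1 mul1r -expr2 sqr_sqrtr //.
    by have /andP[] := f_bound (node_itv (ltnW jn)).
  have sgB i : (i <= n)%N -> `|sg i| <= Num.sqrt M.
    move=> hi; rewrite ger0_norm ?sqrtr_ge0 // ler_wsqrtr //.
    by have /andP[] := f_bound (node_itv hi).
  have dlB i : (i < n)%N -> `|dl i| <= L / n%:R.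
    move=> hi; apply: le_trans (sL _ _ (node_itv hi) (node_itv (ltnW hi))) _.
    by rewrite vE ger0_norm // invr_ge0.
  have bool1 (b : bool) : `|b%:R| <= 1 :> R by case: b; rewrite ?normr1 ?normr0.
  have h1 : `|(j == j')%:R * (f (x j) / n%:R - cell_mean f n j)| <= L / n%:R ^+ 2.
    rewrite normrM -[leRHS]mul1r; apply: ler_pM => //.
    exact: (cell_mean_lipschitz mf f_bound).
  have h2 i i' (b : bool) : (i < n)%N -> (i' < n)%N ->
      `|sg i * dl i' * b%:R| <= Num.sqrt M * L / n%:R.
    move=> hi hi'; rewrite normrM -[leRHS]mulr1; apply: ler_pM => //.
    rewrite normrM -mulrA; apply: ler_pM => //; [exact/sgB/ltnW|exact: dlB].
  have h3 : `|\sum_(a < n) (a < j.+1)%N%:R * (a < j'.+1)%N%:R| <= n%:R :> R.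
    apply: le_trans (ler_norm_sum _ _ _) _.
    have -> : n%:R = \sum_(a < n) 1 :> R by rewrite sumr_const card_ord.
    by apply: ler_sum => a _; rewrite -natrM mulnb.
  have h4 : `|dl j * dl j' * (\sum_(a < n) (a < j.+1)%N%:R * (a < j'.+1)%N%:R)| <=
       L / n%:R * (L / n%:R) * n%:R.
    by rewrite normrM; apply: ler_pM => //; rewrite normrM; apply: ler_pM => //; exact: dlB.
  rewrite E KE.
  have -> : (L + 2 * Num.sqrt M * L + L ^+ 2) / n%:R ^+ 2 = L / n%:R ^+ 2 +
      (Num.sqrt M * L / n%:R + Num.sqrt M * L / n%:R) / n%:R + L / n%:R * (L / n%:R) * n%:R / n%:R.
    by field; rewrite gt_eqF.
  apply: le_trans (ler_normD _ _) _; apply: lerD.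
    apply: le_trans (ler_normD _ _) _; apply: lerD => //.
    rewrite normrM (ger0_norm (_ : 0 <= n%:R^-1)) ?invr_ge0 // ler_wpM2r ?invr_ge0 //.
    by apply: le_trans (ler_normD _ _) _; apply: lerD; exact: h2.
  by rewrite normrM (ger0_norm (_ : 0 <= n%:R^-1)) ?invr_ge0 // ler_wpM2r ?invr_ge0.
apply: le_trans H; rewrite le_eqVlt; apply/orP; left; apply/eqP.
have [W0 _ _ _] := hW.
have mY' i : measurable_fun setT (Y' i).
  apply: measurable_funD; last exact: measurable_funM.
  by apply: measurable_sum => a; apply: measurable_funM.
have mY i : (1 <= i <= n)%N -> measurable_fun setT (Y i).
  move=> hi; have -> : Y i = (fun w => sg i * W (x i) w + Num.sqrt (t2 (x i)) * eps n i w).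
    by apply/funext => w; apply: hY.
  by apply: measurable_funD; exact: measurable_funM.
have mS (Z : nat -> T -> R) : (forall i, (1 <= i <= n)%N -> measurable_fun setT (Z i)) ->
    measurable_fun setT (fun w => ((s_hat n (Z^~ w) k - s_target f k) ^+ 2)%:E).
  move=> mZ; apply/measurable_EFinP; apply: measurable_funX; apply: measurable_funB => //.
  exact: measurable_s_hat.
apply: ge0_ae_eq_integral => //.
- exact: mS.
- exact: mS.
- by move=> w _; rewrite lee_fin sqr_ge0.
- by move=> w _; rewrite lee_fin sqr_ge0.
(* W starts at 0 only almost surely, so [Y] and its expression [Y'] through increments are compared
   outside a null set. *)
apply: filterS W0 => w W0 _; congr ((_ - _) ^+ 2)%:E.
have YY i : (0 < i <= n)%N -> Y i w = Y' i w.
  move=> hi; rewrite hY // /Y'; congr (_ + _).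
  have ni : (i <= n)%N by case/andP: hi.
  transitivity (sg i * \sum_(0 <= a < i) (W (x a.+1) w - W (x a) w)).
    rewrite telescope_sumr // (_ : x 0%N = 0) ?W0 ?subr0 //.
    by rewrite /x mul0r.
  rewrite mulr_sumr /beta big_mkord.
  rewrite (big_ord_widen n (fun a => sg i * (W (x a.+1) w - W (x a) w))) // big_mkcond /=.
  by apply: eq_bigr => a _; case: ifP => _; rewrite ?mulr1 ?mulr0 ?mul0r.
have sE Z Z' : (forall i, (0 < i <= n)%N -> Z i = Z' i) -> s_hat n Z k = s_hat n Z' k :> R.
  move=> ZZ; rewrite /s_hat /t_hat; suff -> : increments n Z k = increments n Z' k by [].
  apply/matrixP => i j; rewrite !mxE.
  have := ltn_ord i; rewrite -ltnS prednK // => hi.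
  by rewrite !ZZ // ?(ltnW hi).
exact: sE.
Qed.

End grid_observations.

(** * Step functions over a common grid *)

Section step_functions.
Context {R : realType}.
Local Notation I01 := (`[0%R, 1%R]%classic : set R).

Definition valid_step (p : R * R * R) : Prop := [/\ 0 <= p.1.1, p.1.1 <= p.1.2 & p.1.2 <= 1].

(** The grid is the sorted list of all endpoints. The telescoping identity is stated for every [F],
    to serve both for paths of W and for indicators. *)
Lemma common_grid (r : seq (R * R * R)) : (forall p, p \in r -> valid_step p) ->
  exists (kk : nat) (u : nat -> R) (b : R * R * R -> nat -> R),
    [/\ 0 <= u 0%N, u kk <= 1, forall j, (j < kk)%N -> u j <= u j.+1 &
      forall p (F : R -> R), p \in r ->
        F p.1.2 - F p.1.1 = \sum_(a < kk) b p a * (F (u a.+1) - F (u a))].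
Proof.
move=> vr.
(* The extra 0 keeps the list nonempty. *)
pose t := sort <=%R (0 :: ([seq p.1.1 | p <- r] ++ [seq p.1.2 | p <- r])).
have st : sorted <=%R t by exact: sort_le_sorted.
have mt y : y \in t = (y \in 0 :: ([seq p.1.1 | p <- r] ++ [seq p.1.2 | p <- r])).
  by rewrite mem_sort.
have t01 y : y \in t -> 0 <= y <= 1.
  rewrite mt inE mem_cat => /orP[/eqP->|/orP[]/mapP[p pr ->]].
  - by rewrite lexx ler01.
  - by have [h1 h2 h3] := vr p pr; rewrite h1 (le_trans h2 h3).
  - by have [h1 h2 h3] := vr p pr; rewrite h3 (le_trans h1 h2).
have szt : (0 < size t)%N by rewrite size_sort.
pose kk := (size t).-1; pose u j := nth 0 t j.
have kkE : kk.+1 = size t by rewrite /kk prednK.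
have uin j : (j <= kk)%N -> u j \in t by move=> jk; rewrite mem_nth // -kkE.
have um i j : (i <= j)%N -> (j <= kk)%N -> u i <= u j.
  move=> ij jk; rewrite /u; apply: (sorted_leq_nth le_trans (@lexx _ _) 0 st) => //.
    by rewrite inE -kkE ltnS (leq_trans ij).
  by rewrite inE -kkE ltnS.
exists kk, u, (fun p a => (index p.1.1 t <= a < index p.1.2 t)%N%:R); split.
- by have /andP[] := t01 _ (uin 0%N isT).
- by have /andP[] := t01 _ (uin kk (leqnn _)).
- by move=> j jk; exact: um.
move=> p F pr; have [h1 h2 h3] := vr p pr.
have in1 : p.1.1 \in t.
  rewrite mt inE mem_cat; apply/orP; right; apply/orP; left.
  exact: (map_f (fun q : R * R * R => q.1.1) pr).
have in2 : p.1.2 \in t.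
  rewrite mt inE mem_cat; apply/orP; right; apply/orP; right.
  exact: (map_f (fun q : R * R * R => q.1.2) pr).
have e1 : u (index p.1.1 t) = p.1.1 by rewrite /u nth_index.
have e2 : u (index p.1.2 t) = p.1.2 by rewrite /u nth_index.
have k2 : (index p.1.2 t <= kk)%N by rewrite -ltnS kkE index_mem.
have k1 : (index p.1.1 t <= kk)%N by rewrite -ltnS kkE index_mem.
have i12 : (index p.1.1 t <= index p.1.2 t)%N.
  rewrite leqNgt; apply/negP => h; have := um _ _ (ltnW h) k1; rewrite e1 e2 => h'.
  have e : p.1.1 = p.1.2 by apply/eqP; rewrite eq_le h2 h'.
  by move: h; rewrite e ltnn.
rewrite -{1}e1 -{1}e2 -(telescope_sumr (fun a => F (u a)) i12).
rewrite (big_nat_widen _ _ _ _ _ k2) (big_nat_widenl _ 0) // big_mkord big_mkcond /=.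
by apply: eq_bigr => a _; rewrite andbC; case: (_ && _); rewrite ?mul1r ?mul0r.
Qed.

Lemma measurable_step_fun (s : seq (R * R * R)) : measurable_fun I01 (step_fun s).
Proof.
by rewrite /step_fun; apply: measurable_sum => p; apply: measurable_funM.
Qed.

Lemma step_fun_bounded (s : seq (R * R * R)) x : `|step_fun s x| <= \sum_(p <- s) `|p.2|.
Proof.
apply: le_trans (ler_norm_sum _ _ _) _; apply: ler_sum => p _.
by rewrite normrM -[leRHS]mulr1 ler_wpM2l //; exact: itv_ind_le1.
Qed.

Section grid.
Variables (kk : nat) (u : nat -> R) (b : R * R * R -> nat -> R) (r : seq (R * R * R)).
Hypothesis u0 : 0 <= u 0%N.
Hypothesis u1 : u kk <= 1.
Hypothesis u_mono : forall j, (j < kk)%N -> u j <= u j.+1.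
Hypothesis rv : forall p, p \in r -> valid_step p.
Hypothesis hb : forall p (F : R -> R), p \in r ->
  F p.1.2 - F p.1.1 = \sum_(a < kk) b p a * (F (u a.+1) - F (u a)).

Definition step_coef (s : seq (R * R * R)) (a : 'I_kk) : R := \sum_(p <- s) p.2 * b p a.

Lemma step_gridE (s : seq (R * R * R)) (F : R -> R) : {subset s <= r} ->
  \sum_(p <- s) p.2 * (F p.1.2 - F p.1.1) =
  \sum_a step_coef s a * (F (u a.+1) - F (u a)).
Proof.
move=> sr; under [RHS]eq_bigr do rewrite /step_coef mulr_suml.
rewrite exchange_big /=; apply: eq_big_seq => p ps.
by rewrite (hb F (sr p ps)) mulr_sumr; apply: eq_bigr => a _; rewrite mulrA.
Qed.

(** Writes the indicator as an increment in the endpoint, so that the telescoping identity of the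
    grid applies to step functions too. *)
Lemma itv_ind_diff (a c x : R) : a <= c -> itv_ind a c x = - (c < x)%R%:R - - (a < x)%R%:R.
Proof.
move=> ac; rewrite itv_indE opprK addrC; case: (ltP c x) => cx.
  by rewrite (le_lt_trans ac cx) subrr andbF.
by rewrite andbT subr0.
Qed.

Lemma step_fun_gridE (s : seq (R * R * R)) x : {subset s <= r} ->
  step_fun s x = \sum_a step_coef s a * itv_ind (u a) (u a.+1) x.
Proof.
move=> sr; transitivity (\sum_a step_coef s a * (- (u a.+1 < x)%R%:R - - (u a < x)%R%:R)).
  rewrite -(step_gridE (fun y => - (y < x)%R%:R) sr); apply: eq_big_seq => p ps.
  by have [_ h _] := rv (sr p ps); congr (_ * _); exact: itv_ind_diff.
by apply: eq_bigr => a _; rewrite itv_ind_diff ?u_mono.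
Qed.

Lemma step_grid_le i j : (i <= j <= kk)%N -> u i <= u j.
Proof.
elim: j => [|j IH]; first by rewrite leqn0 => /andP[/eqP->].
move=> /andP[ij jk]; move: ij; rewrite leq_eqVlt => /predU1P[->//|ij].
by apply: le_trans (u_mono jk); apply: IH; rewrite -ltnS ij ltnW.
Qed.

(** The isometry on the grid: the right-hand side is also the covariance of the two step integrals.
    Grid intervals are disjoint, so only the diagonal survives. *)
Lemma has_int01_step_prod (s s' : seq (R * R * R)) : {subset s <= r} -> {subset s' <= r} ->
  has_int01 (fun x => step_fun s x * step_fun s' x)
    (\sum_a step_coef s a * step_coef s' a * (u a.+1 - u a)).
Proof.
move=> sr sr'.
have h (a : 'I_kk) : has_int01 (itv_ind (u a) (u a.+1)) (u a.+1 - u a).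
  apply: has_int01_itv_ind.
  - by apply: le_trans u0 _; apply: step_grid_le; rewrite /= ltnW.
  - exact: u_mono.
  - by apply: le_trans u1; apply: step_grid_le; rewrite leqnn andbT.
have := has_integral_sum measurable01 (index_enum 'I_kk)
  (fun a : 'I_kk => has_integralZ measurable01 (step_coef s a * step_coef s' a) (h a)).
apply: eq_has_integral => // x _.
rewrite !step_fun_gridE // mulr_suml; apply: eq_bigr => a _.
rewrite mulr_sumr (bigD1 a) //= big1 ?addr0.
  by rewrite itv_indE; case: (_ && _); rewrite /=; ring.
move=> c ca; rewrite !itv_indE.
case: (boolP (_ && _)) => [/andP[h1 h2]|_]; last by rewrite mulr0 mul0r.
case: (boolP (_ && _)) => [/andP[h3 h4]|_]; last by rewrite !mulr0.
move: ca; rewrite -val_eqE neq_ltn /= => /orP[] lt.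
  have h5 : u c.+1 <= u a by apply: step_grid_le; rewrite lt ltnW.
  by have := lt_le_trans h1 (le_trans h4 h5); rewrite ltxx.
have h5 : u a.+1 <= u c by apply: step_grid_le; rewrite lt ltnW.
by have := lt_le_trans h3 (le_trans h2 h5); rewrite ltxx.
Qed.

End grid.

(** h h' - g g' is a product of differences plus two terms linear in a difference; AM-GM with the
    free weight [z] handles the latter. *)
Lemma has_int01_prod_close (h h' g g' : R -> R) (x y e e' M z : R) : 0 < z ->
  has_int01 (fun t => h t * h' t) x -> has_int01 (fun t => g t * g' t) y ->
  has_int01 (fun t => (h t - g t) ^+ 2) e -> has_int01 (fun t => (h' t - g' t) ^+ 2) e' ->
  (forall t, 0 <= t <= 1 -> g t ^+ 2 <= M) -> (forall t, 0 <= t <= 1 -> g' t ^+ 2 <= M) ->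
  `|x - y| <= (1 + z^-1) / 2 * (e + e') + z * M.
Proof.
move=> z0 hx hy he he' gM gM'.
have hd := has_integralB measurable01 hx hy.
have hb := has_integralD measurable01
  (has_integralZ measurable01 ((1 + z^-1) / 2) (has_integralD measurable01 he he'))
  (has_int01_cst (z * M)).
have D t : 0 <= t <= 1 -> `|h t * h' t - g t * g' t| <=
    (1 + z^-1) / 2 * ((h t - g t) ^+ 2 + (h' t - g' t) ^+ 2) + z * M.
  move=> t01; have := gM t t01; have := gM' t t01.
  have -> : h t * h' t - g t * g' t = (h t - g t) * (h' t - g' t) + g t * (h' t - g' t) +
     g' t * (h t - g t) by ring.
  move: (g t) (g' t) (h t - g t) (h' t - g' t) => a a' b b' aM aM'.
  have amgm (p q w : R) : 0 < w -> `|p * q| <= (w * p ^+ 2 + w^-1 * q ^+ 2) / 2.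
    move=> w0; rewrite normrM -[p ^+ 2](real_normK (num_real p)) -[q ^+ 2](real_normK (num_real q)).
    have := sqr_ge0 (`|p| - w^-1 * `|q|); move: (`|p|) (`|q|) => p1 q1 hh.
    have : 0 <= w * (p1 - w^-1 * q1) ^+ 2 by rewrite mulr_ge0 // ltW.
    have -> : w * (p1 - w^-1 * q1) ^+ 2 = w * p1 ^+ 2 + w^-1 * q1 ^+ 2 - 2 * (p1 * q1).
      by field; rewrite gt_eqF.
    lra.
  have h1 := amgm b b' 1 ltr01; have h2 := amgm a b' z z0; have h3 := amgm a' b z z0.
  rewrite invr1 !mul1r in h1.
  have h4 : z * a ^+ 2 <= z * M by rewrite ler_pM2l.
  have h5 : z * a' ^+ 2 <= z * M by rewrite ler_pM2l.
  have := ler_normD (b * b' + a * b') (a' * b); have := ler_normD (b * b') (a * b').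
  lra.
rewrite ler_norml; apply/andP; split.
  rewrite -subr_ge0 opprK.
  apply: (le_has_integral measurable01 _ (has_int01_cst 0) (has_integralD measurable01 hd hb)).
  move=> t /=; rewrite in_itv /= => /D; rewrite ler_norml => /andP[]; lra.
apply: (le_has_integral measurable01 _ hd hb) => t /=.
by rewrite in_itv /= => /D; rewrite ler_norml => /andP[].
Qed.

End step_functions.

(** * Covariances of the approximating step integrals *)

Section step_covariance.
Context {R : realType}.
Local Notation I01 := (`[0%R, 1%R]%classic : set R).
Variables (f : R -> R) (M : R) (n : nat).
Hypothesis mf : measurable_fun I01 f.
Hypothesis f_bound : forall x, 0 <= x <= 1 -> 0 <= f x <= M.
Hypothesis n0 : (0 < n)%N.

(** The integrand sigma cut off at [t], considered over the whole of [0, 1]. *)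
Definition root_upto (t x : R) : R := Num.sqrt (f x) * itv_ind 0 t x.

Lemma measurable_root_upto t : measurable_fun I01 (root_upto t).
Proof.
apply: measurable_funM; last exact: measurable_itv_ind.
by apply: measurableT_comp mf; exact: continuous_measurable_fun (@sqrt_continuous R).
Qed.

Lemma root_upto_sqr_le t x : 0 <= x <= 1 -> root_upto t x ^+ 2 <= M.
Proof.
move=> x01; have /andP[f0 fM] := f_bound x01.
rewrite /root_upto exprMn sqr_sqrtr // itv_indE; case: (_ && _).
  by rewrite expr1n mulr1.
by rewrite expr0n mulr0; exact: le_trans fM.
Qed.

Definition step_dist (s : seq (R * R * R)) (t : R) : R :=
  int01 (fun x => (step_fun s x - root_upto t x) ^+ 2).

Let M0 : 0 <= M.
Proof. by have := @f_bound 1; rewrite ler01 lexx => /(_ isT) /andP[]; exact: le_trans. Qed.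

Lemma has_int01_step_dist s t :
  has_int01 (fun x => (step_fun s x - root_upto t x) ^+ 2) (step_dist s t).
Proof.
pose B := \sum_(p <- s) `|p.2| + Num.sqrt M.
apply: (@has_int01_bounded _ _ (B ^+ 2)).
  apply: measurable_funX; apply: measurable_funB; first exact: measurable_step_fun.
  exact: measurable_root_upto.
move=> x x01; rewrite normrX ler_sqr ?nnegrE //; last first.
  by rewrite addr_ge0 ?sqrtr_ge0 // sumr_ge0.
apply: le_trans (ler_normB _ _) _; apply: lerD; first exact: step_fun_bounded.
by rewrite -sqrtr_sqr ler_wsqrtr // root_upto_sqr_le.
Qed.

Let nR0 : 0 < n%:R :> R. Proof. by rewrite ltr0n. Qed.

Lemma root_upto_diff j x : root_upto (j.+1%:R / n%:R) x - root_upto (j%:R / n%:R) x =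
  Num.sqrt (f x) * cell n j x.
Proof.
rewrite /root_upto -mulrBr /cell; congr (_ * _).
have h : j%:R / n%:R <= j.+1%:R / n%:R :> R by rewrite ler_pM2r ?invr_gt0 // ler_nat.
have h0 : 0 <= j%:R / n%:R :> R by rewrite divr_ge0.
have h1 : 0 <= j.+1%:R / n%:R :> R by rewrite divr_ge0.
by rewrite !itv_ind_diff //; ring.
Qed.

(** Chosen so that both terms of [has_int01_prod_close] are at most 1 / (2 n^2) in [step_grid]. *)
Definition closeness : R :=
  let z := (2 * n%:R ^+ 2 * (M + 1))^-1 in (8 * (1 + z^-1) * n%:R ^+ 2)^-1.

Lemma closeness_gt0 : 0 < closeness.
Proof.
have h : 0 < n%:R ^+ 2 :> R by rewrite exprn_gt0.
have h2 : 0 <= 2 * n%:R ^+ 2 * (M + 1) by rewrite mulr_ge0 ?mulr_ge0 ?addr_ge0 // ltW.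
by rewrite invr_gt0 mulr_gt0 // mulr_gt0 // invrK; lra.
Qed.

(** One grid refines the steps of all nodes. The exact integrands of the increments, sigma on cell
    j, have products integrating to [cell_mean] on the diagonal and to 0 off it; closeness in L^2
    transfers this to the steps. *)
Lemma step_grid (s : nat -> seq (R * R * R)) :
  (forall i p, (0 < i <= n)%N -> p \in s i -> valid_step p) ->
  (forall i, (0 < i <= n)%N -> step_dist (s i) (i%:R / n%:R) <= closeness) ->
  exists (kk : nat) (u : nat -> R) (beta : nat -> 'I_kk -> R),
    [/\ 0 <= u 0%N, u kk <= 1, forall j, (j < kk)%N -> u j <= u j.+1,
      forall i (F : R -> R), (0 < i <= n)%N ->
        \sum_(p <- s i) p.2 * (F p.1.2 - F p.1.1) =
        \sum_a beta i a * (F (u a.+1) - F (u a)) &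
      forall j j', (0 < j < n)%N -> (0 < j' < n)%N ->
        `|increment_cov beta (fun a => u a.+1 - u a) j j' - (j == j')%:R * cell_mean f n j| <=
        1 / n%:R ^+ 2].
Proof.
move=> vs cs.
pose r := flatten [seq s i | i <- index_iota 1 n.+1].
have sr i : (0 < i <= n)%N -> {subset s i <= r}.
  move=> hi p ps; apply/flattenP; exists (s i) => //.
  by apply: map_f; rewrite mem_index_iota ltnS.
have vr p : p \in r -> valid_step p.
  by move=> /flattenP[l /mapP[i]]; rewrite mem_index_iota ltnS => hi ->; exact: vs.
have [kk [u [b [u0 u1 um hb]]]] := common_grid vr.
pose beta i := @step_coef R kk b (s i).
exists kk, u, beta; split=> //.
  by move=> i F hi; apply: (step_gridE hb); exact: sr.
move=> j j' hj hj'.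
have hS i : (0 < i < n)%N -> (0 < i.+1 <= n)%N by case/andP.
have hL i : (0 < i < n)%N -> (0 < i <= n)%N by case/andP=> -> /ltnW.
pose h i x := step_fun (s i.+1) x - step_fun (s i) x.
pose g i x := Num.sqrt (f x) * cell n i x.
have P2 i i' : (0 < i <= n)%N -> (0 < i' <= n)%N ->
    has_int01 (fun x => step_fun (s i) x * step_fun (s i') x)
    (\sum_a beta i a * beta i' a * (u a.+1 - u a)).
  by move=> hi hi'; apply: (has_int01_step_prod u0 u1 um vr hb); exact: sr.
have Hh : has_int01 (fun x => h j x * h j' x) (increment_cov beta (fun a => u a.+1 - u a) j j').
  have := has_integralB measurable01
    (has_integralB measurable01 (P2 j.+1 j'.+1 (hS _ hj) (hS _ hj')) (P2 j.+1 j' (hS _ hj) (hL _ hj')))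
    (has_integralB measurable01 (P2 j j'.+1 (hL _ hj) (hS _ hj')) (P2 j j' (hL _ hj) (hL _ hj'))).
  rewrite -!sumrB (_ : \sum_(i < kk) _ = increment_cov beta (fun a => u a.+1 - u a) j j').
    by apply: eq_has_integral => // x _; rewrite /h; ring.
  by apply: eq_bigr => a _; ring.
have Hg : has_int01 (fun x => g j x * g j' x) ((j == j')%:R * cell_mean f n j).
  case: eqVneq => [<-|jj].
    rewrite mul1r; apply: eq_has_integral (has_int01_cell_mean mf f_bound n j) => // x /=.
    rewrite in_itv /= => /f_bound /andP[f0 _].
    rewrite /g mulrACA -expr2 sqr_sqrtr //; congr (_ * _).
    by rewrite /cell itv_indE; case: (_ && _); rewrite ?mulr1 ?mulr0.
  rewrite mul0r; apply: eq_has_integral (has_int01_cst 0) => // x _.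
  rewrite /g mulrACA; symmetry; apply/eqP; rewrite mulf_eq0; apply/orP; right.
  rewrite /cell !itv_indE.
  case: (boolP (_ && _)) => [/andP[h1 h2]|_]; last by rewrite mul0r.
  case: (boolP (_ && _)) => [/andP[h3 h4]|_]; last by rewrite mulr0.
  move: (lt_le_trans h1 h4) (lt_le_trans h3 h2).
  rewrite !ltr_pM2r ?invr_gt0 // !ltr_nat !ltnS => h5 h6.
  by move: jj; rewrite eqn_leq h5 h6.
(* The increment involves two approximations, and (a - b)^2 <= 2 a^2 + 2 b^2. *)
have Hd i : (0 < i < n)%N -> exists2 e, has_int01 (fun x => (h i x - g i x) ^+ 2) e & e <= 4 * closeness.
  move=> hi; have m : measurable_fun I01 (fun x => h i x - g i x).
    apply: measurable_funB; first by apply: measurable_funB; exact: measurable_step_fun.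
    apply: measurable_funM; last exact: measurable_itv_ind.
    by apply: measurableT_comp mf; exact: continuous_measurable_fun (@sqrt_continuous R).
  have e1 := has_int01_step_dist (s i.+1) (i.+1%:R / n%:R).
  have e2 := has_int01_step_dist (s i) (i%:R / n%:R).
  have e := has_integralD measurable01 (has_integralZ measurable01 2 e1) (has_integralZ measurable01 2 e2).
  have D x : (h i x - g i x) ^+ 2 <= 2 * (step_fun (s i.+1) x - root_upto (i.+1%:R / n%:R) x) ^+ 2 +
     2 * (step_fun (s i) x - root_upto (i%:R / n%:R) x) ^+ 2.
    rewrite /g -root_upto_diff /h.
    have := sqr_ge0 ((step_fun (s i.+1) x - root_upto (i.+1%:R / n%:R) x) +
      (step_fun (s i) x - root_upto (i%:R / n%:R) x)).
    lra.
  pose B := 2 * (\sum_(p <- s i.+1) `|p.2| + Num.sqrt M) ^+ 2 +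
     2 * (\sum_(p <- s i) `|p.2| + Num.sqrt M) ^+ 2.
  have Hi : has_int01 (fun x => (h i x - g i x) ^+ 2) (int01 (fun x => (h i x - g i x) ^+ 2)).
    apply: (@has_int01_bounded _ _ B); first exact: measurable_funX.
    move=> x x01; rewrite ger0_norm ?sqr_ge0 //; apply: le_trans (D x) _.
    have b1 s' t : (step_fun s' x - root_upto t x) ^+ 2 <= (\sum_(p <- s') `|p.2| + Num.sqrt M) ^+ 2.
      apply: sqr_le_of_norm; apply: le_trans (ler_normB _ _) _.
      apply: lerD; first exact: step_fun_bounded.
      by rewrite -sqrtr_sqr ler_wsqrtr // root_upto_sqr_le.
    by apply: lerD; rewrite ler_pM2l //; exact: b1.
  exists (int01 (fun x => (h i x - g i x) ^+ 2)) => //.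
  apply: le_trans (le_has_integral measurable01 (fun x _ => D x) Hi e) _.
  have := cs _ (hS _ hi); have := cs _ (hL _ hi); lra.
have [e he eB] := Hd j hj; have [e' he' eB'] := Hd j' hj'.
pose z : R := (2 * n%:R ^+ 2 * (M + 1))^-1.
have nn : 0 < n%:R ^+ 2 :> R by rewrite exprn_gt0.
have M1 : 0 < M + 1 by have := M0; lra.
have z0 : 0 < z by rewrite invr_gt0 mulr_gt0 // mulr_gt0.
have gM i x : 0 <= x <= 1 -> g i x ^+ 2 <= M.
  move=> x01; have /andP[f0 fM] := f_bound x01.
  rewrite /g exprMn sqr_sqrtr // /cell itv_indE; case: (_ && _).
    by rewrite expr1n mulr1.
  by rewrite expr0n mulr0.
apply: le_trans (has_int01_prod_close z0 Hh Hg he he' (gM j) (gM j')) _.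
have zM : z * M <= (2 * n%:R ^+ 2)^-1.
  rewrite /z invfM -mulrA ler_piMr ?invr_ge0 ?mulr_ge0 ?(ltW nn) //.
  by rewrite ler_pdivrMl //; lra.
have cE : closeness = (8 * (1 + z^-1) * n%:R ^+ 2)^-1 by [].
have z1 : 0 < 1 + z^-1 by rewrite addr_gt0 // invr_gt0.
have h1 : (1 + z^-1) / 2 * (e + e') <= (1 + z^-1) / 2 * (8 * closeness).
  by rewrite ler_pM2l ?divr_gt0 //; lra.
have h2 : (1 + z^-1) / 2 * (8 * closeness) = (2 * n%:R ^+ 2)^-1.
  by rewrite cE; move: (1 + z^-1) z1 => y y0; field; rewrite !gt_eqF.
have -> : 1 / n%:R ^+ 2 = (2 * n%:R ^+ 2)^-1 + (2 * n%:R ^+ 2)^-1 :> R by field; rewrite gt_eqF.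
by apply: lerD => //; rewrite -h2.
Qed.

End step_covariance.

(** * Passage to almost sure limits *)

Section almost_sure_limits.
Context {d : measure_display} {T : measurableType d} {R : realType}.
Variable P : probability T R.

(** Fatou's lemma off the null set where convergence may fail. *)
Lemma fatou_le (f : nat -> T -> R) (g : T -> R) (C : \bar R) :
  (forall l, measurable_fun setT (f l)) -> measurable_fun setT g ->
  (forall l w, 0 <= f l w) -> (forall w, 0 <= g w) ->
  {ae P, forall w, f^~ w @ \oo --> g w} ->
  (forall l, (\int[P]_w (f l w)%:E <= C)%E) -> (\int[P]_w (g w)%:E <= C)%E.
Proof.
move=> mf mg f0 g0 [N [mN N0 fN]] fC.
have mfE l : measurable_fun setT (fun w => (f l w)%:E) by exact/measurable_EFinP.
have mgE : measurable_fun setT (fun w => (g w)%:E) by exact/measurable_EFinP.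
have C' l : (\int[P]_(w in setT `\` N) (f l w)%:E <= C)%E.
  rewrite -ge0_negligible_integral //.
  by move=> w _; rewrite lee_fin.
have mD : measurable (setT `\` N) by exact: measurableD.
rewrite (ge0_negligible_integral mN) //; last by move=> w _; rewrite lee_fin.
apply: (@le_trans _ _ (\int[P]_(w in setT `\` N) limn_einf (fun l => (f l w)%:E))%E).
  rewrite le_eqVlt; apply/orP; left; apply/eqP; apply: eq_integral => w /[!inE] -[_ Nw].
  have h : f^~ w @ \oo --> g w by apply: contrapT => h; exact/Nw/fN.
  symmetry; apply: (cvg_limn_einf_sup _).1.
  by apply/cvg_EFin; [apply: nearW|].
apply: le_trans (fatou P mD _ _) _.
- by move=> l; apply: measurable_funS (mfE l).
- by move=> l w _; rewrite lee_fin.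
rewrite limn_einf_lim; apply: lime_le; first exact: is_cvg_einfs.
apply: nearW => l; apply: le_trans (C' l).
by apply: ereal_inf_lbound; exists l => /=.
Qed.

Lemma ae_cvg0 (Z : nat -> T -> R) :
  (forall l, measurable_fun setT (Z l)) -> (forall l w, 0 <= Z l w) ->
  (forall l, (\int[P]_w (Z l w)%:E <= ((2^-1) ^+ l)%:E)%E) ->
  {ae P, forall w, Z^~ w @ \oo --> (0 : R)}.
Proof.
move=> mZ Z0 ZI.
have mZE l : measurable_fun setT (fun w => (Z l w)%:E) by exact/measurable_EFinP.
have ZE0 l w : (0 <= (Z l w)%:E)%E by rewrite lee_fin.
pose S w := (\sum_(0 <= l <oo) (Z l w)%:E)%E.
have S0 w : (0 <= S w)%E by apply: nneseries_ge0.
have iS : P.-integrable setT S.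
  apply/integrableP; split.
    exact: (@ge0_emeasurable_sum _ _ _ _ (fun l w => (Z l w)%:E) xpredT).
  under eq_integral do rewrite gee0_abs //.
  rewrite integral_nneseries //.
  apply: (@le_lt_trans _ _ 2%:E); last exact: ltry.
  apply: lime_le; first by apply: is_cvg_nneseries => l _ _; apply: integral_ge0.
  apply: nearW => L; apply: (@le_trans _ _ (\sum_(0 <= l < L) ((2^-1) ^+ l)%:E)%E).
    by apply: lee_sum => l _.
  rewrite sumEFin lee_fin.
  have H : \sum_(0 <= l < L) (2^-1) ^+ l = 2 - 2 * (2^-1) ^+ L :> R.
    elim: L => [|L IH]; first by rewrite big_geq // expr0 mulr1 subrr.
    by rewrite big_nat_recr //= IH exprS; lra.
  by rewrite H gerBl mulr_ge0 // exprn_ge0 // invr_ge0.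
have := integrable_ae measurableT iS; apply: filterS => w /(_ I) Sfin.
have h : (\sum_(L <= l <oo) (Z l w)%:E)%E @[L --> \oo] --> 0%E.
  apply: (@nneseries_tail_cvg R (fun l => (Z l w)%:E) xpredT) => //.
  by rewrite -ge0_fin_numE //; exact: S0.
have : (Z l w)%:E @[l --> \oo] --> 0%:E.
  apply: squeeze_cvge (cvg_cst 0%E) h; apply: nearW => l.
  rewrite ZE0 /=; have := @nneseries_lim_ge R (fun l => (Z l w)%:E) xpredT l l.+1.
  by rewrite big_nat1; apply => ? _ _.
by move/fine_cvg.
Qed.

Lemma cvg_sum_seq (I : Type) (r : seq I) (p : pred I) (F : I -> nat -> R) (a : I -> R) :
  (forall i, p i -> F i @ \oo --> a i) ->
  (fun l => \sum_(i <- r | p i) F i l) @ \oo --> \sum_(i <- r | p i) a i.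
Proof. by move=> h; apply: cvg_big => //; exact: add_continuous. Qed.

Lemma cvg_s_hat (n k : nat) (y : nat -> nat -> R) (z : nat -> R) : (16 < n)%N ->
  (forall i, (0 < i <= n)%N -> y^~ i @ \oo --> z i) ->
  (fun l => s_hat n (y l) k) @ \oo --> s_hat n z k.
Proof.
move=> n16 yz.
have hS i : (fun l => spectral_stat n k (y l) i) @ \oo --> spectral_stat n k z i.
  rewrite /spectral_stat [X in _ --> X]big_nat.
  under [X in X @ _]eq_fun do rewrite big_nat.
  apply: cvg_sum_seq => j /andP[j1 jn]; apply: cvgM; first exact: cvg_cst.
  apply: cvgM; first exact: cvg_cst.
  by apply: cvgB; apply: yz; rewrite ?j1 ?jn //= ltnW.
rewrite s_hatE //; under [X in X @ _]eq_fun do rewrite s_hatE //.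
apply: cvgB; last apply: cvgM; first [exact: cvg_cst|idtac].
  apply: cvg_sum_seq => i _; apply: cvgM; first exact: cvg_cst.
  by rewrite expr2; under [X in X @ _]eq_fun do rewrite expr2; exact: cvgM.
apply: cvg_sum_seq => i _; apply: cvgM; first exact: cvg_cst.
by rewrite expr2; under [X in X @ _]eq_fun do rewrite expr2; exact: cvgM.
Qed.

End almost_sure_limits.

(** * Error of [s_hat] in Model (I) *)

Section wiener_observations.
Context {d : measure_display} {T : measurableType d} {R : realType}.
Variable P : probability T R.
Variables (W : R -> {RV P >-> R}) (eps : nat -> nat -> {RV P >-> R}).
Hypothesis hW : standard_brownian_motion W.
Hypothesis heps : noise_array W eps.
Local Notation I01 := (`[0%R, 1%R]%classic : set R).
Local Notation mu := (@lebesgue_measure R).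
Variables (f : R -> R) (M U : R) (t2 : R -> R) (n : nat).
Hypothesis n16 : (16 < n)%N.
Hypothesis mf : measurable_fun I01 f.
Hypothesis f_bound : forall x, 0 <= x <= 1 -> 0 <= f x <= M.
Hypothesis t_bound : forall x, 0 <= x <= 1 -> 0 <= t2 x <= U.

Lemma near_le_of_cvg0 (u : nat -> \bar R) (e : R) : 0 < e -> u @ \oo --> 0%E ->
  \forall m \near \oo, (u m <= e%:E)%E.
Proof.
move=> e0 /fine_cvgP[ufin /cvgrPdist_lt /(_ e e0) h].
near=> m; have um : u m \is a fin_num by near: m.
rewrite -(fineK um) lee_fin ltW // (le_lt_trans (ler_norm _)) //.
by rewrite -normrN -sub0r; near: m.
Unshelve. all: by end_near.
Qed.

(** The steps lie inside ]0, t], so beyond [t], and at 0, both the step function and [root_upto]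
    vanish. *)
Lemma step_dist_le (s : seq (R * R * R)) (t : R) : 0 <= t <= 1 ->
  (forall p, p \in s -> [/\ 0 <= p.1.1, p.1.1 <= p.1.2 & p.1.2 <= t]) ->
  ((step_dist f s t)%:E <=
   \int[mu]_(x in `[0%R, t]) ((step_fun s x - Num.sqrt (f x)) ^+ 2)%:E)%E.
Proof.
move=> /andP[t0 t1] vs.
have [_ <-] := has_int01_step_dist mf f_bound s t.
have -> : `[0%R, t]%classic = I01 `&` `[0%R, t]%classic.
  apply/esym/setIidPr => x /=; rewrite !in_itv /= => /andP[-> h] /=; exact: le_trans t1.
rewrite integral_mkcondr.
have mg : measurable_fun I01 (fun x => ((step_fun s x - Num.sqrt (f x)) ^+ 2)%:E).
  apply/measurable_EFinP; apply: measurable_funX; apply: measurable_funB.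
    exact: measurable_step_fun.
  by apply: measurableT_comp mf; exact: continuous_measurable_fun (@sqrt_continuous R).
have step0 x : (forall p, p \in s -> itv_ind p.1.1 p.1.2 x = 0) -> step_fun s x = 0.
  by move=> h; rewrite /step_fun big1_seq // => p /h; rewrite /itv_ind => ->; rewrite mulr0.
apply: ge0_le_integral => //.
- by move=> x _; rewrite lee_fin sqr_ge0.
- apply/measurable_EFinP; apply: measurable_funX; apply: measurable_funB.
    exact: measurable_step_fun.
  exact: measurable_root_upto.
- apply/(measurable_restrict _ (measurable_itv _) measurable01).
  by apply: measurable_funS mg.
move=> x /=; rewrite in_itv /= => /andP[x0 x1].
rewrite patchE mem_setE in_itv /= x0 /=; case: (leP x t) => xt; rewrite lee_fin.
  have [x0'|x0'] := ltP 0 x.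
    by rewrite /root_upto itv_indE x0' xt mulr1.
  rewrite step0; last first.
    move=> p ps; have [h _ _] := vs p ps; rewrite itv_indE; case: (boolP (_ && _)) => // /andP[h1 _].
    by have := lt_le_trans h1 x0'; rewrite ltNge h.
  by rewrite /root_upto itv_indE [0 < x]ltNge x0' /= mulr0 subrr expr0n sqr_ge0.
rewrite step0; last first.
  move=> p ps; have [_ _ h] := vs p ps; rewrite itv_indE; case: (boolP (_ && _)) => // /andP[_ h1].
  by have := le_lt_trans (le_trans h1 h) xt; rewrite ltxx.
by rewrite /root_upto itv_indE [x <= t]leNgt xt andbF /= mulr0 subrr expr0n.
Qed.

Lemma measurable_step_integral (s : seq (R * R * R)) :
  measurable_fun setT (step_integral (fun t => W t : T -> R) s).
Proof.
rewrite /step_integral; apply: measurable_sum => p.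
by apply: measurable_funM => //; exact: measurable_funB.
Qed.

(** For step integrals the grid bound holds with K = 1, whatever the approximation. A fast
    approximating sequence converges almost surely, [s_hat] is continuous in the data, and Fatou's
    lemma concludes. *)
Lemma wiener_s_hat_error (k : nat) (X : nat -> {RV P >-> R}) (Y : nat -> T -> R) :
  (forall i, (0 < i <= n)%N ->
     is_wiener_integral W (fun r => Num.sqrt (f r)) (i%:R / n%:R) (X i)) ->
  (forall i w, (0 < i <= n)%N -> Y i w = X i w + Num.sqrt (t2 (i%:R / n%:R)) * eps n i w) ->
  k%:R ^+ 2 <= Num.sqrt (n%:R : R) ->
  (\int[P]_w ((s_hat n (Y^~ w) k - s_target f k) ^+ 2)%:E <=
    (target_const eps M U 1 / Num.sqrt n%:R)%:E)%E.
Proof.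
move=> hX hY kq.
have n0 : (0 < n)%N by exact: leq_trans n16.
have nR0 : 0 < n%:R :> R by rewrite ltr0n.
pose x i : R := i%:R / n%:R.
have /choice[S hS] : forall i, exists s : nat -> seq (R * R * R), (0 < i <= n)%N ->
  [/\ forall l p, p \in s l -> [/\ 0 <= p.1.1, p.1.1 <= p.1.2 & p.1.2 <= x i],
      step_dist f (s l) (x i) @[l --> \oo] --> (0 : R) &
      (\int[P]_w ((step_integral W (s l) w - X i w) ^+ 2)%:E)%E @[l --> \oo] --> 0%E].
  move=> i; case: (boolP (0 < i <= n)%N) => hi; last by exists (fun=> [::]).
  have [s [s1 s2 s3]] := hX i hi; exists s => _; split => //.
  have /fine_cvg : (step_dist f (s l) (x i))%:E @[l --> \oo] --> 0%:E; last by [].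
  apply: squeeze_cvge (cvg_cst 0%E) s2; apply: nearW => l; apply/andP; split.
    rewrite lee_fin; apply: (le_has_integral measurable01 _ (has_int01_cst 0)
      (has_int01_step_dist mf f_bound (s l) (x i))) => y _; exact: sqr_ge0.
  apply: step_dist_le; last exact: s1.
  by apply: node_itv => //; case/andP: hi.
(* Division by n makes the sum over the n nodes at most 2^(-l), as [ae_cvg0] wants. *)
pose e l : R := 2^-1 ^+ l / n%:R.
have e0 l : 0 < e l by rewrite divr_gt0 // exprn_gt0 // invr_gt0.
have c0 := closeness_gt0 f_bound n0.
have /choice[m hm] : forall l : nat, exists m : nat, forall i : 'I_n,
    step_dist f (S i.+1 m) (x i.+1) <= closeness M n /\
    (\int[P]_w ((step_integral W (S i.+1 m) w - X i.+1 w) ^+ 2)%:E <= (e l)%:E)%E.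
  move=> l; suff h : \forall m \near \oo, forall i : 'I_n,
      step_dist f (S i.+1 m) (x i.+1) <= closeness M n /\
      (\int[P]_w ((step_integral W (S i.+1 m) w - X i.+1 w) ^+ 2)%:E <= (e l)%:E)%E.
    exact: (@filter_ex _ _ _ _ h).
  apply: filter_forall => i.
  have [_ h2 h3] := hS i.+1 (ltn_ord i).
  apply: filterI; last exact: near_le_of_cvg0.
  move/cvgrPdist_lt: h2 => /(_ _ c0); apply: filterS => m; rewrite sub0r normrN => h.
  exact: le_trans (ler_norm _) (ltW h).
pose V l i := step_integral W (S i (m l)).
pose Yl l i w := V l i w + Num.sqrt (t2 (x i)) * eps n i w.
have mV l i : measurable_fun setT (V l i) by exact: measurable_step_integral.
have mYl l i : measurable_fun setT (Yl l i).
  by apply: measurable_funD => //; exact: measurable_funM.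
have mY i : (1 <= i <= n)%N -> measurable_fun setT (Y i).
  move=> hi; have -> : Y i = (fun w => X i w + Num.sqrt (t2 (x i)) * eps n i w).
    by apply/funext => w; exact: hY.
  by apply: measurable_funD => //; exact: measurable_funM.
pose Z l w := \sum_(i < n) (V l i.+1 w - X i.+1 w) ^+ 2.
have hZ : {ae P, forall w, Z^~ w @ \oo --> (0 : R)}.
  apply: ae_cvg0.
  - move=> l; apply: measurable_sum => i; apply: measurable_funX; exact: measurable_funB.
  - by move=> l w; apply: sumr_ge0 => i _; exact: sqr_ge0.
  move=> l; under eq_integral do rewrite /Z -sumEFin.
  rewrite ge0_integral_sum //; last 2 first.
  - by move=> i; apply/measurable_EFinP; apply: measurable_funX; exact: measurable_funB.
  - by move=> i w _; rewrite lee_fin sqr_ge0.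
  apply: (@le_trans _ _ (\sum_(i < n) (e l)%:E)%E).
    by apply: lee_sum => i _; have [] := hm l i.
  rewrite sumEFin lee_fin sumr_const card_ord -[leLHS]mulr_natr /e divfK ?gt_eqF //.
apply: (fatou_le (f := fun l w => (s_hat n ((Yl l)^~ w) k - s_target f k) ^+ 2)).
- move=> l; apply: measurable_funX; apply: measurable_funB => //.
  by apply: measurable_s_hat => // i _; exact: mYl.
- by apply: measurable_funX; apply: measurable_funB => //; exact: measurable_s_hat.
- by move=> l w; exact: sqr_ge0.
- by move=> w; exact: sqr_ge0.
- apply: filterS hZ => w hw.
  have cv : (fun l => s_hat n ((Yl l)^~ w) k - s_target f k) @ \oo --> s_hat n (Y^~ w) k - s_target f k.
    apply: cvgB; last exact: cvg_cst.
    apply: cvg_s_hat => // i hi; rewrite hY //; apply: cvgD; last exact: cvg_cst.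
    apply/cvgrPdist_lt => r r0; have r2 : 0 < r ^+ 2 by rewrite exprn_gt0.
    move/cvgrPdist_lt: hw => /(_ _ r2); apply: filterS => l; rewrite sub0r normrN => h.
    rewrite -ltr_sqr ?nnegrE ?(ltW r0) // real_normK ?num_real // -sqrrN opprB.
    apply: le_lt_trans (le_lt_trans (ler_norm _) h).
    have hi' : (i.-1 < n)%N by case/andP: hi => i0 ilen; rewrite prednK.
    rewrite /Z (bigD1 (Ordinal hi')) //= prednK; last by case/andP: hi.
    by rewrite lerDl; apply: sumr_ge0 => j _; exact: sqr_ge0.
  by rewrite expr2; under [X in X @ _]eq_fun do rewrite expr2; exact: cvgM.
move=> l.
have [||kk [u [beta [u0 u1 um hb hC]]]] := step_grid mf f_bound n0 (s := fun i => S i (m l)).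
- move=> i p hi ps; have [h _ _] := hS i hi; have [h1 h2 h3] := h _ _ ps; split=> //.
  apply: le_trans h3 _; have /andP[_ ilen] := hi.
  by have /andP[] : 0 <= x i <= 1 by exact: node_itv.
- move=> i hi; have hi' : (i.-1 < n)%N by case/andP: hi => i0 ilen; rewrite prednK.
  have [+ _] := hm l (Ordinal hi'); rewrite /= prednK //; by case/andP: hi.
apply: (grid_s_hat_error hW heps n16 mf f_bound t_bound u0 u1 um hC _ kq).
move=> i w hi; rewrite /Yl; congr (_ + _).
by rewrite /V /step_integral (hb i (fun t => W t w) hi).
Qed.

End wiener_observations.

(** * Uniformity over the smoothness classes *)

Section uniform_risk.
Context {d : measure_display} {T : measurableType d} {R : realType}.
Variable P : probability T R.
Variables (W : R -> {RV P >-> R}) (eps : nat -> nat -> {RV P >-> R}).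
Hypothesis hW : standard_brownian_motion W.
Hypothesis heps : noise_array W eps.
Local Notation I01 := (`[0%R, 1%R]%classic : set R).
Local Notation mu := (@lebesgue_measure R).

(** With [observations_cst], shows that the supremum runs over a nonempty set; otherwise it would be
    minus infinity. *)
Lemma cst_Theta_sb (alpha Q l u : R) : 0 < Q -> l <= u -> Theta_sb alpha Q l u (fun=> l).
Proof.
move=> Q0 lu; split.
- split.
  + exact: measurable_cst.
  + by have [] := has_int01_cst (l ^+ 2).
  + exists (fun i => if i == 0%N then l else 0).
      rewrite (_ : (fun m => _) = fun=> 0%E); first exact: cvg_cst.
      apply/funext => m; apply: integral0_eq => x _.
      rewrite /cosine_sum big_nat big1 ?mulr0 ?addr0 ?subrr ?expr0n // => i /andP[i1 _].
      by rewrite eqn0Ngt i1 mul0r.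
    rewrite (_ : (\sum_(1 <= i <oo) _)%E = 0%E) ?lee_fin ?ltW //.
    apply: eseries0 => i i1 _.
    by rewrite eqn0Ngt i1 expr0n mulr0.
- by apply: continuous_subspaceT => x; exact: cvg_cst.
- by move=> x _; rewrite lexx lu.
Qed.

Lemma wiener_integral_cst (c x : R) : 0 <= x <= 1 ->
  exists X : {RV P >-> R}, is_wiener_integral W (fun=> c) x X.
Proof.
move=> /andP[x0 x1].
exists (cst c \* (W x \- W 0)); exists (fun=> [:: ((0, x), c)]); split.
- by move=> k p; rewrite inE => /eqP -> /=.
- rewrite (_ : (fun k => _) = fun=> 0%E); first exact: cvg_cst.
  apply/funext => k; rewrite -integral_itv_obnd_cbnd.
    apply: integral0_eq => y /=; rewrite in_itv /= => y0x.
    by rewrite /step_fun big_seq1 /= -/(itv_ind 0 x y) itv_indE y0x mulr1 subrr expr0n.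
  apply/measurable_EFinP; apply: measurable_funX; apply: measurable_funB => //.
  apply: (measurable_funS measurable01); last exact: measurable_step_fun.
  by move=> y /=; rewrite !in_itv /= => /andP[y0 yx]; rewrite (ltW y0) (le_trans yx).
- rewrite (_ : (fun k => _) = fun=> 0%E); first exact: cvg_cst.
  apply/funext => k; apply: integral0_eq => w _.
  by rewrite /step_integral big_seq1 /= subrr expr0n.
Qed.

Lemma observations_cst (m : model) (c : R) (t2 : R -> R) (n : nat) : (0 < n)%N ->
  exists Y : nat -> T -> R, observations m W eps (fun=> c) t2 n Y.
Proof.
move=> n0.
have x01 i : (0 < i <= n)%N -> 0 <= (i%:R / n%:R : R) <= 1.
  by move=> /andP[_ ilen]; rewrite divr_ge0 //= ler_pdivrMr ?ltr0n // mul1r ler_nat.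
case: m; last first.
  by exists (fun i w => Num.sqrt c * W (i%:R / n%:R) w + Num.sqrt (t2 (i%:R / n%:R)) * eps n i w).
have /choice[X hX] : forall i, exists X : {RV P >-> R}, (0 < i <= n)%N ->
    is_wiener_integral W (fun=> Num.sqrt c) (i%:R / n%:R) X.
  move=> i; case: (boolP (0 < i <= n)%N) => hi; last by exists (W 0).
  by have [X hX] := wiener_integral_cst (Num.sqrt c) (x01 i hi); exists X.
exists (fun i w => X i w + Num.sqrt (t2 (i%:R / n%:R)) * eps n i w) => i hi.
by exists (X i) => //; exact: hX.
Qed.

Lemma observations_measurable (m : model) (s2 t2 : R -> R) (n : nat) (Y : nat -> T -> R) :
  observations m W eps s2 t2 n Y ->
  forall i, (1 <= i <= n)%N -> measurable_fun setT (Y i).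
Proof.
move=> hY i /hY; case: m {hY} => [[X _ h]|h]; rewrite (funext h).
  by apply: measurable_funD => //; exact: measurable_funM.
by apply: measurable_funD; exact: measurable_funM.
Qed.

Lemma sqrt_lipschitz (a b l : R) : 0 < l -> l <= a -> l <= b ->
  `|Num.sqrt a - Num.sqrt b| <= `|a - b| / Num.sqrt l.
Proof.
move=> l0 la lb; have sl : 0 < Num.sqrt l by rewrite sqrtr_gt0.
have sa : Num.sqrt l <= Num.sqrt a by rewrite ler_wsqrtr.
rewrite ler_pdivlMr // -{2}(@sqr_sqrtr _ a) ?(le_trans (ltW l0)) //.
rewrite -{2}(@sqr_sqrtr _ b) ?(le_trans (ltW l0)) // subr_sqr normrM ler_wpM2l //.
rewrite ger0_norm ?addr_ge0 ?sqrtr_ge0 //.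
by apply: le_trans sa _; rewrite lerDl sqrtr_ge0.
Qed.

Variables (m : model) (alpha beta Q Qbar sigma_min sigma_max tau_min tau_max : R).
Hypothesis hsigma : 0 < sigma_min < sigma_max.
Hypothesis htau : 0 < tau_min < tau_max.
Hypothesis hQ : 0 < Q.
Hypothesis hQbar : 0 < Qbar.
Hypothesis halpha : (m = ModelI /\ 3 / 4 < alpha) \/ (m = ModelII /\ 3 / 2 < alpha).

Local Notation Ts := (Theta_sb alpha Q sigma_min sigma_max).
Local Notation Tt := (Theta_sb beta Qbar tau_min tau_max).

(** The constant depends only on the bounds, on [Q] and [alpha], and on the kurtosis. In Model (II)
    the lower bound on sigma^2 makes sigma Lipschitz as well. *)
Lemma s_hat_uniform_error : exists C : R, forall (s2 t2 : R -> R) (n k : nat) (Y : nat -> T -> R),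
  (16 < n)%N -> Ts s2 -> Tt t2 -> observations m W eps s2 t2 n Y ->
  k%:R ^+ 2 <= Num.sqrt (n%:R : R) ->
  (\int[P]_w ((s_hat n (Y^~ w) k - s_target s2 k) ^+ 2)%:E <= (C / Num.sqrt n%:R)%:E)%E.
Proof.
have /andP[s0 s1] := hsigma; have /andP[t0 t1] := htau.
have bs s2 : Ts s2 -> forall x, 0 <= x <= 1 -> 0 <= s2 x <= sigma_max.
  by move=> [_ _ h] x /h /andP[h1 ->]; rewrite (le_trans (ltW s0) h1).
have bt t2 : Tt t2 -> forall x, 0 <= x <= 1 -> 0 <= t2 x <= tau_max.
  by move=> [_ _ h] x /h /andP[h1 ->]; rewrite (le_trans (ltW t0) h1).
case: halpha => -[mE ha]; rewrite mE.
  exists (target_const eps sigma_max tau_max 1) => s2 t2 n k Y n16 hs ht hY kq.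
  have [[ms _ _] _ _] := hs.
  have /choice[X hX] : forall i, exists X : {RV P >-> R}, (0 < i <= n)%N ->
      is_wiener_integral W (fun r => Num.sqrt (s2 r)) (i%:R / n%:R) X /\
      forall w, Y i w = X w + Num.sqrt (t2 (i%:R / n%:R)) * eps n i w.
    move=> i; case: (boolP (0 < i <= n)%N) => hi; last by exists (W 0).
    by have [X h1 h2] := hY i hi; exists X.
  apply: (wiener_s_hat_error hW heps n16 ms (bs _ hs) (bt _ ht) (X := X)) => //.
  - by move=> i /hX[].
  - by move=> i w /hX[].
pose Lf := lipschitz_const alpha Q.
pose L := Lf * (1 + (Num.sqrt sigma_min)^-1).
exists (target_const eps sigma_max tau_max (L + 2 * Num.sqrt sigma_max * L + L ^+ 2)).
move=> s2 t2 n k Y n16 hs ht hY kq.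
have [th cs hb] := hs; have [ms _ _] := th.
have ns x : 0 <= x <= 1 -> `|s2 x| <= sigma_max.
  by move=> x01; have /andP[h1 h2] := bs _ hs x x01; rewrite ger0_norm.
have lip := Theta_lipschitz ms ns ha th cs.
have sm : 0 < Num.sqrt sigma_min by rewrite sqrtr_gt0.
have L0 : 0 <= Lf.
  have := lip 1 0; rewrite !lexx ler01 subr0 normr1 mulr1 => /(_ erefl erefl).
  by apply: le_trans.
apply: (brownian_s_hat_error hW heps n16 ms (bs _ hs) (bt _ ht) (L := L)) => //.
- move=> x y hx hy; apply: le_trans (lip x y hx hy) _.
  by rewrite ler_wpM2r // /L ler_peMr // lerDl invr_ge0 ltW.
- move=> x y hx hy.
  have /andP[h1 _] := hb x hx; have /andP[h2 _] := hb y hy.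
  apply: le_trans (sqrt_lipschitz s0 h1 h2) _.
  rewrite ler_pdivrMr //; apply: le_trans (lip x y hx hy) _.
  have -> : L * `|x - y| * Num.sqrt sigma_min = Lf * (Num.sqrt sigma_min + 1) * `|x - y|.
    by rewrite /L; field; rewrite gt_eqF.
  by rewrite ler_wpM2r // ler_peMr // lerDr ltW.
- by move=> i w hi; exact: hY.
Qed.

(** N <= n^(1/4) makes the bound on [s_hat] available for every k <= N. The lower bound 0 is part of
    the finiteness demanded by [ebigO]. *)
Lemma sup_MISE_bound : exists2 C : R, 0 < C & forall n N : nat,
  (16 < n)%N -> (0 < N)%N -> N%:R <= n%:R `^ (1 / 4) :> R ->
  (0 <= sup_MISE m W eps Ts Tt n N <=
    (C * (N%:R `^ (- (2 * alpha)) + N%:R * n%:R `^ (- (1 / 2))))%:E)%E.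
Proof.
have /andP[s0 s1] := hsigma; have /andP[t0 t1] := htau.
have [C hC] := s_hat_uniform_error.
have alpha0 : 0 < alpha by case: halpha => -[_]; lra.
pose C' := 2 * Q + 9 * `|C|.
have C'0 : 0 < C' by rewrite /C' ltr_pwDl // mulr_gt0.
exists C' => // n N n16 N0 Nn.
have n0 : (0 < n)%N by exact: leq_trans n16.
have q0 : 0 < Num.sqrt n%:R :> R by rewrite sqrtr_gt0 ltr0n.
apply/andP; split.
  have [Y hY] := observations_cst m sigma_min (fun=> tau_min) n0.
  apply: (@le_trans _ _ (MISE P (fun=> sigma_min) n N Y)).
    by apply: integral_ge0 => w _; apply: integral_ge0 => x _; rewrite lee_fin sqr_ge0.
  apply: ereal_sup_ubound; exists (fun=> sigma_min), (fun=> tau_min), Y; split=> //.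
    by apply: cst_Theta_sb => //; exact: ltW.
  by apply: cst_Theta_sb => //; exact: ltW.
apply: ge_ereal_sup => _ [s2 [t2 [Y [hs ht hY ->]]]].
have [th _ hb] := hs; have [ms _ _] := th.
have bs x : 0 <= x <= 1 -> 0 <= s2 x <= sigma_max.
  by move=> /hb /andP[h1 ->]; rewrite (le_trans (ltW s0) h1).
have N2 : N%:R ^+ 2 <= Num.sqrt (n%:R : R).
  rewrite -powR12_sqrt //; apply: le_trans (_ : (n%:R `^ (1 / 4)) ^+ 2 <= _).
    by rewrite ler_sqr ?nnegrE ?powR_ge0.
  by rewrite -powR_mulrn ?powR_ge0 // -powRrM (_ : 1 / 4 * 2%:R = 2^-1) //; lra.
apply: le_trans (MISE_le ms bs alpha0 th (B := `|C| / Num.sqrt n%:R) N0 _ _) _.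
- by move=> k; apply: measurable_s_hat => //; exact: observations_measurable hY.
- move=> k kN; apply: le_trans (hC s2 t2 n k Y n16 hs ht hY _) _.
    by apply: le_trans N2; rewrite ler_sqr ?nnegrE ?ler0n // ler_nat.
  by rewrite lee_fin ler_pM2r ?invr_gt0 // ler_norm.
rewrite lee_fin (_ : n%:R `^ (- (1 / 2)) = (Num.sqrt n%:R)^-1); last first.
  by rewrite powRN -powR12_sqrt // mul1r.
set a := N%:R `^ _; set b : R := (Num.sqrt n%:R)^-1; set c : R := N%:R.
have a0 : 0 <= a by exact: powR_ge0.
have b0 : 0 <= c * b by rewrite mulr_ge0 // invr_ge0 ltW.
have c0 : 0 <= `|C| by [].
rewrite /C'; have h1 : 0 <= Q * (c * b) by rewrite mulr_ge0 // ltW.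
have h2 : 0 <= `|C| * a by rewrite mulr_ge0.
lra.
Qed.

Lemma ebigO_sup_MISE (N : nat -> nat) (v : nat -> R) (K : R) : 0 < K ->
  (forall n, (0 < N n)%N) ->
  (\forall n \near \oo, (N n)%:R <= n%:R `^ (1 / 4) :> R) ->
  (\forall n \near \oo, (N n)%:R `^ (- (2 * alpha)) + (N n)%:R * n%:R `^ (- (1 / 2)) <= K * v n) ->
  ebigO (fun n => sup_MISE m W eps Ts Tt n (N n)) v.
Proof.
move=> K0 N0 hN hv; have [C C0 H] := sup_MISE_bound.
have {}H : \forall n \near \oo, (0 <= sup_MISE m W eps Ts Tt n (N n) <= (C * (K * v n))%:E)%E.
  near=> n.
  have n16 : (16 < n)%N by near: n; exact: nbhs_infty_gt.
  have Nn : (N n)%:R <= n%:R `^ (1 / 4) :> R by near: n.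
  have /andP[-> h] := H n (N n) n16 (N0 n) Nn.
  by apply: le_trans h _; rewrite lee_fin ler_pM2l //; near: n.
have {}fin : \forall n \near \oo, sup_MISE m W eps Ts Tt n (N n) \is a fin_num.
  by apply: filterS H => n /andP[h1 h2]; rewrite ge0_fin_numE // (le_lt_trans h2) ?ltry.
split=> //; apply/eqO_exP; exists (C * K); first exact: mulr_gt0.
apply: filterS2 H fin => n /andP[h1 h2] f.
rewrite ger0_norm ?fine_ge0 //; rewrite -(fineK f) lee_fin in h2.
apply: le_trans h2 _; rewrite mulrA ler_wpM2l ?ler_norm //.
by rewrite mulr_ge0 // ltW.
Unshelve. all: by end_near.
Qed.

End uniform_risk.

(** * The rates for a general and for the balanced cut-off *)

Theorem theorem2 (R : realType) (d : measure_display) (T : measurableType d)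
    (P : probability T R) (W : R -> {RV P >-> R})
    (eps : nat -> nat -> {RV P >-> R}) (m : model)
    (alpha beta Q Qbar sigma_min sigma_max tau_min tau_max : R)
    (hW : standard_brownian_motion W) (heps : noise_array W eps)
    (hsigma : 0 < sigma_min < sigma_max) (htau : 0 < tau_min < tau_max)
    (hbeta : 5 / 4 < beta) (hQ : 0 < Q) (hQbar : 0 < Qbar)
    (halpha : (m = ModelI /\ 3 / 4 < alpha) \/ (m = ModelII /\ 3 / 2 < alpha)) :
  let supMISE := sup_MISE m W eps (Theta_sb alpha Q sigma_min sigma_max)
                   (Theta_sb beta Qbar tau_min tau_max) in
  (forall N : nat -> nat,
     (forall n, (0 < N n)%N) ->
     (fun n => (N n)%:R : R) =o_\oo (fun n => n%:R `^ (1 / 4)) ->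
     ebigO (fun n => supMISE n (N n))
       (fun n => (N n)%:R `^ (- (2 * alpha)) + (N n)%:R * n%:R `^ (- (1 / 2)))) /\
  (forall Nstar : nat -> nat,
     (forall n, (0 < Nstar n)%N) ->
     (exists c1 c2 : R, [/\ 0 < c1, c1 <= c2 &
        \forall n \near \oo,
          c1 * n%:R `^ (1 / (4 * alpha + 2)) <= (Nstar n)%:R /\
          (Nstar n)%:R <= c2 * n%:R `^ (1 / (4 * alpha + 2))]) ->
     ebigO (fun n => supMISE n (Nstar n))
       (fun n => n%:R `^ (- (alpha / (2 * alpha + 1))))).
Proof.
split.
  (* The o-condition is used with the constant 1: N <= n^(1/4) eventually. *)
  move=> N N0 /eqoP /(_ 1 ltr01) hN.
  apply: (ebigO_sup_MISE hW heps beta hsigma htau hQ hQbar halpha ltr01 N0).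
    by apply: filterS hN => n; rewrite [leRHS]mul1r normr_nat (ger0_norm (powR_ge0 _ _)).
  by apply: nearW => n; rewrite [leRHS]mul1r.
move=> N N0 [c1 [c2 [c10 c12 hN]]].
have alpha0 : 3 / 4 < alpha by case: halpha => -[_]; lra.
have c20 : 0 < c2 by exact: lt_le_trans c12.
pose g := 1 / (4 * alpha + 2).
have g0 : 0 < g by rewrite divr_gt0 //; lra.
(* alpha > 1/2 gives 4 alpha + 2 > 4, so a cut-off of order n^g is eventually below n^(1/4),
   whatever the constant [c2]. *)
have gs : 0 < 1 / 4 - g.
  by rewrite /g subr_gt0 ltr_pM2l // ltf_pV2 ?posrE; lra.
have c1a : 0 < c1 `^ (- (2 * alpha)) by exact: powR_gt0.
apply: (ebigO_sup_MISE hW heps beta hsigma htau hQ hQbar halpha (addr_gt0 c1a c20) N0).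
  near=> n.
  have [_ h] : c1 * n%:R `^ g <= (N n)%:R /\ (N n)%:R <= c2 * n%:R `^ g by near: n.
  apply: le_trans h _.
  have cn : c2 `^ (1 / 4 - g)^-1 <= n%:R by near: n; exact: nbhs_infty_ger.
  have n0 : 0 < n%:R :> R by apply: lt_le_trans cn; exact: powR_gt0.
  rewrite [leRHS](_ : _ = n%:R `^ (1 / 4 - g) * n%:R `^ g); last first.
    by rewrite -powRD ?subrK // (gt_eqF n0) implybT.
  rewrite ler_wpM2r ?powR_ge0 //.
  rewrite [leLHS](_ : c2 = (c2 `^ (1 / 4 - g)^-1) `^ (1 / 4 - g)); last first.
    by rewrite -powRrM mulVf ?gt_eqF // powRr1 // ltW.
  by apply: ge0_ler_powR; rewrite ?nnegrE ?powR_ge0 ?(ltW gs) ?(ltW n0).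
near=> n.
have [h1 h2] : c1 * n%:R `^ g <= (N n)%:R /\ (N n)%:R <= c2 * n%:R `^ g by near: n.
have n0 : 0 < n%:R :> R by rewrite ltr0n; near: n; exact: nbhs_infty_gt.
have a2 : 2 * alpha + 1 != 0 by rewrite gt_eqF //; lra.
have a4 : 4 * alpha + 2 != 0 by rewrite gt_eqF //; lra.
(* The lower bound on the cut-off controls the approximation term and the upper bound the stochastic
   one; both exponents, - 2 alpha g and g - 1/2, equal - alpha / (2 alpha + 1). *)
rewrite [leRHS]mulrDl; apply: lerD.
  rewrite (_ : - (alpha / (2 * alpha + 1)) = g * - (2 * alpha)); last by rewrite /g; field; rewrite a2 a4.
  rewrite powRrM -powRM ?powR_ge0 ?(ltW c10) // !powRN lef_pV2 ?posrE.
  - by apply: ge0_ler_powR => //; rewrite ?nnegrE ?mulr_ge0 ?powR_ge0 ?(ltW c10) //; lra.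
  - by rewrite powR_gt0 // ltr0n.
  - by rewrite powR_gt0 // mulr_gt0 // powR_gt0.
rewrite (_ : - (alpha / (2 * alpha + 1)) = g - 1 / 2); last by rewrite /g; field; rewrite a2 a4.
rewrite powRD; last by rewrite (gt_eqF n0) implybT.
by rewrite mulrA ler_wpM2r ?powR_ge0.
Unshelve. all: by end_near.
Qed.
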